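(* Let $\Omega\subset\mathbb{R}^d$ be a compact set, let $\mathrm{P},\mathrm{Q}\in\mathcal{P}(\Omega)$, and let $\mathrm{P}_n$ (resp. $\mathrm{Q}_m$) be the empirical measure of an i.i.d. sample $\mathbf{X}_1,\dots,\mathbf{X}_n$ with law $\mathrm{P}$ (resp. $\mathbf{Y}_1,\dots,\mathbf{Y}_m$ with law $\mathrm{Q}$), the two samples being mutually independent. If $m=m(n)\to\infty$, $\frac{m}{n+m}\to\lambda\in(0,1)$ and $\eta\in L^\infty(\mathrm{P}\otimes\mathrm{Q})$, then $$\int\eta\,(d\pi_{\mathrm{P}_n,\mathrm{Q}_m}-d\pi_{\mathrm{P},\mathrm{Q}})=\frac1n\sum_{k=1}^n(1-\mathcal{A}_{\mathrm{Q}}\mathcal{A}_{\mathrm{P}})^{-1}\big(\eta_{\mathbf{x}}-\mathcal{A}_{\mathrm{Q}}\eta_{\mathbf{y}}\big)(\mathbf{X}_k)+\frac1m\sum_{j=1}^m(1-\mathcal{A}_{\mathrm{P}}\mathcal{A}_{\mathrm{Q}})^{-1}\big(\eta_{\mathbf{y}}-\mathcal{A}_{\mathrm{P}}\eta_{\mathbf{x}}\big)(\mathbf{Y}_j)+o_{\mathbb{P}}\left(\sqrt{\tfrac{n+m}{n\,m}}\right).$$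
   Context: Fix $\epsilon>0$. $\mathcal{P}(\Omega)$ is the set of Borel probability measures on $\Omega$. For $\mu,\nu\in\mathcal{P}(\Omega)$, $\pi_{\mu,\nu}$ denotes the unique minimizer of $\int\frac12\|\mathbf{x}-\mathbf{y}\|^2d\pi(\mathbf{x},\mathbf{y})+\epsilon H(\pi\mid\mu\otimes\nu)$ over couplings $\pi$ of $\mu$ and $\nu$, where $H(\alpha\mid\beta)=\int\log\frac{d\alpha}{d\beta}d\alpha$ if $\alpha\ll\beta$ and $+\infty$ otherwise. $\xi_{\mathrm{P},\mathrm{Q}}$ is the density of $\pi_{\mathrm{P},\mathrm{Q}}$ w.r.t. $\mathrm{P}\otimes\mathrm{Q}$; it has the form $\xi_{\mathrm{P},\mathrm{Q}}(\mathbf{x},\mathbf{y})=e^{(f_{\mathrm{P},\mathrm{Q}}(\mathbf{x})+g_{\mathrm{P},\mathrm{Q}}(\mathbf{y})-\frac12\|\mathbf{x}-\mathbf{y}\|^2)/\epsilon}$ with $f_{\mathrm{P},\mathrm{Q}},g_{\mathrm{P},\mathrm{Q}}$ the optimal dual potentials, and satisfies $\int\xi_{\mathrm{P},\mathrm{Q}}(\mathbf{x},\cdot)d\mathrm{P}(\mathbf{x})=1=\int\xi_{\mathrm{P},\mathrm{Q}}(\cdot,\mathbf{y})d\mathrm{Q}(\mathbf{y})$ on $\Omega$. $\mathcal{A}_{\mathrm{P}}f=\int\xi_{\mathrm{P},\mathrm{Q}}(\mathbf{x},\cdot)f(\mathbf{x})d\mathrm{P}(\mathbf{x})$ for $f\in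 L^2(\mathrm{P})$ and $\mathcal{A}_{\mathrm{Q}}g=\int\xi_{\mathrm{P},\mathrm{Q}}(\cdot,\mathbf{y})g(\mathbf{y})d\mathrm{Q}(\mathbf{y})$ for $g\in L^2(\mathrm{Q})$. ''1'' is the identity; $(1-\mathcal{A}_{\mathrm{Q}}\mathcal{A}_{\mathrm{P}})^{-1}$ is the inverse on $\{f\in L^2(\mathrm{P}):\int f\,d\mathrm{P}=0\}$ and $(1-\mathcal{A}_{\mathrm{P}}\mathcal{A}_{\mathrm{Q}})^{-1}$ the inverse on $\{g\in L^2(\mathrm{Q}):\int g\,d\mathrm{Q}=0\}$. $\eta_{\mathbf{x}}(\mathbf{x})=\int\eta(\mathbf{x},\mathbf{y})\xi_{\mathrm{P},\mathrm{Q}}(\mathbf{x},\mathbf{y})d\mathrm{Q}(\mathbf{y})$ and $\eta_{\mathbf{y}}(\mathbf{y})=\int\eta(\mathbf{x},\mathbf{y})\xi_{\mathrm{P},\mathrm{Q}}(\mathbf{x},\mathbf{y})d\mathrm{P}(\mathbf{x})$. $w_n=o_{\mathbb{P}}(a_n)$ means $w_n/a_n\to0$ in probability. *)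

(* Defs.v *)
From HB Require Import structures.
From mathcomp Require Import all_boot all_order all_algebra.
From mathcomp Require Import all_classical all_reals all_analysis.

Set Implicit Arguments.
Unset Strict Implicit.
Unset Printing Implicit Defensive.

Import Order.TTheory GRing.Theory Num.Theory.
Import numFieldNormedType.Exports.

Local Open Scope classical_set_scope.
Local Open Scope ring_scope.
Local Open Scope charge_scope.

(* R^d with the Borel sigma-algebra of its usual topology. *)
Notation borelRd R d := (g_sigma_algebraType (@open 'rV[R]_d)).

(* The library norm on 'rV[R]_d is the sup norm, so the squared Euclidean
   distance is written out. *)
Definition sqdist (R : realType) (d : nat) (x y : 'rV[R]_d) : R :=
  \sum_(i < d) (x ord0 i - y ord0 i) ^+ 2.

Section entropic_optimal_transport.
Context (R : realType).

Definition rel_entropy (d : measure_display) (T : measurableType d)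
    (a b : probability T R) : \bar R :=
  if pselect (a `<< b)
  then (\int[a]_z lne (('d (charge_of_finite_measure a) '/d b) z))%E
  else +oo%E.

(* A version of the density da/db; it is only determined b-almost everywhere,
   and so are the functions built from it below. *)
Definition density (d : measure_display) (T : measurableType d)
    (a b : probability T R) (z : T) : R :=
  fine (('d (charge_of_finite_measure a) '/d b) z).

Context (d : nat) (eps : R).
Local Notation E := (borelRd R d).

(* Marginals are compared on measurable sets only: the values of a library
   measure on other sets are unspecified. *)
Definition coupling (mu nu : probability E R) : set (probability (E * E)%type R) :=
  [set pi | forall A : set E, measurable A ->
     pushforward pi fst A = mu A /\ pushforward pi snd A = nu A].

Definition eot_cost (mu nu : probability E R)
    (pi : probability (E * E)%type R) : \bar R :=
  (\int[pi]_z (2^-1 * sqdist z.1 z.2)%:E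
   + eps%:E * rel_entropy pi (mu \x nu))%E.

Definition eot_minimizers (mu nu : probability E R) :
    set (probability (E * E)%type R) :=
  [set pi | coupling mu nu pi /\
     forall pi', coupling mu nu pi' -> (eot_cost mu nu pi <= eot_cost mu nu pi')%E].

Definition eot_plan (mu nu : probability E R) : probability (E * E)%type R :=
  get (eot_minimizers mu nu).

Definition eot_density (P Q : probability E R) (z : E * E) : R :=
  density (eot_plan P Q) (P \x Q)%E z.

Definition op_P (P Q : probability E R) (f : E -> R) (y : E) : R :=
  \int[P]_x (eot_density P Q (x, y) * f x).

Definition op_Q (P Q : probability E R) (g : E -> R) (x : E) : R :=
  \int[Q]_y (eot_density P Q (x, y) * g y).

Definition eta_x (P Q : probability E R) (eta : E * E -> R) (x : E) : R :=
  \int[Q]_y (eta (x, y) * eot_density P Q (x, y)).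

Definition eta_y (P Q : probability E R) (eta : E * E -> R) (y : E) : R :=
  \int[P]_x (eta (x, y) * eot_density P Q (x, y)).

End entropic_optimal_transport.

Section mean_zero_inverse.
Context (R : realType) (d : measure_display) (T : measurableType d).
Variable mu : probability T R.

Definition L2_mean_zero : set (T -> R) :=
  [set f | f \in Lfun mu 2%:E /\ \int[mu]_x f x = 0].

(* A representative of (1 - K)^{-1} phi in the mean-zero part of L^2(mu);
   elements of L^2(mu) are functions, with equality mu-almost everywhere. *)
Definition inv_one_sub (K : (T -> R) -> T -> R) (phi : T -> R) : T -> R :=
  xget (cst 0) [set h | L2_mean_zero h /\ h \- K h = phi %[ae mu]].

End mean_zero_inverse.

Section empirical.
Context (R : realType) (d : measure_display) (T : measurableType d).
Variables (x : nat -> T) (n : nat).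

(* Empirical measure of x 0, ..., x n.-1; the size n.-1.+1 is n as soon as
   n > 0, and makes this a probability measure for n = 0 as well. *)
Definition empirical : set T -> \bar R :=
  mscale (n.-1.+1%:R^-1)%:nng (msum (fun k => \d_(x k)) n.-1.+1).

HB.instance Definition _ := Measure.on empirical.

Let empirical_setT : empirical setT = 1%E.
Proof.
transitivity (n.-1.+1%:R^-1%:E * (\sum_(k < n.-1.+1) 1%:E) : \bar R)%E.
  by congr (_ * _)%E; apply: eq_bigr => k _; rewrite /= diracT.
by rewrite sumEFin sumr_const card_ord -EFinM mulVf.
Qed.

HB.instance Definition _ :=
  Measure_isProbability.Build _ _ _ empirical empirical_setT.

End empirical.
Arguments empirical {R d T}.

Section random_variables.
Context (R : realType) (dT : measure_display) (T : measurableType dT).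
Variable Pr : probability T R.

Definition has_law (d : measure_display) (E : measurableType d)
    (X : {RV Pr >-> E}) (P : probability E R) :=
  forall A : set E, measurable A -> distribution Pr X A = P A.

Definition mutually_independent (d : measure_display) (E : measurableType d)
    (I : choiceType) (Z : I -> {RV Pr >-> E}) :=
  forall (s : seq I) (A : I -> set E), uniq s ->
    (forall i, measurable (A i)) ->
    Pr (\big[setI/setT]_(i <- s) (Z i @^-1` A i))
      = (\prod_(i <- s) Pr (Z i @^-1` A i))%E.

(* Measurability of W n is part of the definition: otherwise the events below
   could be non-measurable, where the value of Pr is unspecified. *)
Definition cvg_in_probability (W : nat -> T -> R) (c : R) :=
  (forall n, measurable_fun setT (W n)) /\
  forall delta : R, 0 < delta ->
    Pr [set t | delta <= `|W n t - c|] @[n --> \oo] --> 0%E.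

Definition little_o_prob (w : nat -> T -> R) (a : nat -> R) :=
  cvg_in_probability (fun n t => w n t / a n) 0.

End random_variables.

(* Main.v *)
Require Import Defs.
From HB Require Import structures.
From mathcomp Require Import all_boot all_order all_algebra.
From mathcomp Require Import all_classical all_reals all_analysis.
From mathcomp Require Import measurable_realfun ess_sup_inf.
From mathcomp Require Import ring lra.
Import Order.TTheory GRing.Theory Num.Theory.
Import numFieldNormedType.Exports.
Set Implicit Arguments.
Unset Strict Implicit.
Unset Printing Implicit Defensive.
Local Open Scope classical_set_scope.
Local Open Scope ring_scope.
Local Open Scope charge_scope.

(** With respect to P \x Q the optimal plan has a density xi = a(x) k(x, y) b(y),
  where k is the Gibbs kernel of the cost, and the empirical plan has density
  xi e^w with respect to P_n \x Q_m, where w(x, y) = u(x) + v(y).  Let phi and psi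
  be the two influence functions and theta the integral of eta against the optimal
  plan.  They satisfy phi + A_Q psi + theta = eta_x and psi + A_P phi + theta = eta_y,
  so that zeta = eta - phi - psi - theta makes xi zeta integrate to zero in each
  variable.  As the empirical plan has marginals P_n and Q_m, the quantity to bound
  is exactly the P_n \x Q_m-average of xi e^w zeta.  Expanding e^w = 1 + w + O(w^2),
  the constant term is the average of a doubly degenerate kernel, of order
  (nm)^(-1/2); the linear term is at most the norm of w times the norms of the
  one-variable averages of xi zeta; and testing the marginal constraints against w
  bounds the L^2(P_n \x Q_m) norm of w by the sampling errors of the marginals
  of xi (strong concavity of the dual problem, the potentials being uniformly
  bounded).  All the squares involved have expectation O(1/n + 1/m), and Markov's
  inequality concludes.

  Plans of the form a k b exist, and depend measurably on the sample, because
  the Sinkhorn iteration contracts ratios geometrically; such a plan is the only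
  minimizer by the strict case of ln x <= x - 1. *)

(** * Bounded measurable functions *)

(** Densities and influence functions are given only up to null sets, while empirical measures
    charge single points. All of them are therefore replaced by bounded measurable versions whose
    identities hold at every point; almost surely the sample avoids the exceptional null sets. Such
    versions exist because truncating the cost keeps the Gibbs kernel between [expR (- M / eps)] and
    1 on the whole space, so that contractions in the sup norm replace spectral theory in L^2. The
    same two bounds control all plans at once: the population density and, for almost every sample,
    the empirical one lie between e^(-2M/eps) and e^(2M/eps), hence |w| is at most 4M/eps. The
    expansion of e^w thus has constants that depend neither on n nor on m, and no consistency of the
    empirical potentials has to be proved beforehand. With r = 1/n + 1/m, the square of the
    normalisation in the statement, the remainder is dominated by a variable of expectation O(r),
    and dividing by sqrt r leaves O(sqrt r). *)

Lemma measurable_inv_pos (R : realType) d (T : measurableType d) (f : T -> R) :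
  measurable_fun setT f -> (forall t, 0 < f t) -> measurable_fun setT (fun t => (f t)^-1).
Proof.
move=> mf f0; rewrite (_ : (fun t => _) = (fun t => expR (- ln (f t)))).
  by do 3 apply: measurableT_comp => //.
by apply/funext => t; rewrite expRN lnK// posrE.
Qed.

Section bounded_measurable.
Context (R : realType).

(** Such functions are integrable against every probability measure and are stable under ring
    operations and partial integration, so the side conditions of linearity and of Fubini's theorem
    reduce to closure properties of this class. *)
Definition bounded_measurable d (T : measurableType d) (f : T -> R) :=
  measurable_fun setT f /\ exists M, forall x, `|f x| <= M.

Section ring_operations.
Context d (T : measurableType d).
Implicit Types f g : T -> R.

Lemma bmf_cst c : bounded_measurable (fun _ : T => c).
Proof. by split; [exact: measurable_cst|exists `|c|]. Qed.

Lemma bmfD f g : bounded_measurable f -> bounded_measurable g ->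
  bounded_measurable (fun x => f x + g x).
Proof.
move=> [mf [M fM]] [mg [N gN]]; split; first exact: measurable_funD.
exists (M + N) => x; apply: le_trans (ler_normD _ _) _; exact: lerD.
Qed.

Lemma bmfN f : bounded_measurable f -> bounded_measurable (fun x => - f x).
Proof.
move=> [mf [M fM]]; split; first exact: measurableT_comp.
by exists M => x; rewrite normrN.
Qed.

Lemma bmfB f g : bounded_measurable f -> bounded_measurable g ->
  bounded_measurable (fun x => f x - g x).
Proof. by move=> hf hg; apply: bmfD => //; exact: bmfN. Qed.

Lemma bmfM f g : bounded_measurable f -> bounded_measurable g ->
  bounded_measurable (fun x => f x * g x).
Proof.
move=> [mf [M fM]] [mg [N gN]]; split; first exact: measurable_funM.
by exists (M * N) => x; rewrite normrM ler_pM.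
Qed.

Lemma bmf_norm f : bounded_measurable f -> bounded_measurable (fun x => `|f x|).
Proof.
move=> [mf [M fM]]; split; first exact: measurableT_comp.
by exists M => x; rewrite normr_id.
Qed.

Lemma bmf_sum n (F : 'I_n -> T -> R) : (forall i, bounded_measurable (F i)) ->
  bounded_measurable (fun x => \sum_(i < n) F i x).
Proof.
elim: n F => [|n IHn] F hF.
  by under eq_fun do rewrite big_ord0; exact: bmf_cst.
under eq_fun do rewrite big_ord_recr.
by apply: bmfD => //; exact: IHn.
Qed.

Lemma bmf_indic (A : set T) : measurable A -> bounded_measurable (\1_A : T -> R).
Proof.
move=> mA; split; first exact: measurable_indic.
by exists 1 => x; rewrite indicE; case: (_ \in _); rewrite ?normr1 ?normr0.
Qed.

(** Turns a function bounded only almost everywhere, or only at the sample points, into one bounded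
    everywhere without changing it where the bound holds. *)
Definition clamp (B r : R) := Num.max (- B) (Num.min r B).

Lemma clamp_id B r : `|r| <= B -> clamp B r = r.
Proof. by rewrite ler_norml => /andP[h1 h2]; rewrite /clamp min_l// max_r. Qed.

Lemma bmf_clamp f B : 0 <= B -> measurable_fun setT f ->
  bounded_measurable (fun x => clamp B (f x)).
Proof.
move=> B0 mf; split; first by apply: measurable_maxr => //; exact: measurable_minr.
exists B => x; rewrite ler_norml le_max lexx/= ge_max ge_min lexx orbT andbT.
by rewrite lerNl; lra.
Qed.

Lemma bmf_inv f c : 0 < c -> bounded_measurable f -> (forall x, c <= f x) ->
  bounded_measurable (fun x => (f x)^-1).
Proof.
move=> c0 [mf _] cf; split.
  by apply: measurable_inv_pos => // x; exact: lt_le_trans (cf x).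
exists c^-1 => x; have fx0 : 0 < f x := lt_le_trans c0 (cf x).
by rewrite gtr0_norm ?invr_gt0// lef_pV2.
Qed.

End ring_operations.

Section integral.
Context d (T : measurableType d) (mu : probability T R).
Implicit Types f g : T -> R.

Lemma bmf_integrable f : bounded_measurable f -> mu.-integrable setT (EFin \o f).
Proof.
move=> [mf [M fM]]; apply: measurable_bounded_integrable => //.
  by apply: (le_lt_trans (probability_le1 mu _)) => //; rewrite ltry.
by exists M; split; [exact: num_real|move=> x Mx t _; apply: (le_trans (fM t)); exact: ltW].
Qed.

Lemma bmf_intD f g : bounded_measurable f -> bounded_measurable g ->
  \int[mu]_x (f x + g x) = \int[mu]_x f x + \int[mu]_x g x.
Proof. by move=> hf hg; rewrite RintegralD//; exact: bmf_integrable. Qed.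

Lemma bmf_intB f g : bounded_measurable f -> bounded_measurable g ->
  \int[mu]_x (f x - g x) = \int[mu]_x f x - \int[mu]_x g x.
Proof. by move=> hf hg; rewrite RintegralB//; exact: bmf_integrable. Qed.

Lemma bmf_intZ f c : bounded_measurable f ->
  \int[mu]_x (c * f x) = c * \int[mu]_x f x.
Proof. by move=> hf; rewrite RintegralZl//; exact: bmf_integrable. Qed.

Lemma bmf_intZr f c : bounded_measurable f ->
  \int[mu]_x (f x * c) = \int[mu]_x f x * c.
Proof. by move=> hf; rewrite RintegralZr//; exact: bmf_integrable. Qed.

Lemma Rint_cst c : \int[mu]_x c = c.
Proof. by rewrite Rintegral_cst// [X in fine X](probability_setT mu) mulr1. Qed.

Lemma probability_Rint A : measurable A -> mu A = (\int[mu]_x \1_A x)%:E.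
Proof.
by move=> mA; rewrite /Rintegral integral_indic// setIT fineK//; exact: fin_num_measure.
Qed.

Lemma bmf_int_sum n (F : 'I_n -> T -> R) : (forall i, bounded_measurable (F i)) ->
  \int[mu]_x (\sum_(i < n) F i x) = \sum_(i < n) \int[mu]_x F i x.
Proof.
elim: n F => [|n IHn] F hF.
  by under eq_Rintegral do rewrite big_ord0; rewrite Rint_cst big_ord0.
under eq_Rintegral do rewrite big_ord_recr/=.
by rewrite bmf_intD//; [rewrite IHn// big_ord_recr|exact: bmf_sum].
Qed.

Lemma bmf_le f g : bounded_measurable f -> bounded_measurable g ->
  (forall x, f x <= g x) -> \int[mu]_x f x <= \int[mu]_x g x.
Proof. by move=> hf hg fg; apply: le_Rintegral => //; exact: bmf_integrable. Qed.

Lemma bmf_int_norm f M : bounded_measurable f -> (forall x, `|f x| <= M) ->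
  `|\int[mu]_x f x| <= M.
Proof.
move=> hf fM; apply: (le_trans (le_normr_Rintegral _ _)) => //.
  exact: bmf_integrable.
by rewrite -[leRHS]Rint_cst; apply: bmf_le => //; [exact: bmf_norm|exact: bmf_cst].
Qed.

Lemma Rint_ae_eq f g : measurable_fun setT f -> measurable_fun setT g ->
  f = g %[ae mu] -> \int[mu]_x f x = \int[mu]_x g x.
Proof.
move=> mf mg fg; congr fine; apply: ae_eq_integral => //.
- exact/measurable_EFinP.
- exact/measurable_EFinP.
- by apply: filterS fg => x /= fgx /fgx ->.
Qed.

End integral.

Section product.
Context d1 (T1 : measurableType d1) d2 (T2 : measurableType d2).
Context (mu : probability T1 R) (nu : probability T2 R).

Lemma bmf_pair1 (f : T1 * T2 -> R) x : bounded_measurable f ->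
  bounded_measurable (fun y => f (x, y)).
Proof.
move=> [mf [M fM]]; split; last by exists M => y; exact: fM.
exact: measurableT_comp mf (measurable_pair1 x).
Qed.

Lemma bmf_pair2 (f : T1 * T2 -> R) y : bounded_measurable f ->
  bounded_measurable (fun x => f (x, y)).
Proof.
move=> [mf [M fM]]; split; last by exists M => x; exact: fM.
exact: measurableT_comp mf (measurable_pair2 y).
Qed.

Lemma bmf_swap (f : T1 * T2 -> R) : bounded_measurable f ->
  bounded_measurable (fun z : T2 * T1 => f (z.2, z.1)).
Proof.
move=> [mf [M fM]]; split; last by exists M => z; exact: fM.
by apply: (measurableT_comp mf); exact: measurable_swap.
Qed.

Lemma bmf_comp d3 (T3 : measurableType d3) (g : T3 -> T1) (f : T1 -> R) :
  measurable_fun setT g -> bounded_measurable f ->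
  bounded_measurable (fun x => f (g x)).
Proof.
move=> mg [mf [M fM]]; split; last by exists M => z; exact: fM.
exact: measurableT_comp.
Qed.

Lemma bmf_fst (f : T1 -> R) : bounded_measurable f ->
  bounded_measurable (fun z : T1 * T2 => f z.1).
Proof.
move=> [mf [M fM]]; split; last by exists M => z; exact: fM.
exact: measurableT_comp mf measurable_fst.
Qed.

Lemma bmf_snd (f : T2 -> R) : bounded_measurable f ->
  bounded_measurable (fun z : T1 * T2 => f z.2).
Proof.
move=> [mf [M fM]]; split; last by exists M => z; exact: fM.
exact: measurableT_comp mf measurable_snd.
Qed.

(** No boundedness is assumed, since [eot_density] and [eta] are only known to be measurable;
    Tonelli applies to the positive and negative parts separately. *)
Lemma measurable_Rint2 (f : T1 * T2 -> R) : measurable_fun setT f ->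
  measurable_fun setT (fun x => \int[nu]_y f (x, y)).
Proof.
move=> mf; apply: measurableT_comp => //.
have mF : measurable_fun setT (EFin \o f) by exact/measurable_EFinP.
rewrite (_ : (fun x => _) = (fun x => \int[nu]_y (EFin \o f)^\+%E (x, y))
  \- (fun x => \int[nu]_y (EFin \o f)^\-%E (x, y)))%E.
  apply: emeasurable_funB.
    by apply: measurable_fun_fubini_tonelli_F => //; exact: measurable_funepos.
  by apply: measurable_fun_fubini_tonelli_F => //; exact: measurable_funeneg.
by apply/funext => x; rewrite [LHS]integralE; congr (_ - _)%E; apply: eq_integral => y _; rewrite ?funeposE ?funenegE.
Qed.

Lemma bmf_int2 (f : T1 * T2 -> R) : bounded_measurable f ->
  bounded_measurable (fun x => \int[nu]_y f (x, y)).
Proof.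
move=> hf; have [mf [M fM]] := hf; split; first exact: measurable_Rint2.
by exists M => x; apply: bmf_int_norm => //; exact: bmf_pair1.
Qed.

Lemma bmf_Fubini1 (f : T1 * T2 -> R) : bounded_measurable f ->
  \int[(mu \x nu)%E]_z f z = \int[mu]_x \int[nu]_y f (x, y).
Proof.
move=> hf; rewrite /Rintegral -integral12_prod_meas1; last exact: bmf_integrable.
congr fine; apply: eq_integral => x _; rewrite /fubini_F/= fineK//.
by apply: integrable_fin_num => //; apply: bmf_integrable; exact: bmf_pair1.
Qed.

Lemma bmf_Fubini2 (f : T1 * T2 -> R) : bounded_measurable f ->
  \int[(mu \x nu)%E]_z f z = \int[nu]_y \int[mu]_x f (x, y).
Proof.
move=> hf; rewrite /Rintegral -integral21_prod_meas1; last exact: bmf_integrable.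
congr fine; apply: eq_integral => x _; rewrite /fubini_G/= fineK//.
by apply: integrable_fin_num => //; apply: bmf_integrable; exact: bmf_pair2.
Qed.

End product.
End bounded_measurable.

(** * Convergence of the Sinkhorn iteration *)

Section geometric_limit.
Context (R : realType).

(** With D = C / (1 - q), the intervals of centre [u n] and radius D q^n are nested, because C q^n +
    D q^(n+1) = D q^n. The infimum of their right ends lies in all of them and gives the limit by an
    explicit formula. *)
Lemma geometric_cauchy_limit (u : nat -> R) (q C : R) :
  0 <= q -> q < 1 -> (forall n, `|u n.+1 - u n| <= C * q ^+ n) ->
  forall n, `|u n - inf (range (fun n => u n + C / (1 - q) * q ^+ n))|
    <= C / (1 - q) * q ^+ n.
Proof.
move=> q0 q1 hu; set D := C / (1 - q).
have DC : D * (1 - q) = C by rewrite /D divfK// subr_eq0 gt_eqF.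
have D0 : 0 <= D.
  apply: divr_ge0; last by rewrite subr_ge0 ltW.
  by have := hu 0%N; rewrite expr0 mulr1 => /(le_trans (normr_ge0 _)).
have Dq n : 0 <= D * q ^+ n by rewrite mulr_ge0// exprn_ge0.
have step n : D * q ^+ n = C * q ^+ n + D * q ^+ n.+1.
  by rewrite -DC exprS; ring.
have lo n k : u n - D * q ^+ n <= u (n + k)%N - D * q ^+ (n + k).
  elim: k => [|k IHk]; first by rewrite addn0.
  apply: le_trans IHk _; rewrite addnS step.
  by have := hu (n + k)%N; rewrite ler_norml => /andP[]; lra.
have hi n k : u (n + k)%N + D * q ^+ (n + k) <= u n + D * q ^+ n.
  elim: k => [|k IHk]; first by rewrite addn0.
  apply: le_trans _ IHk; rewrite addnS (step (n + k)%N).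
  by have := hu (n + k)%N; rewrite ler_norml => /andP[]; lra.
have lohi n p : u n - D * q ^+ n <= u p + D * q ^+ p.
  have h1 := lo n p; have h2 := hi p n; have := Dq (n + p)%N.
  by rewrite (addnC p n) in h2; lra.
move=> n; pose S := range (fun n => u n + D * q ^+ n); rewrite -/S; set l := inf S.
have S0 : S !=set0 by exists (u 0%N + D * q ^+ 0), 0%N.
have lbS p : lbound S (u p - D * q ^+ p) by move=> _ [j _ <-]; exact: lohi.
have l1 : u n - D * q ^+ n <= l by apply: lb_le_inf.
have l2 : l <= u n + D * q ^+ n.
  by apply: ge_inf; [exists (u 0%N - D * q ^+ 0); exact: lbS|exists n].
by rewrite ler_norml; apply/andP; split; lra.
Qed.

Lemma geometric_bound_cvg (u : nat -> R) (l q D : R) : 0 <= q -> q < 1 ->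
  (forall n, `|u n - l| <= D * q ^+ n) -> u n @[n --> \oo] --> l.
Proof.
move=> q0 q1 hu.
have D0 : D * q ^+ n @[n --> \oo] --> 0.
  rewrite -(mulr0 D); apply: cvgM; first exact: cvg_cst.
  by apply: cvg_expr; rewrite ger0_norm.
apply/cvgrPdist_le => e e0.
move/cvgrPdist_le : D0 => /(_ e e0); apply: filterS => n.
rewrite sub0r normrN => h; rewrite distrC; apply: le_trans (hu n) _.
exact: le_trans (ler_norm _) h.
Qed.

Lemma geometric_bound_eq0 (r q D : R) : 0 <= q -> q < 1 -> 0 <= r ->
  (forall n, r <= D * q ^+ n) -> r = 0.
Proof.
move=> q0 q1 r0 hr.
have h : (fun=> r) n @[n --> \oo] --> (0 : R).
  apply: (geometric_bound_cvg q0 q1) => n.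
  by rewrite subr0 ger0_norm//; exact: hr.
by rewrite -(cvg_lim _ h)// lim_cst.
Qed.

Lemma bmf_geometric_limit d (T : measurableType d) (u : nat -> T -> R) (q C : R) :
  0 <= q -> q < 1 -> (forall n, bounded_measurable (u n)) ->
  (forall n x, `|u n.+1 x - u n x| <= C * q ^+ n) ->
  exists v, bounded_measurable v /\
    forall n x, `|u n x - v x| <= C / (1 - q) * q ^+ n.
Proof.
move=> q0 q1 bu hu.
pose v x := inf (range (fun n => u n x + C / (1 - q) * q ^+ n)).
have uv n x : `|u n x - v x| <= C / (1 - q) * q ^+ n.
  exact: (@geometric_cauchy_limit (u ^~ x)).
exists v; split => //; split.
  apply: (@measurable_fun_cvg _ _ _ _ u) => [n|x _]; first by case: (bu n).
  exact: geometric_bound_cvg (uv ^~ x).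
have [_ [M uM]] := bu 0%N; exists (M + C / (1 - q)) => x.
have := uv 0%N x; have := uM x; rewrite expr0 mulr1 !ler_norml.
by move=> /andP[? ?] /andP[? ?]; apply/andP; split; lra.
Qed.

End geometric_limit.

Lemma ln_le_sub1 (R : realType) (x : R) : 0 < x -> ln x <= x - 1.
Proof.
move=> x0; rewrite -[X in ln X](subrKC 1) le_ln1Dx// ltrBrDr addNr//.
Qed.

(** Since ln r <= r - 1, the ratio r = t / s satisfies ln r <= M - 1 and - ln r <= 1/m - 1; both are
    at most (M - m)/m when m <= 1 <= M. *)
Lemma ln_ratio_bound (R : realType) (s t m M : R) : 0 < s -> 0 < t -> 0 < m ->
  m * s <= t <= M * s -> m <= 1 <= M -> `|ln t - ln s| <= (M - m) / m.
Proof.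
move=> s0 t0 m0 /andP[h1 h2] /andP[m1 M1].
rewrite -ln_div ?posrE//.
have r0 : 0 < t / s by exact: divr_gt0.
have rm : m <= t / s by rewrite ler_pdivlMr.
have rM : t / s <= M by rewrite ler_pdivrMr.
have mV : 1 <= m^-1 by rewrite invf_ge1.
rewrite ler_norml; apply/andP; split.
  rewrite lerNl -lnV ?posrE//.
  apply: le_trans (ln_le_sub1 _) _; first by rewrite invr_gt0.
  have : (t / s)^-1 <= m^-1 by rewrite lef_pV2.
  have -> : (M - m) / m = M / m - 1 by field; rewrite gt_eqF.
  have : 1 / m <= M / m by rewrite ler_pM2r ?invr_gt0.
  by rewrite mul1r; lra.
apply: le_trans (ln_le_sub1 r0) _.
have : (M - m) * 1 <= (M - m) / m by rewrite ler_wpM2l//; lra.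
lra.
Qed.

Lemma ln_expR_bound (R : realType) (s t e : R) : 0 < s -> 0 < t ->
  expR (- e) * s <= t <= expR e * s -> `|ln t - ln s| <= e.
Proof.
move=> s0 t0 /andP[h1 h2].
have h3 : - e + ln s <= ln t by rewrite -ler_expR expRD !lnK.
have h4 : ln t <= e + ln s by rewrite -ler_expR expRD !lnK.
by rewrite ler_norml; apply/andP; split; lra.
Qed.

Section scaling_step.
Context (R : realType) d1 (T1 : measurableType d1) d2 (T2 : measurableType d2).
Context (nu : probability T2 R) (k : T1 * T2 -> R) (dl : R).
Hypotheses (dl0 : 0 < dl) (bk : bounded_measurable k).
Hypotheses (dlk : forall z, dl <= k z) (k1 : forall z, k z <= 1).

Definition positive_measurable d (T : measurableType d) (b : T -> R) :=
  bounded_measurable b /\ exists2 c, 0 < c & forall x, c <= b x.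

Definition kernel_op (b : T2 -> R) (x : T1) : R := \int[nu]_y (k (x, y) * b y).

(** Half a Sinkhorn iteration: the factor a(x) for which a(x) k(x, y) b(y) integrates to 1 in y. *)
Definition scaling (b : T2 -> R) (x : T1) : R := (kernel_op b x)^-1.

Lemma positive_gt0 d (T : measurableType d) (b : T -> R) x :
  positive_measurable b -> 0 < b x.
Proof. by move=> [_ [c c0 cb]]; exact: lt_le_trans (cb x). Qed.

Lemma bmf_ln d (T : measurableType d) (f : T -> R) : positive_measurable f ->
  bounded_measurable (fun x => ln (f x)).
Proof.
move=> [[mf [N fN]] [c c0 cf]]; split; first exact: measurableT_comp.
exists (`|ln N| + `|ln c|) => x.
have f0 : 0 < f x by exact: lt_le_trans (cf x).
have h1 : ln c <= ln (f x) by rewrite ler_ln ?posrE.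
have h2 : ln (f x) <= ln N.
  have xN : f x <= N by exact: le_trans (ler_norm _) (fN x).
  by rewrite ler_ln ?posrE// (lt_le_trans f0).
have := ler_norm (ln N); have := ler_norm (- ln c); rewrite normrN => h3 h4.
have := normr_ge0 (ln N); have := normr_ge0 (ln c) => h5 h6.
by rewrite ler_norml; apply/andP; split; lra.
Qed.

Lemma bmf_kernel (b : T2 -> R) x : bounded_measurable b ->
  bounded_measurable (fun y => k (x, y) * b y).
Proof. by move=> bb; apply: bmfM => //; exact: bmf_pair1. Qed.

Lemma bmf_kernel_op (b : T2 -> R) : bounded_measurable b ->
  bounded_measurable (kernel_op b).
Proof.
move=> bb; apply: (@bmf_int2 _ _ _ _ _ _ (fun z => k z * b z.2)).
by apply: bmfM => //; exact: bmf_snd.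
Qed.

Lemma positive_kernel_op (b : T2 -> R) : positive_measurable b ->
  positive_measurable (kernel_op b).
Proof.
move=> [bb [c c0 cb]]; split; first exact: bmf_kernel_op.
exists (dl * c) => [|x]; first exact: mulr_gt0.
rewrite -[leLHS](Rint_cst nu); apply: bmf_le; [exact: bmf_cst|exact: bmf_kernel|].
by move=> y; apply: ler_pM => //; exact: ltW.
Qed.

Lemma positive_inv d (T : measurableType d) (b : T -> R) :
  positive_measurable b -> positive_measurable (fun x => (b x)^-1).
Proof.
move=> [bb [c c0 cb]]; split; first exact: bmf_inv c0 bb cb.
have [_ [M bM]] := bb; exists (`|M| + 1)^-1 => [|x].
  by rewrite invr_gt0 ltr_wpDl.
have bx0 : 0 < b x by exact: lt_le_trans (cb x).
rewrite lef_pV2 ?posrE// ?ltr_wpDl//.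
have := bM x; rewrite gtr0_norm// => /le_trans; apply.
by rewrite (le_trans (ler_norm _))// lerDl.
Qed.

Lemma positive_scaling (b : T2 -> R) : positive_measurable b ->
  positive_measurable (scaling b).
Proof. by move=> pb; exact/positive_inv/positive_kernel_op. Qed.

(* Integrating b' - m b >= 0 against the kernel yields at least dl times its
   mass: this moves both bounds on the ratio towards r. *)
Lemma kernel_op_contraction (b b' : T2 -> R) (m M : R) :
  positive_measurable b -> positive_measurable b' ->
  (forall y, m * b y <= b' y <= M * b y) ->
  let r := \int[nu]_y b' y / \int[nu]_y b y in
  m <= r <= M /\
  forall x, ((1 - dl) * m + dl * r) * kernel_op b x <= kernel_op b' x
            <= ((1 - dl) * M + dl * r) * kernel_op b x.
Proof.
move=> pb pb' mM; have [bb _] := pb; have [bb' _] := pb'.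
have hmb c : bounded_measurable (fun y => c * b y).
  by apply: bmfM => //; exact: bmf_cst.
set I := \int[nu]_y b y; set I' := \int[nu]_y b' y => r.
have I0 : 0 < I.
  have [_ [c c0 cb]] := pb; apply: (lt_le_trans c0).
  by rewrite -[leLHS](Rint_cst nu); apply: bmf_le => //; exact: bmf_cst.
have rI : I' = r * I by rewrite /r divfK// gt_eqF.
have mr : m <= r.
  rewrite -(ler_pM2r I0) -rI -bmf_intZ//; apply: bmf_le => // y.
  by have /andP[] := mM y.
have rM : r <= M.
  rewrite -(ler_pM2r I0) -rI -bmf_intZ//; apply: bmf_le => // y.
  by have /andP[] := mM y.
split; first by rewrite mr.
move=> x.
have KI : kernel_op b x <= I.
  apply: bmf_le => [|//|y]; first exact: bmf_kernel.
  by rewrite ler_piMl// ltW// positive_gt0.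
have lower : dl * (I' - m * I) <= kernel_op b' x - m * kernel_op b x.
  rewrite -!bmf_intZ//; last exact: bmf_kernel.
  rewrite -bmf_intB// -bmf_intZ; last exact: bmfB.
  rewrite -bmf_intB; [|exact: bmf_kernel| ]; last first.
    by apply: bmfM; [exact: bmf_cst|exact: bmf_kernel].
  apply: bmf_le => [||y].
  - by apply: bmfM; [exact: bmf_cst|exact: bmfB].
  - by apply: bmfB; [exact: bmf_kernel|apply: bmfM; [exact: bmf_cst|exact: bmf_kernel]].
  have /andP[h _] := mM y; rewrite mulrCA -mulrBr.
  by rewrite ler_wpM2r// subr_ge0.
have upper : dl * (M * I - I') <= M * kernel_op b x - kernel_op b' x.
  rewrite -!bmf_intZ//; last exact: bmf_kernel.
  rewrite -bmf_intB// -bmf_intZ; last exact: bmfB.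
  rewrite -bmf_intB; [| |exact: bmf_kernel]; last first.
    by apply: bmfM; [exact: bmf_cst|exact: bmf_kernel].
  apply: bmf_le => [||y].
  - by apply: bmfM; [exact: bmf_cst|exact: bmfB].
  - by apply: bmfB; [apply: bmfM; [exact: bmf_cst|exact: bmf_kernel]|exact: bmf_kernel].
  have /andP[_ h] := mM y; rewrite mulrCA -mulrBr.
  by rewrite ler_wpM2r// subr_ge0.
have e1 : dl * ((r - m) * kernel_op b x) <= dl * (I' - m * I).
  by rewrite rI -mulrBl ler_pM2l// ler_wpM2l// subr_ge0.
have e2 : dl * ((M - r) * kernel_op b x) <= dl * (M * I - I').
  by rewrite rI -mulrBl ler_pM2l// ler_wpM2l// subr_ge0.
by apply/andP; split; nra.
Qed.

(** The bounds of [kernel_op_contraction] are at least as good as m and M, because r lies between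
    them. Taking inverses exchanges the roles of b and b'. *)
Lemma scaling_monotone (b b' : T2 -> R) (m M : R) :
  positive_measurable b -> positive_measurable b' ->
  (forall y, m * b y <= b' y <= M * b y) ->
  forall x, m * scaling b' x <= scaling b x <= M * scaling b' x.
Proof.
move=> pb pb' mM x; have [+ /(_ x)] := kernel_op_contraction pb pb' mM.
set r := _ / _ => /andP[mr rM] /andP[h1 h2].
have B := positive_gt0 x (positive_kernel_op pb).
have B' := positive_gt0 x (positive_kernel_op pb').
have dmr : dl * m <= dl * r by rewrite ler_pM2l.
have drM : dl * r <= dl * M by rewrite ler_pM2l.
have hm : m * kernel_op b x <= kernel_op b' x.
  by apply: le_trans h1; rewrite ler_pM2r//; lra.
have hM : kernel_op b' x <= M * kernel_op b x.
  by apply: le_trans h2 _; rewrite ler_pM2r//; lra.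
rewrite /scaling; apply/andP; split.
  by rewrite ler_pdivrMr// [leRHS]mulrC ler_pdivlMr.
by rewrite ler_pdivlMr// mulrC ler_pdivrMr.
Qed.

Lemma scaling_contraction (b b' : T2 -> R) (m M : R) : dl <= 1 ->
  positive_measurable b -> positive_measurable b' ->
  (forall y, m * b y <= b' y <= M * b y) ->
  exists m' M', [/\ m <= m', M' - m' = (1 - dl) * (M - m) &
    forall x, m' * scaling b' x <= scaling b x <= M' * scaling b' x].
Proof.
move=> dl1 pb pb' mM; have [+ H] := kernel_op_contraction pb pb' mM.
set r := _ / _ in H * => /andP[mr rM].
exists ((1 - dl) * m + dl * r), ((1 - dl) * M + dl * r); split.
- by have : dl * m <= dl * r; [rewrite ler_pM2l|lra].
- by ring.
move=> x; have /andP[h1 h2] := H x.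
have B := positive_gt0 x (positive_kernel_op pb).
have B' := positive_gt0 x (positive_kernel_op pb').
rewrite /scaling; apply/andP; split.
  by rewrite ler_pdivrMr// [leRHS]mulrC ler_pdivlMr.
by rewrite ler_pdivlMr// mulrC ler_pdivrMr.
Qed.

End scaling_step.

Definition swap_kernel (R : Type) (T1 T2 : Type) (k : T1 * T2 -> R) (z : T2 * T1) :=
  k (z.2, z.1).

Section sinkhorn.
Context (R : realType) d1 (T1 : measurableType d1) d2 (T2 : measurableType d2).
Context (mu : probability T1 R) (nu : probability T2 R).
Context (k : T1 * T2 -> R) (dl : R).
Hypotheses (dl0 : 0 < dl) (bk : bounded_measurable k).
Hypotheses (dlk : forall z, dl <= k z) (k1 : forall z, k z <= 1).

Let k' := swap_kernel k.
Let bk' : bounded_measurable k'. Proof. exact: bmf_swap. Qed.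
Let dlk' z : dl <= k' z. Proof. exact: dlk. Qed.
Let k1' z : k' z <= 1. Proof. exact: k1. Qed.

Definition sinkhorn_step (b : T2 -> R) : T2 -> R :=
  scaling mu k' (scaling nu k b).

Let dl1 : dl <= 1.
Proof. exact: le_trans (dlk (point, point)) (k1 _). Qed.

Lemma positive_sinkhorn_step b : positive_measurable b ->
  positive_measurable (sinkhorn_step b).
Proof.
by move=> pb; apply: (positive_scaling _ dl0 bk' dlk'); exact: (positive_scaling _ dl0 bk dlk).
Qed.

Let step_monotone b b' m M :
  positive_measurable b -> positive_measurable b' ->
  (forall y, m * b y <= b' y <= M * b y) ->
  forall y, m * sinkhorn_step b y <= sinkhorn_step b' y <= M * sinkhorn_step b y.
Proof.
move=> pb pb' mM; have pa := positive_scaling nu dl0 bk dlk pb.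
have pa' := positive_scaling nu dl0 bk dlk pb'.
apply: (scaling_monotone mu dl0 bk' dlk' k1' pa' pa).
exact: (scaling_monotone nu dl0 bk dlk k1 pb pb').
Qed.

(** The gain of the first half step suffices; the second half step only has to preserve the
    bounds. *)
Let step_contraction b b' m M :
  positive_measurable b -> positive_measurable b' ->
  (forall y, m * b y <= b' y <= M * b y) ->
  exists m' M', [/\ m <= m', M' - m' = (1 - dl) * (M - m) &
  forall y, m' * sinkhorn_step b y <= sinkhorn_step b' y <= M' * sinkhorn_step b y].
Proof.
move=> pb pb' mM.
have [m' [M' [? ? H]]] := scaling_contraction nu dl0 bk dlk k1 dl1 pb pb' mM.
exists m', M'; split => // y.
have pa := positive_scaling nu dl0 bk dlk pb.
have pa' := positive_scaling nu dl0 bk dlk pb'.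
exact: (scaling_monotone mu dl0 bk' dlk' k1' pa' pa H).
Qed.

(* Both b and its update carry total mass 1 against the first marginal of the
   current plan, so 1 separates the bounds on their ratio. *)
Let ratio_around1 b m M : positive_measurable b ->
  (forall y, m * b y <= sinkhorn_step b y <= M * b y) -> m <= 1 <= M.
Proof.
move=> pb mM; set a := scaling nu k b.
have pa : positive_measurable a by exact: (positive_scaling nu dl0 bk dlk).
(* The update of b is 1 / w, so its product with w is the constant 1. The product b w is the second
   marginal density of the plan a k b, of mass 1 because a normalises each section in y. *)
pose w y := kernel_op mu k' a y.
have pw : positive_measurable w by exact: (positive_kernel_op mu dl0 bk' dlk').
have [bw _] := pw; have [bb _] := pb; have [ba _] := pa.
have w1 : \int[nu]_y (sinkhorn_step b y * w y) = 1.
  rewrite -[RHS](Rint_cst nu); apply: eq_Rintegral => y _.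
  by rewrite mulVf// gt_eqF//; exact: positive_gt0.
have w2 : \int[nu]_y (b y * w y) = 1.
  pose F (z : T1 * T2) := k z * a z.1 * b z.2.
  have bF : bounded_measurable F.
    apply: bmfM; last exact: bmf_snd.
    by apply: bmfM => //; exact: bmf_fst.
  transitivity (\int[nu]_y \int[mu]_x F (x, y)).
    apply: eq_Rintegral => y _; rewrite mulrC -bmf_intZr//.
    exact: (bmf_kernel bk' y ba).
  rewrite -(bmf_Fubini2 mu nu bF) (bmf_Fubini1 mu nu bF) -[RHS](Rint_cst mu).
  apply: eq_Rintegral => x _.
  transitivity (\int[nu]_y (a x * (k (x, y) * b y))).
    by apply: eq_Rintegral => y _; rewrite /F/=; ring.
  rewrite bmf_intZ; last exact: bmf_kernel.
  rewrite mulVf// gt_eqF//; apply: positive_gt0; exact: (positive_kernel_op nu dl0 bk dlk pb).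
have [bs _] := positive_sinkhorn_step pb.
have bbw : bounded_measurable (fun y => b y * w y) by exact: bmfM.
apply/andP; split.
  rewrite -[leLHS]mulr1 -[X in _ * X]w2 -bmf_intZ// -[leRHS]w1.
  apply: bmf_le => [||y]; [by apply: bmfM => //; exact: bmf_cst|exact: bmfM|].
  rewrite mulrA ler_wpM2r//; last by have /andP[] := mM y.
  exact/ltW/positive_gt0.
rewrite -[leRHS]mulr1 -[X in _ <= _ * X]w2 -bmf_intZ// -[leLHS]w1.
apply: bmf_le => [||y]; [exact: bmfM|by apply: bmfM => //; exact: bmf_cst|].
rewrite mulrA ler_wpM2r//; last by have /andP[] := mM y.
exact/ltW/positive_gt0.
Qed.

Let b_ n := iter n sinkhorn_step (fun _ => 1).

Let pb_ n : positive_measurable (b_ n).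
Proof.
elim: n => [|n IHn]; last exact: positive_sinkhorn_step.
by split; [exact: bmf_cst|exists 1].
Qed.

(** The gap between the bounds decays geometrically. The lower bounds stay above a fixed [m0],
    because [ln_ratio_bound] divides by them. *)
Let ratio_bounds : exists m0 G, [/\ 0 < m0, 0 <= G & forall n, exists m M,
  [/\ m0 <= m, M - m = G * (1 - dl) ^+ n &
    forall y, m * b_ n y <= b_ n.+1 y <= M * b_ n y]].
Proof.
have [bs1 [m0 m00 hm0]] := pb_ 1; have [_ [M0 hM0]] := bs1.
(* The iteration starts from the constant 1, so the first ratio is [b_ 1] itself. *)
have h0 y : m0 * b_ 0 y <= b_ 1 y <= M0 * b_ 0 y.
  by rewrite !mulr1 hm0/= (le_trans (ler_norm _))// hM0.
have /andP[h1 h2] := ratio_around1 (pb_ 0) h0.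
exists m0, (M0 - m0); split => // [|n]; first by lra.
elim: n => [|n [m [M [m0m Mm H]]]]; first by exists m0, M0; rewrite expr0 mulr1.
have [m' [M' [mm' E H']]] := step_contraction (pb_ n) (pb_ n.+1) H.
exists m', M'; split => //; first exact: le_trans mm'.
by rewrite E Mm exprS; ring.
Qed.

(** The ratio bounds make the logarithms of the iterates uniformly Cauchy at a geometric rate.
    Exponentiating their limit gives a function that is automatically bounded and bounded away from
    0. *)
Lemma sinkhorn_limit : exists2 b, positive_measurable b /\
  (forall y, sinkhorn_step b y = b y) &
  forall y, iter n sinkhorn_step (fun _ => 1) y @[n --> \oo] --> b y.
Proof.
have [m0 [G [m00 G0 H]]] := ratio_bounds.
have q0 : 0 <= 1 - dl by rewrite subr_ge0.
have q1 : 1 - dl < 1 by rewrite ltrBlDr ltrDl.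
have lnb n y : `|ln (b_ n.+1 y) - ln (b_ n y)| <= G / m0 * (1 - dl) ^+ n.
  have [m [M [m0m Mm hmM]]] := H n.
  have mgt0 : 0 < m by exact: lt_le_trans m0m.
  have bn := positive_gt0 y (pb_ n); have bn1 := positive_gt0 y (pb_ n.+1).
  apply: le_trans (ln_ratio_bound bn bn1 mgt0 (hmM y) (ratio_around1 (pb_ n) hmM)) _.
  rewrite Mm mulrAC ler_wpM2r ?exprn_ge0// ler_wpM2l// lef_pV2 ?posrE//.
have blnb n : bounded_measurable (fun y => ln (b_ n y)) by exact: bmf_ln.
have [v [bv lv]] := bmf_geometric_limit q0 q1 blnb lnb.
have [mv [V vV]] := bv.
set D := G / m0 / _ in lv.
pose b y := expR (v y).
have pb : positive_measurable b.
  split; last first.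
    exists (expR (- V)) => [|y]; first exact: expR_gt0.
    by rewrite ler_expR; have := vV y; rewrite ler_norml => /andP[].
  split; first exact: measurableT_comp.
  exists (expR V) => y; rewrite gtr0_norm ?expR_gt0// ler_expR.
  exact: le_trans (ler_norm _) (vV y).
have close n y : expR (- (D * (1 - dl) ^+ n)) * b_ n y <= b y
                 <= expR (D * (1 - dl) ^+ n) * b_ n y.
  have b0 := positive_gt0 y (pb_ n).
  have eb : b_ n y = expR (ln (b_ n y)) by rewrite lnK.
  rewrite eb -!expRD !ler_expR; have := lv n y.
  by rewrite ler_norml => /andP[? ?]; apply/andP; split; lra.
exists b; last first.
  move=> y; have -> : b y = expR (v y) by [].
  have -> : (fun n => iter n sinkhorn_step (fun=> 1) y) = expR \o (fun n => ln (b_ n y)).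
    by apply/funext => n /=; rewrite lnK// posrE; exact: positive_gt0.
  apply: continuous_cvg; first exact: continuous_expR.
  exact: (geometric_bound_cvg q0 q1 (lv ^~ y)).
split => // y; have ps := positive_sinkhorn_step pb.
have s0 := positive_gt0 y ps.
have b0 := positive_gt0 y pb.
apply: ln_inj; rewrite ?posrE//; apply/eqP; rewrite -subr_eq0 -normr_eq0; apply/eqP.
(* Fixed point by monotonicity: if b is within D q^n of [b_ n] in logarithm, then its update is
   within D q^n of [b_ n.+1], and so is b. The two distances add up to the factor 2. *)
apply: (@geometric_bound_eq0 _ _ (1 - dl) (2 * D)) => // n.
have b10 := positive_gt0 y (pb_ n.+1).
have h1 := ln_expR_bound b10 s0 (step_monotone (pb_ n) pb (close n) y).
have h2 := ln_expR_bound b10 b0 (close n.+1 y).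
apply: le_trans (ler_distD (ln (b_ n.+1 y)) _ _) _.
rewrite [X in _ + X]distrC -mulrA mulrDl mul1r; apply: lerD h1 _.
apply: le_trans h2 _.
have D0 : 0 <= D by rewrite /D !divr_ge0// ?subr_ge0 ltW.
by rewrite ler_wpM2l// exprS ler_piMl ?exprn_ge0// ltW.
Qed.

End sinkhorn.

(** * Neumann series for Markov kernels *)

Section markov_kernel.
Context (R : realType) d1 (T1 : measurableType d1) d2 (T2 : measurableType d2).
Context (nu : probability T2 R) (xi : T1 * T2 -> R) (ka : R).
Hypotheses (bxi : bounded_measurable xi) (kaxi : forall z, ka <= xi z).
Hypothesis (xi1 : forall x, \int[nu]_y xi (x, y) = 1).

Lemma kernel_opB (f g : T2 -> R) x : bounded_measurable f -> bounded_measurable g ->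
  kernel_op nu xi (fun y => f y - g y) x = kernel_op nu xi f x - kernel_op nu xi g x.
Proof.
move=> bf bg; rewrite /kernel_op -bmf_intB; try exact: bmf_kernel.
by under eq_Rintegral do rewrite mulrBr.
Qed.

Lemma kernel_op_cst c x : kernel_op nu xi (fun _ => c) x = c.
Proof. by rewrite /kernel_op bmf_intZr ?xi1 ?mul1r//; exact: bmf_pair1. Qed.

Lemma kernel_op_norm (g : T2 -> R) M x : 0 <= ka -> bounded_measurable g ->
  (forall y, `|g y| <= M) -> `|kernel_op nu xi g x| <= M.
Proof.
move=> ka0 bg gM.
apply: le_trans (le_normr_Rintegral _ _) _ => //.
  by apply: bmf_integrable; exact: bmf_kernel.
rewrite -[leRHS](kernel_op_cst M x); apply: bmf_le => [||y].
- by apply: bmf_norm; exact: bmf_kernel.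
- by apply: bmf_kernel => //; exact: bmf_cst.
by rewrite normrM ger0_norm ?(le_trans ka0)// ler_wpM2l ?(le_trans ka0).
Qed.

(** Doeblin's argument: subtracting the constant ka from the kernel does not change its action on a
    mean-zero g, and leaves a nonnegative kernel of mass 1 - ka. *)
Lemma kernel_op_mean0_norm (g : T2 -> R) M x : bounded_measurable g ->
  \int[nu]_y g y = 0 -> (forall y, `|g y| <= M) ->
  `|kernel_op nu xi g x| <= (1 - ka) * M.
Proof.
move=> bg g0 gM.
have bx := bmf_pair1 x bxi.
have bka : bounded_measurable (fun y => xi (x, y) - ka).
  by apply: bmfB => //; exact: bmf_cst.
have -> : kernel_op nu xi g x = \int[nu]_y ((xi (x, y) - ka) * g y).
  under [RHS]eq_Rintegral do rewrite mulrBl.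
  rewrite bmf_intB ?bmf_intZ ?g0 ?mulr0 ?subr0//; first exact: bmf_kernel.
  by apply: bmfM => //; exact: bmf_cst.
apply: le_trans (le_normr_Rintegral _ _) _ => //.
  by apply: bmf_integrable; exact: bmfM.
have -> : (1 - ka) * M = \int[nu]_y ((xi (x, y) - ka) * M).
  rewrite bmf_intZr// bmf_intB//; last exact: bmf_cst.
  by rewrite xi1 Rint_cst.
apply: bmf_le => [||y]; first by apply: bmf_norm; exact: bmfM.
  by apply: bmfM => //; exact: bmf_cst.
by rewrite normrM ger0_norm ?subr_ge0// ler_wpM2l ?subr_ge0.
Qed.

End markov_kernel.

Section bimarkov_kernel.
Context (R : realType) d1 (T1 : measurableType d1) d2 (T2 : measurableType d2).
Context (mu : probability T1 R) (nu : probability T2 R) (xi : T1 * T2 -> R) (ka : R).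
Hypotheses (bxi : bounded_measurable xi) (kaxi : forall z, ka <= xi z).
Hypothesis (xi1 : forall x, \int[nu]_y xi (x, y) = 1).
Hypothesis (xi2 : forall y, \int[mu]_x xi (x, y) = 1).

Lemma kernel_bound_le1 : ka <= 1.
Proof.
rewrite -(xi1 point) -[leLHS](Rint_cst nu); apply: bmf_le => [||y]; first exact: bmf_cst.
  exact: bmf_pair1.
exact: kaxi.
Qed.

Lemma int_kernel_op (g : T2 -> R) : bounded_measurable g ->
  \int[mu]_x kernel_op nu xi g x = \int[nu]_y g y.
Proof.
move=> bg; have bF : bounded_measurable (fun z : T1 * T2 => xi z * g z.2).
  by apply: bmfM => //; exact: bmf_snd.
rewrite -(bmf_Fubini1 mu nu bF) (bmf_Fubini2 mu nu bF).
apply: eq_Rintegral => y _ /=; rewrite bmf_intZr ?xi2 ?mul1r//.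
exact: bmf_pair2.
Qed.

End bimarkov_kernel.

Section neumann.
Context (R : realType) d1 (T1 : measurableType d1) d2 (T2 : measurableType d2).
Context (mu : probability T1 R) (nu : probability T2 R) (xi : T1 * T2 -> R) (ka : R).
Hypotheses (bxi : bounded_measurable xi) (ka0 : 0 < ka) (kaxi : forall z, ka <= xi z).
Hypothesis (xi1 : forall x, \int[nu]_y xi (x, y) = 1).
Hypothesis (xi2 : forall y, \int[mu]_x xi (x, y) = 1).

Let xi' := swap_kernel xi.
Let bxi' : bounded_measurable xi'. Proof. exact: bmf_swap. Qed.
Let kaxi' z : ka <= xi' z. Proof. exact: kaxi. Qed.

Let K (f : T1 -> R) := kernel_op nu xi (kernel_op mu xi' f).

Let bK f : bounded_measurable f -> bounded_measurable (K f).
Proof. by move=> bf; apply: bmf_kernel_op => //; exact: bmf_kernel_op. Qed.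

Let K_mean f : bounded_measurable f -> \int[mu]_x K f x = \int[mu]_x f x.
Proof.
move=> bf; rewrite (@int_kernel_op _ _ _ _ _ mu nu)//; last exact: bmf_kernel_op.
by rewrite (@int_kernel_op _ _ _ _ _ nu mu).
Qed.

Let KB f g x : bounded_measurable f -> bounded_measurable g ->
  K (fun y => f y - g y) x = K f x - K g x.
Proof.
move=> bf bg; rewrite /K -kernel_opB//; try exact: bmf_kernel_op.
by congr kernel_op; apply/funext => y; rewrite kernel_opB.
Qed.

(** The inner operator contracts because f has mean zero; the outer one only has to be non-expansive
    in the sup norm. *)
Let K_contraction f M x : bounded_measurable f -> \int[mu]_x f x = 0 ->
  (forall x, `|f x| <= M) -> `|K f x| <= (1 - ka) * M.
Proof.
move=> bf f0 fM; apply: (@kernel_op_norm _ _ _ _ _ _ _ ka) => //; first exact: ltW.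
  exact: bmf_kernel_op.
by move=> y; apply: kernel_op_mean0_norm.
Qed.

Lemma neumann_unique f : bounded_measurable f -> \int[mu]_x f x = 0 ->
  (forall x, f x = kernel_op nu xi (kernel_op mu xi' f) x) -> forall x, f x = 0.
Proof.
move=> bf f0 fK x; have [_ [M fM]] := bf.
have h n : forall x, `|f x| <= M * (1 - ka) ^+ n.
  elim: n => [|n IHn] z; first by rewrite expr0 mulr1.
  by rewrite fK exprS mulrCA; exact: K_contraction.
apply/eqP; rewrite -normr_eq0; apply/eqP.
have k1 : ka <= 1 by exact: kernel_bound_le1 bxi kaxi xi1.
apply: (@geometric_bound_eq0 _ _ (1 - ka) M) => //; first by rewrite subr_ge0.
by rewrite ltrBlDr ltrDl.
Qed.

Lemma neumann_solution phi : bounded_measurable phi -> \int[mu]_x phi x = 0 ->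
  exists f, [/\ bounded_measurable f, \int[mu]_x f x = 0 &
    forall x, f x = phi x + kernel_op nu xi (kernel_op mu xi' f) x].
Proof.
move=> bphi phi0.
have k1 : ka <= 1 by exact: kernel_bound_le1 bxi kaxi xi1.
(* [h n] is the partial sum of K^j phi for j from 0 to n, so consecutive terms differ by K^(n+1)
   phi. *)
pose h n := iter n (fun f x => phi x + K f x) phi.
have q0 : 0 <= 1 - ka by rewrite subr_ge0.
have q1 : 1 - ka < 1 by rewrite ltrBlDr ltrDl.
have hh n : bounded_measurable (h n) /\ \int[mu]_x h n x = 0.
  elim: n => [//|n [bn n0]]; split; first by apply: bmfD => //; exact: bK.
  by rewrite bmf_intD//; [rewrite K_mean// phi0 n0 addr0|exact: bK].
have [_ [M phiM]] := bphi.
have step n x : `|h n.+1 x - h n x| <= M * (1 - ka) ^+ n.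
  elim: n x => [|n IHn] x.
    rewrite expr0 mulr1 /= addrAC subrr add0r.
    apply: le_trans (K_contraction x bphi phi0 phiM) _.
    rewrite ler_piMl//; first exact: le_trans (phiM point).
    by rewrite lerBlDr lerDl ltW.
  have [b1 m1] := hh n; have [b2 m2] := hh n.+1.
  have -> : h n.+2 x - h n.+1 x = K (fun y => h n.+1 y - h n y) x.
    by rewrite KB//= /h/=; ring.
  rewrite exprS mulrCA; apply: K_contraction => //; first exact: bmfB.
  by rewrite bmf_intB// m1 m2 subrr.
have [f [bf hf]] := bmf_geometric_limit q0 q1 (fun n => (hh n).1) step.
set D := M / _ in hf.
have f0 : \int[mu]_x f x = 0.
  apply/eqP; rewrite -normr_eq0; apply/eqP.
  apply: (@geometric_bound_eq0 _ _ (1 - ka) D) => // n.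
  have [b1 m1] := hh n.
  rewrite -[X in `|X|]subr0 -{1}m1 -bmf_intB//; apply: bmf_int_norm => [|x].
    exact: bmfB.
  by rewrite distrC.
exists f; split => // x; apply/eqP; rewrite -subr_eq0 -normr_eq0; apply/eqP.
apply: (@geometric_bound_eq0 _ _ (1 - ka) (2 * D)) => // n.
have [b1 m1] := hh n.
have D0 : 0 <= D * (1 - ka) ^+ n by apply: le_trans (hf n x).
have e1 : `|K (h n) x - K f x| <= D * (1 - ka) ^+ n.
  rewrite -KB//; apply: (@le_trans _ _ ((1 - ka) * (D * (1 - ka) ^+ n))).
    apply: K_contraction => //; first exact: bmfB.
    by rewrite bmf_intB// m1 f0 subrr.
  by rewrite ler_piMl// lerBlDr lerDl ltW.
have e2 := hf n.+1 x.
have e3 : D * (1 - ka) ^+ n.+1 <= D * (1 - ka) ^+ n.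
  by rewrite exprS mulrCA ler_piMl// lerBlDr lerDl ltW.
have E : f x - (phi x + K f x) = (K (h n) x - K f x) - (h n.+1 x - f x).
  by rewrite /h/= /K; ring.
rewrite -/(K f) E; apply: le_trans (ler_normB _ _) _; lra.
Qed.

End neumann.

(** * Entropy and densities *)

(** The positivity and normalisation proofs are arguments, so that the probability structure can be
    attached to the term itself. *)
Definition density_probability d (T : measurableType d) (R : realType)
    (mu : probability T R) (f : T -> R) (mf : measurable_fun setT f)
    (f0 : forall x, 0 <= f x) (f1 : (\int[mu]_x (f x)%:E = 1)%E) : set T -> \bar R :=
  fun A => (\int[mu]_(x in A) (f x)%:E)%E.

Section density_probability.
Context d (T : measurableType d) (R : realType) (mu : probability T R) (f : T -> R).
Context (mf : measurable_fun setT f) (f0 : forall x, 0 <= f x).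
Context (f1 : (\int[mu]_x (f x)%:E = 1)%E).

Local Notation nu := (density_probability mf f0 f1).

Let nu0 : nu set0 = 0%E. Proof. exact: integral_set0. Qed.

Let nu_ge0 A : (0 <= nu A)%E. Proof. by apply: integral_ge0 => x _; rewrite lee_fin. Qed.

Let nu_sigma : semi_sigma_additive nu.
Proof. by apply: semi_sigma_additive_nng_induced => //; exact/measurable_EFinP. Qed.

HB.instance Definition _ := isMeasure.Build _ _ _ nu nu0 nu_ge0 nu_sigma.

HB.instance Definition _ := Measure_isProbability.Build _ _ _ nu f1.

End density_probability.

Section has_density.
Context d (T : measurableType d) (R : realType) (rho pi : probability T R) (xi : T -> R).
Hypotheses (bxi : bounded_measurable xi) (xi0 : forall x, 0 <= xi x).
Hypothesis piE : forall A, measurable A -> pi A = (\int[rho]_(x in A) (xi x)%:E)%E.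

Lemma density_dominates : pi `<< rho.
Proof.
have [mxi _] := bxi.
apply/null_content_dominatesP => A mA A0; rewrite piE//.
by apply: null_set_integral => //; apply: measurable_funTS; exact/measurable_EFinP.
Qed.

Lemma ae_eq_density :
  'd (charge_of_finite_measure pi) '/d rho = EFin \o xi %[ae rho].
Proof.
have [mxi _] := bxi.
apply: integral_ae_eq => //.
- by apply: Radon_Nikodym_integrable => /=; exact: density_dominates.
- exact/measurable_EFinP.
- by move=> A _ mA; rewrite -Radon_Nikodym_integral//; [exact: piE|exact: density_dominates].
Qed.

Lemma density_int (h : T -> R) : bounded_measurable h ->
  \int[pi]_x h x = \int[rho]_x (h x * xi x).
Proof.
move=> bh; have [mh _] := bh; have [mxi _] := bxi; congr fine.
rewrite -(Radon_Nikodym_change_of_variables density_dominates)//; last first.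
  exact: bmf_integrable.
apply: ae_eq_integral => //.
- apply: emeasurable_funM; first exact/measurable_EFinP.
  by apply: (measurable_int rho); apply: Radon_Nikodym_integrable => /=; exact: density_dominates.
- by apply/measurable_EFinP; exact: measurable_funM.
- by apply: filterS ae_eq_density => x /= + _ => /(_ Logic.I) ->; rewrite EFinM.
Qed.

End has_density.

Section absolutely_continuous.
Context d (T : measurableType d) (R : realType) (rho pi : probability T R).
Hypothesis pirho : pi `<< rho.

(** Provides a version of the derivative that is finite and nonnegative at every point, with a
    change of variables valid for all nonnegative functions, whether integrable or not. *)
Lemma nonneg_density : exists p : T -> R, [/\ measurable_fun setT p,
  forall x, 0 <= p x, 'd (charge_of_finite_measure pi) '/d rho = EFin \o p %[ae rho] &
  forall f : T -> \bar R, (forall x, 0 <= f x)%E -> measurable_fun setT f ->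
    (\int[rho]_x (f x * (p x)%:E) = \int[pi]_x f x)%E].
Proof.
pose s := Radon_Nikodym_SigmaFinite.f pi rho.
have s0 x : (0 <= s x)%E by exact: Radon_Nikodym_SigmaFinite.f_ge0.
have sfin x : s x \is a fin_num by exact: Radon_Nikodym_SigmaFinite.f_fin_num.
have ms : measurable_fun setT s.
  exact: measurable_int (Radon_Nikodym_SigmaFinite.f_integrable pirho).
exists (fine \o s); split => [|x||f f0 mf].
- exact: measurableT_comp.
- exact/fine_ge0.
- have := @ae_eq_Radon_Nikodym_SigmaFinite _ _ _ pi rho pirho setT measurableT.
  by apply: filterS => x /= h /h <-; rewrite fineK.
- rewrite -(Radon_Nikodym_SigmaFinite.change_of_variables pirho)//.
  by apply: eq_integral => x _; rewrite /= fineK.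
Qed.

Lemma null_dominates_ae (B : set T) :
  (\forall x \ae rho, B x) -> \forall x \ae pi, B x.
Proof.
case=> N [mN N0 BN]; exists N; split => //.
by move/null_content_dominatesP : pirho; apply.
Qed.

End absolutely_continuous.

Section integral_add_nonneg.
Local Open Scope ereal_scope.
Context d (T : measurableType d) (R : realType) (mu : {measure set T -> \bar R}).

(** Entropies may be infinite, so additivity is needed when D is not integrable. The negative part
    of l + D is then still dominated by |l|; a finite integral of the sum would make D = (l + D) - l
    integrable. *)
Lemma integralD_nonneg (l D : T -> R) : mu.-integrable setT (EFin \o l) ->
  measurable_fun setT D -> (forall x, 0 <= D x)%R ->
  \int[mu]_x (l x + D x)%:E = \int[mu]_x (l x)%:E + \int[mu]_x (D x)%:E.
Proof.
move=> il mD D0.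
have ml : measurable_fun setT l by apply/measurable_EFinP; exact: measurable_int il.
have [iD|niD] := pselect (mu.-integrable setT (EFin \o D)).
  by under eq_integral do rewrite EFinD; rewrite integralD.
have Doo : \int[mu]_x (D x)%:E = +oo.
  have : \int[mu]_x (D x)%:E = +oo \/ (\int[mu]_x (D x)%:E < +oo).
    by case: (\int[mu]_x _) => [r| |]; [right; rewrite ltry|left|right].
  case=> // h; exfalso; apply: niD; apply/integrableP; split; first exact/measurable_EFinP.
  by under eq_integral => x _ do rewrite gee0_abs ?lee_fin//.
have lfin : \int[mu]_x (l x)%:E \is a fin_num by exact: integrable_fin_num.
rewrite Doo addey; last by move: lfin; rewrite fin_numE => /andP[].
pose f := (EFin \o (fun x => l x + D x)%R).
have mf : measurable_fun setT f by apply/measurable_EFinP; exact: measurable_funD.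
rewrite -/f integralE.
have fneg : \int[mu]_x f^\- x < +oo.
  apply: (@le_lt_trans _ _ (\int[mu]_x `|(l x)%:E|)); last by case/integrableP : il.
  apply: ge0_le_integral => //.
  - exact: measurable_funeneg.
  - by apply: measurableT_comp => //; exact/measurable_EFinP.
  - move=> x _; rewrite funenegE /f/= -EFin_max lee_fin ge_max normr_ge0 andbT.
    have := D0 x; have := ler_norm (- l x)%R; rewrite normrN; lra.
have fnegfin : \int[mu]_x f^\- x \is a fin_num.
  by rewrite ge0_fin_numE//; exact: integral_ge0.
suff -> : \int[mu]_x f^\+ x = +oo.
  by rewrite addye//; case: (\int[mu]_x f^\- x) fnegfin.
apply/eqP; rewrite eq_le leey/= leNgt; apply/negP => h; apply: niD.
have fi : mu.-integrable setT f.
  rewrite (funeposneg f); apply: integrableB => //.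
    apply/integrableP; split; first exact: measurable_funepos.
    by under eq_integral do rewrite gee0_abs//.
  apply/integrableP; split; first exact: measurable_funeneg.
  by under eq_integral do rewrite gee0_abs//.
rewrite (_ : EFin \o D = f \- (EFin \o l)); first exact: integrableB.
by apply/funext => x /=; rewrite -EFinB addrAC subrr add0r.
Qed.

End integral_add_nonneg.

Lemma expR_eq1Dx (R : realType) (x : R) : expR x - 1 - x = 0 -> x = 0.
Proof.
move=> h; apply/eqP; apply: contraT => x0.
by have := expR_gt1Dx x0; lra.
Qed.

Lemma measurable_set_le d (T : measurableType d) (R : realType) (f g : T -> R) :
  measurable_fun setT f -> measurable_fun setT g -> measurable [set x | f x <= g x].
Proof.
move=> mf mg; have := measurable_fun_ler mf mg measurableT (Y := [set true]) Logic.I.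
rewrite setTI; congr measurable; apply/seteqP; split => x //=.
Qed.

Lemma nonneg_int0_ae d (T : measurableType d) (R : realType)
    (mu : {measure set T -> \bar R}) (f : T -> R) :
  measurable_fun setT f -> (forall x, 0 <= f x) -> (\int[mu]_x (f x)%:E = 0)%E ->
  \forall x \ae mu, f x = 0.
Proof.
move=> mf f0 h; have mF : measurable_fun setT (EFin \o f) by exact/measurable_EFinP.
have : (\int[mu]_x `|(EFin \o f) x| = 0)%E.
  by rewrite -h; apply: eq_integral => x _; rewrite /= ger0_norm.
move/(ae_eq_integral_abs mu measurableT mF).
by apply: filterS => x /= /(_ Logic.I) [].
Qed.

(** The derivative inside the definition equals p only rho-almost everywhere. Domination transfers
    the equality to pi, and [lne] agrees with [ln] where p is positive, that is pi-almost
    everywhere. *)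
Lemma rel_entropyE d (T : measurableType d) (R : realType) (rho pi : probability T R)
    (p : T -> R) : pi `<< rho -> measurable_fun setT p ->
  'd (charge_of_finite_measure pi) '/d rho = EFin \o p %[ae rho] ->
  (\forall x \ae pi, 0 < p x) ->
  rel_entropy pi rho = (\int[pi]_x (ln (p x))%:E)%E.
Proof.
move=> pirho mp RNp ae_pgt0.
rewrite /rel_entropy; case: pselect => //= _.
apply: ae_eq_integral => //.
- have RNfin x : ('d (charge_of_finite_measure pi) '/d rho) x \is a fin_num.
    by apply: Radon_Nikodym_fin_num => /=; exact: pirho.
  rewrite (_ : (fun z => lne _) = (fun z =>
    if fine (('d (charge_of_finite_measure pi) '/d rho) z) <= 0 then -oo%E
    else (ln (fine (('d (charge_of_finite_measure pi) '/d rho) z)))%:E)).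
    have mRN : measurable_fun setT (fun z => fine (('d (charge_of_finite_measure pi) '/d rho) z)).
      have iRN : rho.-integrable setT ('d (charge_of_finite_measure pi) '/d rho).
        by apply: Radon_Nikodym_integrable => /=; exact: pirho.
      by apply: measurableT_comp => //; exact: measurable_int iRN.
    apply: measurable_fun_ifT => //; first exact: measurable_fun_ler.
    by apply/measurable_EFinP; exact: measurableT_comp.
  by apply/funext => z; rewrite -{1}(fineK (RNfin z)).
- by apply/measurable_EFinP; exact: measurableT_comp.
- have RNpi := null_dominates_ae pirho RNp.
  apply: filterS2 RNpi ae_pgt0 => x /= /(_ Logic.I) -> px _.
  by rewrite lne_EFin.
Qed.

Section entropy.
Context d (T : measurableType d) (R : realType) (rho pi : probability T R) (xi : T -> R).
Hypotheses (pxi : positive_measurable xi) (xi1 : \int[rho]_x xi x = 1).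
Hypothesis pirho : pi `<< rho.

(* With p the density of pi, ln p - ln xi = 1 - xi/p + (e^w - 1 - w) where
   w = ln xi - ln p, and the integral of xi/p against pi is at most 1. *)
Lemma rel_entropy_decomposition : exists G : R, exists D : \bar R,
  [/\ G <= 1, (0 <= D)%E,
    rel_entropy pi rho = ((\int[pi]_x ln (xi x) + (1 - G))%:E + D)%E &
    G = 1 -> D = 0%E ->
      forall A, measurable A -> pi A = (\int[rho]_(x in A) (xi x)%:E)%E].
Proof.
have [bxi [c c0 cxi]] := pxi; have [mxi [M xiM]] := bxi.
have xi0 x : 0 < xi x by exact: positive_gt0.
have [p [mp p0 RNp cov]] := nonneg_density pirho.
have piA A : measurable A -> pi A = (\int[rho]_x (\1_A x * p x)%:E)%E.
  move=> mA; transitivity (\int[pi]_x (\1_A x)%:E)%E.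
    by rewrite integral_indic// setIT.
  by rewrite -cov//; apply/measurable_EFinP; exact: measurable_indic.
have ae_pgt0 : \forall x \ae pi, 0 < p x.
  exists [set x | p x <= 0]; split => [| |x /= /negP]; last by rewrite -leNgt.
    exact: measurable_set_le.
  rewrite piA; last exact: measurable_set_le.
  rewrite (eq_integral (cst 0%E)) ?integral0// => x _.
  rewrite indicE; have [/set_mem/= px|_] := boolP (x \in _); last by rewrite mul0r.
  by rewrite mul1r; congr EFin; apply/eqP; rewrite eq_le px p0.
(* This is xi / p where p is positive. The value taken where p vanishes, a pi-null set, is harmless:
   g p <= xi holds at every point and gives G <= 1 for G the integral of g against pi. *)
pose g x := xi x * expR (- ln (p x)).
have g0 x : 0 <= g x by rewrite mulr_ge0 ?expR_ge0// ltW.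
have mg : measurable_fun setT g.
  apply: measurable_funM => //; apply: measurableT_comp => //.
  by apply: measurableT_comp => //; exact: measurableT_comp.
have gp x : g x * p x <= xi x.
  have [px0|px0] := leP (p x) 0.
    by apply: le_trans (ltW (xi0 x)); rewrite mulr_ge0_le0.
  by rewrite /g expRN lnK ?posrE// divfK// gt_eqF.
have gpi : (\int[pi]_x (g x)%:E = \int[rho]_x (g x * p x)%:E)%E.
  by rewrite -cov//; exact/measurable_EFinP.
have int_xi : (\int[rho]_x (xi x)%:E = 1)%E.
  rewrite -[RHS]/(1%:E) -xi1 fineK//.
  by apply: integrable_fin_num => //; exact: bmf_integrable.
have mgp : measurable_fun setT (fun x => g x * p x) by exact: measurable_funM.
have g_le1 : (\int[pi]_x (g x)%:E <= 1)%E.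
  rewrite gpi -int_xi; apply: ge0_le_integral => //.
  - by move=> x _; rewrite lee_fin mulr_ge0.
  - exact/measurable_EFinP.
  - exact/measurable_EFinP.
  - by move=> x _; rewrite lee_fin.
have gge0 : (0 <= \int[pi]_x (g x)%:E)%E.
  by apply: integral_ge0 => x _; rewrite lee_fin.
have gfin : (\int[pi]_x (g x)%:E)%E \is a fin_num.
  by rewrite ge0_fin_numE// (le_lt_trans g_le1)// ltry.
have ig : pi.-integrable setT (EFin \o g).
  apply/integrableP; split; first exact/measurable_EFinP.
  under eq_integral => x _ do rewrite /= ger0_norm//.
  by rewrite (le_lt_trans g_le1)// ltry.
pose w x := ln (xi x) - ln (p x).
have gw x : g x = expR (w x) by rewrite expRD lnK// posrE.
have blnxi : bounded_measurable (fun x => ln (xi x)) by exact: bmf_ln.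
pose D x := expR (w x) - 1 - w x.
have D0 x : 0 <= D x by have := expR_ge1Dx (w x); rewrite /D; lra.
have mw : measurable_fun setT w.
  by apply: measurable_funB; exact: measurableT_comp.
have mD : measurable_fun setT D.
  by do 2 (apply: measurable_funB => //); exact: measurableT_comp.
pose l x := ln (xi x) + 1 - g x.
have bl1 : bounded_measurable (fun x => ln (xi x) + 1).
  by apply: bmfD => //; exact: bmf_cst.
have il1 := bmf_integrable pi bl1.
have il : pi.-integrable setT (EFin \o l).
  rewrite (_ : EFin \o l = ((EFin \o (fun x => (ln (xi x) + 1)%R)) \- (EFin \o g))%E).
    exact: integrableB.
  by apply/funext => x; rewrite /= EFinB.
have int_l : (\int[pi]_x (l x)%:E = (\int[pi]_x ln (xi x) + (1 - fine (\int[pi]_x (g x)%:E)))%:E)%E.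
  rewrite -[LHS]fineK; last exact: integrable_fin_num.
  congr EFin; transitivity (\int[pi]_x l x); first by [].
  rewrite /l RintegralB// bmf_intD//; last exact: bmf_cst.
  by rewrite Rint_cst addrA.
have ent : rel_entropy pi rho = (\int[pi]_x (l x + D x)%:E)%E.
  rewrite (rel_entropyE pirho mp RNp ae_pgt0); apply: eq_integral => x _.
  by congr EFin; rewrite /l /D gw /w; ring.
exists (fine (\int[pi]_x (g x)%:E)%E), (\int[pi]_x (D x)%:E)%E; split.
- by rewrite -lee_fin fineK.
- by apply: integral_ge0 => x _; rewrite lee_fin.
- by rewrite ent integralD_nonneg// int_l.
(* Equality case. D = 0 forces p = xi only pi-almost everywhere, which says nothing where p
   vanishes. G = 1 excludes that set: it gives xi = g p rho-almost everywhere, and xi is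
   positive. *)
move=> G1 Dint0 A mA.
have pxi_ae : \forall x \ae pi, p x = xi x.
  have := nonneg_int0_ae mD D0 Dint0.
  apply: filterS2 ae_pgt0 => x px /expR_eq1Dx /eqP; rewrite subr_eq0 => /eqP h.
  by apply: ln_inj; rewrite ?posrE.
have mN : measurable [set x | p x <> xi x].
  rewrite (_ : mkset _ = ~` ([set x | p x <= xi x] `&` [set x | xi x <= p x])).
    by apply: measurableC; apply: measurableI; exact: measurable_set_le.
  apply/seteqP; split => x /= h; first by move=> [h1 h2]; apply: h; apply/eqP; rewrite eq_le h1.
  by move=> e; apply: h; rewrite e.
have piN : pi [set x | p x <> xi x] = 0%E.
  exact/negligibleP.
have ae1 : \forall x \ae rho, \1_[set x | p x <> xi x] x * p x = 0.
  apply: nonneg_int0_ae => [|x|]; last by rewrite -piA.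
    exact: measurable_funM.
  by rewrite mulr_ge0.
have ae2 : \forall x \ae rho, xi x - g x * p x = 0.
  apply: nonneg_int0_ae => [|x|]; first exact: measurable_funB.
    by rewrite subr_ge0.
  have igp : rho.-integrable setT (EFin \o (fun x => g x * p x)).
    apply/integrableP; split; first exact/measurable_EFinP.
    have gp0 x : 0 <= g x * p x by exact: mulr_ge0.
    under eq_integral => x _ do rewrite /= ger0_norm//.
    by rewrite -gpi (le_lt_trans g_le1)// ltry.
  under eq_integral do rewrite EFinB.
  rewrite integralB//; last exact: bmf_integrable.
  by rewrite int_xi -gpi -(fineK gfin) G1 subee.
have ae3 : \forall x \ae rho, p x = xi x.
  apply: filterS2 ae1 ae2 => x; rewrite indicE.
  have [/set_mem h|/negP h _ _] := boolP (x \in _); last first.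
    by apply: contrapT => h'; apply: h; rewrite inE.
  rewrite mul1r => -> ; rewrite mulr0 subr0 => e.
  by have := xi0 x; rewrite e ltxx.
rewrite piA// [RHS]integral_mkcond; apply: ae_eq_integral => //.
- by apply/measurable_EFinP; exact: measurable_funM.
- by apply/(measurable_restrictT _ _).1 => //; apply: measurable_funTS; exact/measurable_EFinP.
- apply: filterS ae3 => x -> _; rewrite patchE indicE.
  by case: (x \in A); rewrite ?mul1r ?mul0r.
Qed.

End entropy.

(** * The optimal entropic plan *)

Section image_measure.
Context d (T : measurableType d) d' (T' : measurableType d') (R : realType).
Context (pi : probability T R) (mu : probability T' R) (phi : T -> T').
Hypothesis mphi : measurable_fun setT phi.
Hypothesis phiE : forall A, measurable A -> pi (phi @^-1` A) = mu A.

Lemma int_image (h : T' -> R) : bounded_measurable h ->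
  \int[pi]_x h (phi x) = \int[mu]_y h y.
Proof.
move=> bh; have [mh _] := bh.
pose mixin := isMeasurableFun.Build _ _ _ _ _ mphi.
pose X : {RV pi >-> T'} := MeasurableFun.Pack (MeasurableFun.Class mixin).
have := @integral_distribution _ _ _ _ _ pi X (EFin \o h).
rewrite /Rintegral => e; congr fine.
transitivity (\int[distribution pi X]_y (h y)%:E)%E.
  rewrite e//; first exact/measurable_EFinP.
  by apply: (@bmf_integrable _ _ _ pi (h \o phi)); exact: bmf_comp.
by apply: eq_measure_integral => A mA _; exact: phiE.
Qed.

End image_measure.

Lemma prob1_ae d (T : measurableType d) (R : realType) (mu : probability T R) A :
  measurable A -> mu A = 1%E -> \forall x \ae mu, A x.
Proof.
move=> mA A1; exists (~` A); split => //; first exact: measurableC.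
by rewrite probability_setC// A1 subee.
Qed.

Section borel_coordinates.
Context (R : realType) (d : nat).

Lemma measurable_coord (i : 'I_d) : measurable_fun setT (fun x : borelRd R d => x ord0 i).
Proof.
apply: (measurability _ (RGenOpens.measurableE R)).
move=> _ [_ [a [b ->] <-]]; rewrite setTI; apply: sub_sigma_algebra.
apply: open_comp => [x _|]; first exact: coord_continuous.
exact: interval_open.
Qed.

Lemma measurable_compact (K : set 'rV[R]_d) : compact K -> measurable (K : set (borelRd R d)).
Proof.
move=> cK; have : closed K by apply: compact_closed => //; exact: norm_hausdorff.
move=> /closed_openC oK; rewrite -(setCK K); apply: measurableC.
exact: sub_sigma_algebra.
Qed.

Lemma measurable_sqdist d' (T : measurableType d') (f g : T -> borelRd R d) :
  measurable_fun setT f -> measurable_fun setT g ->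
  measurable_fun setT (fun z => sqdist (f z) (g z)).
Proof.
move=> mf mg; apply: measurable_sum => i; apply: measurable_funX.
by apply: measurable_funB; exact: (measurableT_comp (measurable_coord i)).
Qed.

Lemma sqdist_ge0 (x y : 'rV[R]_d) : 0 <= sqdist x y.
Proof. by apply: sumr_ge0 => i _; exact: sqr_ge0. Qed.

End borel_coordinates.

Section gibbs_kernel.
Context (R : realType) (d : nat) (eps M : R).
Local Notation E := (borelRd R d).

(* The cost is truncated at M, which does not change it on the supports of the
   measures at hand, to make the kernel bounded below on the whole space. *)
Definition gibbs (z : E * E) : R :=
  expR (- (Num.min (2^-1 * sqdist z.1 z.2) M) / eps).

Hypotheses (eps0 : 0 < eps) (M0 : 0 <= M).

Lemma gibbs_ge z : expR (- M / eps) <= gibbs z.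
Proof.
by rewrite ler_expR ler_pM2r ?invr_gt0// lerN2 ge_min lexx orbT.
Qed.

Lemma gibbs_le1 z : gibbs z <= 1.
Proof.
rewrite expR_le1 mulNr oppr_le0 divr_ge0 ?(ltW eps0)//.
by rewrite le_min M0 mulr_ge0// sqdist_ge0.
Qed.

Lemma bmf_gibbs : bounded_measurable gibbs.
Proof.
split; last first.
  by exists 1 => z; rewrite gtr0_norm ?expR_gt0//; exact: gibbs_le1.
apply: measurableT_comp => //; apply: measurable_funM => //.
apply: measurableT_comp => //; apply: measurable_minr => //.
by apply: measurable_funM => //; apply: measurable_sqdist.
Qed.

End gibbs_kernel.

(** * Uniform bounds on solutions of the Schrödinger system *)

Section schrodinger_system.
Context (R : realType) d1 (T1 : measurableType d1) d2 (T2 : measurableType d2).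
Context (mu : probability T1 R) (nu : probability T2 R).
Context (k : T1 * T2 -> R) (dl : R).
Hypotheses (dl0 : 0 < dl) (bk : bounded_measurable k).
Hypotheses (dlk : forall z, dl <= k z) (k1 : forall z, k z <= 1).
Context (a : T1 -> R) (b : T2 -> R).
Hypotheses (pa : positive_measurable a) (pb : positive_measurable b).
Hypothesis (ab1 : forall x, a x * kernel_op nu k b x = 1).
Hypothesis (ab2 : forall y, b y * kernel_op mu (swap_kernel k) a y = 1).

Definition scaled_kernel (z : T1 * T2) := a z.1 * k z * b z.2.

Lemma bmf_scaled_kernel : bounded_measurable scaled_kernel.
Proof.
apply: bmfM; last by apply: bmf_snd; case: pb.
by apply: bmfM => //; apply: bmf_fst; case: pa.
Qed.

Lemma scaled_kernel_int1 x : \int[nu]_y scaled_kernel (x, y) = 1.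
Proof.
have [bb _] := pb; rewrite -[RHS](ab1 x) -bmf_intZ; last exact: bmf_kernel.
by apply: eq_Rintegral => y _; rewrite /scaled_kernel/= mulrA.
Qed.

Lemma scaled_kernel_int2 y : \int[mu]_x scaled_kernel (x, y) = 1.
Proof.
have [ba _] := pa; rewrite -[RHS](ab2 y) -bmf_intZ; last first.
  by apply: bmf_kernel => //; exact: bmf_swap.
by apply: eq_Rintegral => x _; rewrite /scaled_kernel /swap_kernel/=; ring.
Qed.

Lemma kernel_op_bounds (f : T2 -> R) x : positive_measurable f ->
  dl * \int[nu]_y f y <= kernel_op nu k f x <= \int[nu]_y f y.
Proof.
move=> pf; have [bf _] := pf; apply/andP; split.
  rewrite -bmf_intZ//; apply: bmf_le => [||y].
  - by apply: bmfM => //; exact: bmf_cst.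
  - exact: bmf_kernel.
  - by rewrite ler_wpM2r//; exact/ltW/positive_gt0.
apply: bmf_le => [|//|y]; first exact: bmf_kernel.
by rewrite ler_piMl//; exact/ltW/positive_gt0.
Qed.

Lemma positive_int_gt0 d (T : measurableType d) (m : probability T R) (f : T -> R) :
  positive_measurable f -> 0 < \int[m]_x f x.
Proof.
move=> [bf [c c0 cf]]; apply: (lt_le_trans c0).
by rewrite -[leLHS](Rint_cst m); apply: bmf_le => //; exact: bmf_cst.
Qed.

End schrodinger_system.

Section schrodinger_bounds.
Context (R : realType) d1 (T1 : measurableType d1) d2 (T2 : measurableType d2).
Context (mu : probability T1 R) (nu : probability T2 R).
Context (k : T1 * T2 -> R) (dl : R).
Hypotheses (dl0 : 0 < dl) (bk : bounded_measurable k).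
Hypotheses (dlk : forall z, dl <= k z) (k1 : forall z, k z <= 1).
Context (a : T1 -> R) (b : T2 -> R).
Hypotheses (pa : positive_measurable a) (pb : positive_measurable b).
Hypothesis (ab1 : forall x, a x * kernel_op nu k b x = 1).
Hypothesis (ab2 : forall y, b y * kernel_op mu (swap_kernel k) a y = 1).

(** Let A and B be the integrals of a and b. Since dl <= k <= 1, the normalisations put a(x) B, b(y)
    A and, by integration, A B between 1 and 1/dl. Dividing the product of the first two by the
    third gives dl <= a(x) b(y) <= dl^-2. Only dl enters, so the same bounds serve for the
    population and for every sample. *)
Lemma scaled_kernel_bounds z : dl ^+ 2 <= scaled_kernel k a b z <= dl ^- 2.
Proof.
case: z => x y; rewrite /scaled_kernel/=.
set A := \int[mu]_x a x; set B := \int[nu]_y b y.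
have A0 : 0 < A by exact: positive_int_gt0.
have B0 : 0 < B by exact: positive_int_gt0.
have hx t : 1 <= a t * B /\ a t * B * dl <= 1.
  have /andP[h1 h2] := kernel_op_bounds nu bk dlk k1 t pb.
  have at0 := positive_gt0 t pa.
  split; first by rewrite -(ab1 t) ler_pM2l.
  by rewrite -[leRHS](ab1 t) -mulrA ler_pM2l// mulrC.
have hy t : 1 <= b t * A /\ b t * A * dl <= 1.
  have bk' : bounded_measurable (swap_kernel k) by exact: bmf_swap.
  have /andP[h1 h2] := kernel_op_bounds mu bk' (fun z => dlk _) (fun z => k1 _) t pa.
  have bt0 := positive_gt0 t pb.
  split; first by rewrite -(ab2 t) ler_pM2l.
  by rewrite -[leRHS](ab2 t) -mulrA ler_pM2l// mulrC.
have [ba _] := pa; have [bb _] := pb.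
have AB1 : 1 <= A * B.
  rewrite -[leLHS](Rint_cst mu) -bmf_intZr//; apply: bmf_le => [||t].
  - exact: bmf_cst.
  - by apply: bmfM => //; exact: bmf_cst.
  - by have [] := hx t.
have AB2 : A * B * dl <= 1.
  rewrite -[leRHS](Rint_cst mu) -mulrA -bmf_intZr//; apply: bmf_le => [||t].
  - by apply: bmfM => //; exact: bmf_cst.
  - exact: bmf_cst.
  - by have [_] := hx t; rewrite mulrA.
have [x1 x2] := hx x; have [y1 y2] := hy y.
have ax0 := positive_gt0 x pa; have by0 := positive_gt0 y pb.
have kz1 := k1 (x, y); have kz0 := dlk (x, y).
have k0 : 0 < k (x, y) by exact: lt_le_trans kz0.
have ab0 : 0 < a x * b y by exact: mulr_gt0.
have abAB : 1 <= (a x * b y) * (A * B).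
  rewrite (_ : _ * _ = (a x * B) * (b y * A)); last by ring.
  by rewrite mulr_ege1.
have abge : dl <= a x * b y.
  apply: (@le_trans _ _ (a x * b y * (A * B) * dl)).
    by rewrite ler_peMl// ltW.
  by rewrite -mulrA ler_piMr// ltW.
have able : a x * b y * dl ^+ 2 <= 1.
  apply: (@le_trans _ _ (a x * b y * (A * B) * dl ^+ 2)).
    apply: ler_wpM2r; first by rewrite exprn_ge0// ltW.
    by rewrite ler_peMr// ltW.
  rewrite (_ : _ * _ = (a x * B * dl) * (b y * A * dl)); last by ring.
  by rewrite mulr_ile1// ?mulr_ge0// ltW.
rewrite mulrAC; apply/andP; split.
  by rewrite expr2 ler_pM// ltW.
apply: (@le_trans _ _ (a x * b y)); first by rewrite ler_piMr// ltW.
by rewrite -[leRHS]mul1r ler_pdivlMr// exprn_gt0.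
Qed.

End schrodinger_bounds.

(** * Optimality and uniqueness of the scaled Gibbs plan *)

Section optimal_plan.
Context (R : realType) (d : nat) (eps M : R).
Local Notation E := (borelRd R d).
Context (P Q : probability E R) (K1 K2 : set E).
Hypotheses (eps0 : 0 < eps) (M0 : 0 <= M) (mK1 : measurable K1) (mK2 : measurable K2).
Hypotheses (PK : P K1 = 1%E) (QK : Q K2 = 1%E).
Hypothesis costK : forall x y, K1 x -> K2 y -> 2^-1 * sqdist x y <= M.
Let k := @gibbs R d eps M.
Context (a b : E -> R).
Hypotheses (pa : positive_measurable a) (pb : positive_measurable b).
Hypothesis (ab1 : forall x, a x * kernel_op Q k b x = 1).
Hypothesis (ab2 : forall y, b y * kernel_op P (swap_kernel k) a y = 1).

Let xi : E * E -> R := scaled_kernel k a b.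
Let rho := (P \x Q)%E.

Let bk : bounded_measurable k. Proof. exact: bmf_gibbs. Qed.
Let dl0 : 0 < expR (- M / eps). Proof. exact: expR_gt0. Qed.

Let bxi : bounded_measurable xi.
Proof. exact: bmf_scaled_kernel. Qed.

Let xi_bounds z : expR (- M / eps) ^+ 2 <= xi z <= expR (- M / eps) ^- 2.
Proof.
apply: (scaled_kernel_bounds dl0 bk _ _ pa pb ab1 ab2) => z'.
- exact: gibbs_ge.
- exact: gibbs_le1.
Qed.

Let xi0 z : 0 < xi z.
Proof. by have /andP[h _] := xi_bounds z; apply: lt_le_trans h; rewrite exprn_gt0. Qed.

Let pxi : positive_measurable xi.
Proof.
split => //; exists (expR (- M / eps) ^+ 2); first by rewrite exprn_gt0.
by move=> z; have /andP[] := xi_bounds z.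
Qed.

Let xi_int : \int[rho]_z xi z = 1.
Proof.
rewrite (bmf_Fubini1 P Q bxi) -[RHS](Rint_cst P); apply: eq_Rintegral => x _.
exact: scaled_kernel_int1.
Qed.

Let exi_int : (\int[rho]_z (xi z)%:E = 1)%E.
Proof.
rewrite -[RHS]/(1%:E) -xi_int fineK//; apply: integrable_fin_num => //.
exact: bmf_integrable.
Qed.

Let pistar : probability (E * E)%type R :=
  density_probability (proj1 bxi) (fun z => ltW (xi0 z)) exi_int.

Let pistarE A : measurable A -> pistar A = (\int[rho]_(z in A) (xi z)%:E)%E.
Proof. by []. Qed.

(** Every coupling lives where the truncated cost coincides with the true one. *)
Lemma coupling_ae (pi : probability (E * E)%type R) : coupling P Q pi ->
  \forall z \ae pi, K1 z.1 /\ K2 z.2.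
Proof.
move=> cpl; have [h1 _] := cpl K1 mK1; have [_ h2] := cpl K2 mK2.
apply: filterS2; last 2 first.
- apply: (@prob1_ae _ _ _ pi (fst @^-1` K1)); last by rewrite -PK -h1.
  by rewrite -[X in measurable X]setTI; exact: measurable_fst.
- apply: (@prob1_ae _ _ _ pi (snd @^-1` K2)); last by rewrite -QK -h2.
  by rewrite -[X in measurable X]setTI; exact: measurable_snd.
by [].
Qed.

(** The dual value, with potentials eps ln a and eps ln b. *)
Let V := eps * (\int[P]_x ln (a x) + \int[Q]_y ln (b y)).

(** On [K1] times [K2] the cost equals eps (ln a + ln b - ln xi), and the integrals of ln a and ln b
    depend only on the marginals of the coupling. *)
Lemma transport_cost (pi : probability (E * E)%type R) : coupling P Q pi ->
  (\int[pi]_z (2^-1 * sqdist z.1 z.2)%:E = (V - eps * \int[pi]_z ln (xi z))%:E)%E.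
Proof.
move=> cpl.
have blna := bmf_ln pa; have blnb := bmf_ln pb; have blnxi := bmf_ln pxi.
have blna1 : bounded_measurable (fun z : E * E => ln (a z.1)) by exact: bmf_fst blna.
have blnb2 : bounded_measurable (fun z : E * E => ln (b z.2)) by exact: bmf_snd blnb.
pose h z := eps * (ln (a z.1) + ln (b z.2) - ln (xi z)).
have bs : bounded_measurable (fun z : E * E => ln (a z.1) + ln (b z.2)) by exact: bmfD.
have bh : bounded_measurable h.
  by apply: bmfM; [exact: bmf_cst|exact: bmfB].
transitivity (\int[pi]_z (h z)%:E)%E.
  apply: ae_eq_integral => //.
  - apply/measurable_EFinP; apply: measurable_funM => //; exact: measurable_sqdist.
  - by apply/measurable_EFinP; case: bh.
  - apply: filterS (coupling_ae cpl) => z [z1 z2] _; congr EFin.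
    have za := positive_gt0 z.1 pa; have zb := positive_gt0 z.2 pb.
    rewrite /h /xi /scaled_kernel !lnM ?posrE ?mulr_gt0//; try exact: expR_gt0.
    rewrite /k /gibbs expRK min_l; last exact: (costK z1 z2).
    by field; rewrite gt_eqF.
rewrite -[LHS]fineK; last by apply: integrable_fin_num => //; exact: bmf_integrable.
congr EFin; transitivity (\int[pi]_z h z); first by [].
rewrite bmf_intZ; last exact: bmfB.
rewrite bmf_intB// bmf_intD// mulrBr; congr (_ * (_ + _) - _).
- by apply: (int_image measurable_fst _ blna) => A mA; have [] := cpl A mA.
- by apply: (int_image measurable_snd _ blnb) => A mA; have [] := cpl A mA.
Qed.

Lemma pistar_coupling : coupling P Q pistar.
Proof.
move=> A mA.
have piE (B : set (E * E)) : measurable B ->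
    pistar B = (\int[rho]_z (\1_B z * xi z))%:E.
  move=> mB; rewrite pistarE// integral_mkcond.
  have bB : bounded_measurable (fun z => \1_B z * xi z).
    by apply: bmfM => //; exact: bmf_indic.
  rewrite /Rintegral fineK; last first.
    by apply: integrable_fin_num => //; exact: bmf_integrable.
  apply: eq_integral => z _; rewrite patchE indicE.
  by case: (z \in B); rewrite ?mul1r ?mul0r.
have bA : bounded_measurable (\1_A : E -> R) by exact: bmf_indic.
split; rewrite /pushforward [RHS]probability_Rint//.
- have mB : measurable (fst @^-1` A : set (E * E)).
    by rewrite -[X in measurable X]setTI; exact: measurable_fst.
  rewrite piE//; congr EFin.
  have bF : bounded_measurable (fun z : E * E => \1_A z.1 * xi z).
    by apply: bmfM => //; exact: bmf_fst.
  transitivity (\int[rho]_z (\1_A z.1 * xi z)); first by [].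
  rewrite (bmf_Fubini1 P Q bF); apply: eq_Rintegral => x _ /=.
  rewrite bmf_intZ; last exact: bmf_pair1.
  by rewrite [X in _ * X]scaled_kernel_int1 ?mulr1.
- have mB : measurable (snd @^-1` A : set (E * E)).
    by rewrite -[X in measurable X]setTI; exact: measurable_snd.
  rewrite piE//; congr EFin.
  have bF : bounded_measurable (fun z : E * E => \1_A z.2 * xi z).
    by apply: bmfM => //; exact: bmf_snd.
  transitivity (\int[rho]_z (\1_A z.2 * xi z)); first by [].
  rewrite (bmf_Fubini2 P Q bF); apply: eq_Rintegral => y _ /=.
  rewrite bmf_intZ; last exact: bmf_pair2.
  by rewrite [X in _ * X](scaled_kernel_int2 bk pa ab2) ?mulr1.
Qed.

Let pistar_dom : pistar `<< rho.
Proof. exact: density_dominates bxi pistarE. Qed.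

Lemma pistar_cost : eot_cost eps P Q pistar = V%:E.
Proof.
rewrite /eot_cost transport_cost; last exact: pistar_coupling.
have [mxi _] := bxi.
rewrite (rel_entropyE pistar_dom mxi (ae_eq_density bxi pistarE)); last first.
  by apply: aeW => z; exact: xi0.
have blnxi := bmf_ln pxi.
rewrite -[X in (_ + _ * X)%E]fineK; last first.
  by apply: integrable_fin_num => //; exact: bmf_integrable.
by rewrite -EFinM -EFinD subrK.
Qed.

(** The integral of ln xi cancels between transport cost and entropy, leaving V + eps ((1 - G) + D)
    with G <= 1 and D >= 0. A cost of at most V forces G = 1 and D = 0, the equality case of
    [rel_entropy_decomposition]. *)
Lemma coupling_cost (pi : probability (E * E)%type R) : coupling P Q pi ->
  (V%:E <= eot_cost eps P Q pi)%E /\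
  ((eot_cost eps P Q pi <= V%:E)%E ->
    forall A, measurable A -> pi A = (\int[rho]_(z in A) (xi z)%:E)%E).
Proof.
move=> cpl; rewrite /eot_cost transport_cost//.
have [dom|ndom] := pselect (pi `<< rho); last first.
  have -> : rel_entropy pi rho = +oo%E.
    by rewrite /rel_entropy; case: pselect.
  by rewrite gt0_muley ?lte_fin// addey//; split; rewrite ?leey// leye_eq.
have [G [D [G1 D0 -> HD]]] := rel_entropy_decomposition pxi xi_int dom.
set I := \int[pi]_z ln (xi z).
case: D D0 HD => [D| |//] D0 HD; last first.
  rewrite addey// gt0_muley ?lte_fin// addey//; split; first by rewrite leey.
  by rewrite leye_eq.
rewrite lee_fin in D0.
have -> : ((V - eps * I)%:E + eps%:E * ((I + (1 - G))%:E + D%:E) =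
    (V + eps * ((1 - G) + D))%:E)%E.
  transitivity (V - eps * I + eps * (I + (1 - G) + D))%:E; first by [].
  by congr EFin; ring.
rewrite !lee_fin.
split; first by rewrite lerDl mulr_ge0 ?(ltW eps0)//; lra.
rewrite gerDl pmulr_rle0// => h.
by apply: HD; [lra|congr EFin; lra].
Qed.

(** The plan is selected by [get], so existence is needed to know that it is a minimizer at all;
    uniqueness then fixes its value on every measurable set. *)
Lemma eot_plan_density A : measurable A ->
  eot_plan eps P Q A = (\int[(P \x Q)%E]_(z in A) (xi z)%:E)%E.
Proof.
have ex : exists pi, eot_minimizers eps P Q pi.
  exists pistar; split; first exact: pistar_coupling.
  by move=> pi' /coupling_cost[h _]; rewrite pistar_cost.
have := getPex ex; rewrite -/(eot_plan eps P Q) => -[cpl hmin].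
have [_ h] := coupling_cost cpl; apply: h.
by rewrite -pistar_cost; apply: hmin; exact: pistar_coupling.
Qed.

End optimal_plan.

(** * Expansion of the empirical plan *)

Section average.
Context (R : realType).

Definition avg n (f : 'I_n -> R) : R := n%:R^-1 * \sum_(i < n) f i.

Lemma eq_avg n (f g : 'I_n -> R) : f =1 g -> avg f = avg g.
Proof. by move=> fg; rewrite /avg; congr (_ * _); apply: eq_bigr => i _. Qed.

Lemma avgD n (f g : 'I_n -> R) : avg (fun i => f i + g i) = avg f + avg g.
Proof. by rewrite /avg big_split mulrDr. Qed.

Lemma avgZ n c (f : 'I_n -> R) : avg (fun i => c * f i) = c * avg f.
Proof. by rewrite /avg -mulr_sumr mulrCA. Qed.

Lemma avgB n (f g : 'I_n -> R) : avg (fun i => f i - g i) = avg f - avg g.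
Proof. by rewrite /avg sumrB mulrBr. Qed.

Lemma avg_cst n c : (0 < n)%N -> avg (fun _ : 'I_n => c) = c.
Proof.
move=> n0; rewrite /avg sumr_const card_ord -[c *+ n]mulr_natl mulrA mulVf ?mul1r//.
by rewrite pnatr_eq0 -lt0n.
Qed.

Lemma avg_le n (f g : 'I_n -> R) : (forall i, f i <= g i) -> avg f <= avg g.
Proof. by move=> fg; rewrite /avg ler_wpM2l ?invr_ge0 ?ler0n// ler_sum. Qed.

Lemma avg_norm n (f : 'I_n -> R) : `|avg f| <= avg (fun i => `|f i|).
Proof.
rewrite /avg normrM ger0_norm ?invr_ge0 ?ler0n// ler_wpM2l ?invr_ge0 ?ler0n//.
exact: ler_norm_sum.
Qed.

Lemma exchange_avg n m (f : 'I_n -> 'I_m -> R) :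
  avg (fun i => avg (fun j => f i j)) = avg (fun j => avg (fun i => f i j)).
Proof.
rewrite /avg -!mulr_sumr exchange_big/= !mulrA [_^-1 * _^-1]mulrC//.
Qed.

End average.

Section exponential_bounds.
Context (R : realType).
Implicit Types w W : R.

(** Strong monotonicity of the exponential on [-W, W], which is where the strong concavity of the
    dual problem comes from. *)
Lemma expR_mul_lower w W : `|w| <= W -> expR (- W) * w ^+ 2 <= (expR w - 1) * w.
Proof.
rewrite ler_norml => /andP[w1 w2].
have [w0|w0] := leP 0 w.
  have h1 : w * w <= (expR w - 1) * w by rewrite ler_wpM2r// lerBrDl expR_ge1Dx.
  apply: le_trans h1; rewrite expr2 ler_piMl ?mulr_ge0// -expR0 ler_expR; lra.
have h : 1 - expR w >= expR w * - w.
  have := expR_ge1Dx (- w); rewrite expRN => h.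
  have e0 := expR_gt0 w.
  have : expR w * (1 - w) <= 1.
    by rewrite -ler_pdivlMl// mulr1.
  lra.
have h2 : expR (- W) <= expR w by rewrite ler_expR.
have h3 : expR (- W) * (- w) <= expR w * - w by rewrite ler_wpM2r// oppr_ge0 ltW.
have : expR (- W) * (- w) * (- w) <= (1 - expR w) * (- w).
  by rewrite ler_wpM2r// ?oppr_ge0 ?(ltW w0)//; exact: le_trans h3 h.
by rewrite expr2; lra.
Qed.

Lemma expR_taylor2 w W : `|w| <= W -> 0 <= expR w - 1 - w <= expR W * w ^+ 2.
Proof.
rewrite ler_norml => /andP[w1 w2].
have l := expR_ge1Dx w; apply/andP; split; first by lra.
have e : expR w * (1 - w) <= 1.
  by rewrite -ler_pdivlMl ?expR_gt0// mulr1 -expRN expR_ge1Dx.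
have h1 : expR w - 1 - w <= w * (expR w - 1) by lra.
apply: le_trans h1 _.
have [w0|w0] := leP 0 w.
  have h2 : w * (expR w - 1) <= w * (expR w * w) by rewrite ler_wpM2l//; lra.
  apply: le_trans h2 _; rewrite mulrCA -expr2 ler_wpM2r ?sqr_ge0//.
  by rewrite ler_expR.
have h2 : (- w) * (1 - expR w) <= (- w) * (- w) by rewrite ler_wpM2l//; lra.
have h3 : w ^+ 2 <= expR W * w ^+ 2.
  rewrite ler_peMl ?sqr_ge0// -expR0 ler_expR; lra.
by apply: le_trans h3; rewrite expr2; lra.
Qed.

End exponential_bounds.

Section plan_expansion.
Context (R : realType) (n m : nat) (n0 : (0 < n)%N) (m0 : (0 < m)%N).
Context (xi zeta : 'I_n -> 'I_m -> R) (u : 'I_n -> R) (v : 'I_m -> R) (ka W Z : R).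
Hypotheses (ka0 : 0 < ka) (kaxi : forall i j, ka <= xi i j).
Hypothesis uvW : forall i j, `|u i + v j| <= W.
Hypothesis xizetaZ : forall i j, `|xi i j * zeta i j| <= Z.
Let xih i j := xi i j * expR (u i + v j).
Hypothesis xih1 : forall i, avg (xih i) = 1.
Hypothesis xih2 : forall j, avg (xih ^~ j) = 1.

Let A i := avg (fun j => xi i j - 1).
Let B j := avg (fun i => xi i j - 1).
Let KQ i := avg (fun j => xi i j * zeta i j).
Let KP j := avg (fun i => xi i j * zeta i j).
Let sq k (f : 'I_k -> R) := avg (fun i => f i ^+ 2).

Let avg2 (f : 'I_n -> 'I_m -> R) := avg (fun i => avg (f i)).

Let th := ka * expR (- W).

Let th0 : 0 < th. Proof. by rewrite mulr_gt0// expR_gt0. Qed.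

(** Young's inequality, weighted so that the squares of the potentials are absorbed by half of the
    lower bound in [potential_bound]. *)
Let amgm (x y : R) : - (x * y) <= th / 2 * x ^+ 2 + (2 * th)^-1 * y ^+ 2.
Proof.
have : 0 <= (2 * th)^-1 * (th * x + y) ^+ 2.
  by rewrite mulr_ge0 ?sqr_ge0// invr_ge0 mulr_ge0// ltW.
rewrite (_ : _^-1 * (th * x + y) ^+ 2 = th / 2 * x ^+ 2 + x * y + (2 * th)^-1 * y ^+ 2).
  by move=> h; rewrite -subr_ge0 opprK addrAC.
by field; rewrite gt_eqF.
Qed.

(* The marginal constraints kill every function of x alone or y alone tested
   against xih, which leaves only the sampling errors A and B of xi. *)
Let test_uv (u' : 'I_n -> R) (v' : 'I_m -> R) :
  avg2 (fun i j => (xih i j - xi i j) * (u' i + v' j))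
  = - avg (fun i => u' i * A i) - avg (fun j => v' j * B j).
Proof.
have E1 : avg2 (fun i j => (xih i j - xi i j) * u' i) = - avg (fun i => u' i * A i).
  rewrite -mulN1r -avgZ; apply: eq_avg => i.
  rewrite /A avgB avg_cst// mulN1r -mulrN opprB -(xih1 i) -avgB -avgZ.
  by apply: eq_avg => j; rewrite mulrC.
have E2 : avg2 (fun i j => (xih i j - xi i j) * v' j) = - avg (fun j => v' j * B j).
  rewrite /avg2 exchange_avg -mulN1r -avgZ; apply: eq_avg => j.
  rewrite /B avgB avg_cst// mulN1r -mulrN opprB -(xih2 j) -avgB -avgZ.
  by apply: eq_avg => i; rewrite mulrC.
rewrite -E1 -E2 /avg2 -avgD; apply: eq_avg => i; rewrite -avgD.
by apply: eq_avg => j; rewrite mulrDr.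
Qed.

(** Centring v' removes the cross term, so the squared norm of w splits into two one-variable
    squares. Testing xi (e^w - 1) against w is bounded below by [expR_mul_lower] and above by
    [test_uv]; comparing the two bounds the potentials by the sampling errors. *)
Let potential_bound (u' : 'I_n -> R) (v' : 'I_m -> R) :
  (forall i j, u' i + v' j = u i + v j) -> avg v' = 0 ->
  sq u' + sq v' <= th ^- 2 * (sq A + sq B) /\
  avg2 (fun i j => (u i + v j) ^+ 2) = sq u' + sq v'.
Proof.
move=> uv v0.
have N2 : avg2 (fun i j => (u i + v j) ^+ 2) = sq u' + sq v'.
  transitivity (avg2 (fun i j => u' i ^+ 2 + (2 * u' i * v' j + v' j ^+ 2))).
    by apply: eq_avg => i; apply: eq_avg => j; rewrite -uv; ring.
  transitivity (avg (fun i => u' i ^+ 2 + sq v')).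
    by apply: eq_avg => i; rewrite avgD avg_cst// avgD avgZ v0 mulr0 add0r.
  by rewrite avgD avg_cst.
split => //.
have lower : th * (sq u' + sq v') <= avg2 (fun i j => (xih i j - xi i j) * (u' i + v' j)).
  rewrite -N2 /avg2 -avgZ; apply: avg_le => i; rewrite -avgZ; apply: avg_le => j.
  rewrite uv /xih -[X in _ * _ - X]mulr1 -mulrBr -mulrA /th -mulrA.
  have xi0 : 0 <= xi i j by exact: le_trans (ltW ka0) (kaxi i j).
  apply: ler_pM (kaxi i j) (expR_mul_lower (uvW i j)); first exact: ltW.
  by rewrite mulr_ge0 ?sqr_ge0 ?expR_ge0.
have upper : avg2 (fun i j => (xih i j - xi i j) * (u' i + v' j)) <=
    th / 2 * (sq u' + sq v') + (2 * th)^-1 * (sq A + sq B).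
  rewrite test_uv.
  have h1 : - avg (fun i => u' i * A i) <= th / 2 * sq u' + (2 * th)^-1 * sq A.
    rewrite -mulN1r -!avgZ -avgD; apply: avg_le => i; rewrite mulN1r; exact: amgm.
  have h2 : - avg (fun j => v' j * B j) <= th / 2 * sq v' + (2 * th)^-1 * sq B.
    rewrite -mulN1r -!avgZ -avgD; apply: avg_le => i; rewrite mulN1r; exact: amgm.
  by rewrite !mulrDr; lra.
have h := le_trans lower upper.
have h' : th / 2 * (sq u' + sq v') <= (2 * th)^-1 * (sq A + sq B) by lra.
have t0 : 0 <= 2 / th by rewrite divr_ge0// ltW.
have := ler_wpM2l t0 h'.
have -> : 2 / th * (th / 2 * (sq u' + sq v')) = sq u' + sq v'.
  by field; rewrite gt_eqF.
have -> : 2 / th * ((2 * th)^-1 * (sq A + sq B)) = th ^- 2 * (sq A + sq B).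
  by field; rewrite gt_eqF.
by [].
Qed.

(** Let N be the mean square of u + v. Young's inequality bounds the linear term by half of N + sq
    KQ + sq KP, Taylor's formula bounds the quadratic one by Z e^W N, and N is at most th^-2 (sq A +
    sq B). *)
Lemma plan_expansion :
  `|avg (fun i => avg (fun j => xih i j * zeta i j))|
  <= `|avg (fun i => KQ i)| +
     ((2^-1 + Z * expR W) * th ^- 2 + 2^-1) * (sq A + sq B + sq KQ + sq KP).
Proof.
(* The potentials are determined only up to moving a constant from one to the other; this choice
   centres the second. *)
pose s := avg v; pose u' i := u i + s; pose v' j := v j - s.
have uv i j : u' i + v' j = u i + v j by rewrite /u' /v'; ring.
have v0 : avg v' = 0 by rewrite avgB avg_cst// subrr.
have [N2 E2] := potential_bound uv v0.
have Z0 : 0 <= Z.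
  exact: le_trans (normr_ge0 _) (xizetaZ (Ordinal n0) (Ordinal m0)).
have split3 : avg2 (fun i j => xih i j * zeta i j) =
    avg2 (fun i j => xi i j * zeta i j) +
    (avg (fun i => u' i * KQ i) + avg (fun j => v' j * KP j)) +
    avg2 (fun i j => xi i j * zeta i j * (expR (u i + v j) - 1 - (u i + v j))).
  have -> : avg (fun i => u' i * KQ i) = avg2 (fun i j => xi i j * zeta i j * u' i).
    by apply: eq_avg => i; rewrite -avgZ; apply: eq_avg => j; rewrite mulrC.
  have -> : avg (fun j => v' j * KP j) = avg2 (fun i j => xi i j * zeta i j * v' j).
    rewrite /avg2 exchange_avg; apply: eq_avg => j.
    by rewrite -avgZ; apply: eq_avg => i; rewrite mulrC.
  rewrite -!avgD; apply: eq_avg => i; rewrite -!avgD; apply: eq_avg => j.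
  by rewrite -mulrDr uv /xih; ring.
have third : `|avg2 (fun i j => xi i j * zeta i j * (expR (u i + v j) - 1 - (u i + v j)))|
    <= Z * expR W * (sq u' + sq v').
  rewrite -E2 /avg2 -avgZ; apply: le_trans (avg_norm _) _; apply: avg_le => i.
  rewrite -avgZ; apply: le_trans (avg_norm _) _; apply: avg_le => j.
  have /andP[t1 t2] := expR_taylor2 (uvW i j).
  by rewrite normrM -mulrA ler_pM// ger0_norm.
have young (x y : R) : `|x * y| <= 2^-1 * x ^+ 2 + 2^-1 * y ^+ 2.
  have := sqr_ge0 (x + y); have := sqr_ge0 (x - y); rewrite ler_norml !expr2.
  by move=> h1 h2; apply/andP; split; lra.
have second1 : `|avg (fun i => u' i * KQ i)| <= 2^-1 * sq u' + 2^-1 * sq KQ.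
  by apply: le_trans (avg_norm _) _; rewrite -!avgZ -avgD; apply: avg_le.
have second2 : `|avg (fun j => v' j * KP j)| <= 2^-1 * sq v' + 2^-1 * sq KP.
  by apply: le_trans (avg_norm _) _; rewrite -!avgZ -avgD; apply: avg_le.
have sq0 k (f : 'I_k -> R) : 0 <= sq f.
  by rewrite /sq /avg mulr_ge0 ?invr_ge0 ?ler0n// sumr_ge0// => i _; exact: sqr_ge0.
have thV0 : 0 <= th ^- 2 by rewrite invr_ge0 exprn_ge0// ltW.
have ZW0 : 0 <= Z * expR W by rewrite mulr_ge0// expR_ge0.
rewrite -/(avg2 _) split3.
apply: le_trans (ler_normD _ _) _.
apply: le_trans (lerD (ler_normD _ _) third) _.
have s12 := le_trans (ler_normD _ _) (lerD second1 second2).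
rewrite -addrA lerD2l; apply: le_trans (lerD s12 (lexx _)) _.
set ZW := Z * expR W in ZW0 *; set T := th ^- 2 in thV0 N2 *.
have := sq0 _ A; have := sq0 _ B; have := sq0 _ KQ; have := sq0 _ KP.
have := ler_wpM2l (_ : 0 <= 2^-1 + ZW) N2.
have z12 : 0 <= 2^-1 + ZW by rewrite addr_ge0// invr_ge0.
move=> /(_ z12).
set a := sq A; set b := sq B; set q := sq KQ; set p := sq KP; set x := sq u'; set y := sq v'.
move=> h p0 q0 b0 a0.
have c0 : 0 <= (2^-1 + ZW) * T by rewrite mulr_ge0.
have h2 : 0 <= (2^-1 + ZW) * T * (q + p) by rewrite mulr_ge0// addr_ge0.
rewrite (_ : (2^-1 + ZW) * (T * (a + b)) = (2^-1 + ZW) * T * (a + b)) in h; last by rewrite mulrA.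
nra.
Qed.

End plan_expansion.

(** * Second moments of two-sample averages *)

Section independence.
Context (R : realType) (dT : measure_display) (T : measurableType dT) (Pr : probability T R).

(** Finite measures that agree on rectangles agree on the product sigma-algebra. Carrying the events
    D and D' along allows a triple to be treated one coordinate at a time, the earlier coordinates
    being kept as events. *)
Lemma rectangle_proportional d1 (T1 : measurableType d1) d2 (T2 : measurableType d2)
    (D D' : set T) (c : R) (V : {RV Pr >-> T1}) (W : {RV Pr >-> T2}) :
  measurable D -> measurable D' -> 0 <= c ->
  (forall B1 B2, measurable B1 -> measurable B2 ->
    Pr (V @^-1` B1 `&` W @^-1` B2 `&` D') = (c%:E * Pr (V @^-1` B1 `&` W @^-1` B2 `&` D))%E) ->
  forall B, measurable B ->
    Pr ((fun t => (V t, W t)) @^-1` B `&` D') =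
    (c%:E * Pr ((fun t => (V t, W t)) @^-1` B `&` D))%E.
Proof.
move=> mD mD' c0 h.
have mVW : measurable_fun setT (fun t => (V t, W t)).
  by apply/measurable_fun_pairP; split; exact: measurable_funP.
pose VW t := (V t, W t).
pose m1 : {measure set _ -> \bar R} := pushforward (mrestr Pr mD') VW.
pose m2 : {measure set _ -> \bar R} :=
  mscale (NngNum c0) (pushforward (mrestr Pr mD) VW).
pose C : set (set (T1 * T2)) := [set A `*` B | A in measurable & B in measurable].
have CI : setI_closed C.
  move=> _ _ [X1 mX1 [X2 mX2 <-]] [Y1 mY1 [Y2 mY2 <-]].
  rewrite -setXI; exists (X1 `&` Y1); first exact: measurableI.
  by exists (X2 `&` Y2) => //; exact: measurableI.
move=> B mB.
suff : m1 mVW B = m2 mVW B by [].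
apply: (measure_unique C (fun=> setT)) => //.
- by rewrite measurable_prod_measurableType.
- by move=> _; exists setT => //; exists setT => //; rewrite setXTT.
- by rewrite bigcup_const//; exists 0%N.
- move=> _ [B1 mB1 [B2 mB2 <-]].
  exact: (h B1 B2 mB1 mB2).
- move=> _; apply: (@le_lt_trans _ _ 1%E); last by rewrite ltry.
  by apply: probability_le1; rewrite preimage_setT; exact: measurableI.
Qed.

Definition rv_pair d1 (T1 : measurableType d1) d2 (T2 : measurableType d2)
    (V : {RV Pr >-> T1}) (W : {RV Pr >-> T2}) : {RV Pr >-> (T1 * T2)%type} :=
  MeasurableFun.Pack (MeasurableFun.Class (isMeasurableFun.Build _ _ _ _ _
    (proj2 (measurable_fun_pairP (fun t => (V t, W t)))
       (conj (measurable_funP V) (measurable_funP W))))).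

Lemma measurable_preimage d1 (T1 : measurableType d1) (V : {RV Pr >-> T1}) B :
  measurable B -> measurable (V @^-1` B).
Proof. by move=> mB; rewrite -[X in measurable X]setTI; exact: measurable_funP. Qed.

Lemma int_independent d1 (T1 : measurableType d1) d2 (T2 : measurableType d2)
    (U : {RV Pr >-> T1}) (V : {RV Pr >-> T2}) (mu : probability T1 R) (F : T2 * T1 -> R) :
  has_law U mu ->
  (forall A B, measurable A -> measurable B ->
    Pr (V @^-1` B `&` U @^-1` A) = (Pr (U @^-1` A) * Pr (V @^-1` B))%E) ->
  bounded_measurable F ->
  \int[Pr]_t F (V t, U t) = \int[distribution Pr V]_v \int[mu]_u F (v, u).
Proof.
move=> lawU indep bF; rewrite -bmf_Fubini1//.
apply: (@int_image _ _ _ _ _ Pr (distribution Pr V \x mu)%E (rv_pair V U)) => // B mB.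
apply/esym.
pose m' : {measure set _ -> \bar R} := distribution Pr (rv_pair V U).
apply: (@product_measure_unique _ _ _ _ _ _ _ m') => // B1 A1 mB1 mA1.
by rewrite muleC -[X in (X * _)%E](lawU A1 mA1); exact: indep.
Qed.

Section family.
Context d (E : measurableType d) (I : choiceType) (Z : I -> {RV Pr >-> E}).
Hypothesis indepZ : mutually_independent Z.

(** The indices [i1], [i2], [i3] may coincide, whereas independence is stated for lists without
    repetition: duplicates are removed, and each index receives the intersection of all conditions
    imposed on it. *)
Lemma independent_of_three i0 i1 i2 i3 (A B1 B2 B3 : set E) :
  i0 != i1 -> i0 != i2 -> i0 != i3 ->
  measurable A -> measurable B1 -> measurable B2 -> measurable B3 ->
  Pr (Z i1 @^-1` B1 `&` (Z i2 @^-1` B2 `&` Z i3 @^-1` B3) `&` Z i0 @^-1` A) =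
  (Pr (Z i0 @^-1` A) * Pr (Z i1 @^-1` B1 `&` (Z i2 @^-1` B2 `&` Z i3 @^-1` B3)))%E.
Proof.
move=> n1 n2 n3 mA mB1 mB2 mB3.
pose S := undup [:: i1; i2; i3].
pose F i := (if i == i1 then B1 else setT) `&`
  ((if i == i2 then B2 else setT) `&` (if i == i3 then B3 else setT)).
pose G i := if i == i0 then A else F i.
have mF i : measurable (F i).
  by apply: measurableI; [|apply: measurableI]; case: ifP.
have mG i : measurable (G i) by rewrite /G; case: ifP.
have inS i : (i \in S) = [|| i == i1, i == i2 | i == i3].
  by rewrite mem_undup !inE.
have i0S : i0 \notin S by rewrite inS !negb_or n1 n2.
have bigF : \big[setI/setT]_(i <- S) (Z i @^-1` F i) =
    Z i1 @^-1` B1 `&` (Z i2 @^-1` B2 `&` Z i3 @^-1` B3).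
  rewrite -bigcap_seq; apply/seteqP; split => t /=.
    move=> h; split; [|split].
    - by have := h i1; rewrite /= inS eqxx => /(_ isT)[]; rewrite eqxx.
    - by have := h i2; rewrite /= inS eqxx orbT => /(_ isT)[_ []]; rewrite eqxx.
    - by have := h i3; rewrite /= inS eqxx !orbT => /(_ isT)[_ []]; rewrite eqxx.
  move=> [h1 [h2 h3]] i _; rewrite /F; split; [|split].
  - by case: eqP => // ->.
  - by case: eqP => // ->.
  - by case: eqP => // ->.
have bigG : \big[setI/setT]_(i <- S) (Z i @^-1` G i) =
    \big[setI/setT]_(i <- S) (Z i @^-1` F i).
  rewrite big_seq [RHS]big_seq; apply: eq_bigr => i iS.
  by rewrite /G; case: eqP => // e; move: iS; rewrite e (negbTE i0S).
have prodG : (\prod_(i <- S) Pr (Z i @^-1` G i) = \prod_(i <- S) Pr (Z i @^-1` F i))%E.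
  rewrite big_seq [RHS]big_seq; apply: eq_bigr => i iS.
  by rewrite /G; case: eqP => // e; move: iS; rewrite e (negbTE i0S).
have uS : uniq S by exact: undup_uniq.
have := @indepZ (i0 :: S) G; rewrite /= i0S uS => /(_ isT mG).
rewrite !big_cons bigG bigF prodG {1 2}/G eqxx setIC => ->.
by rewrite -(indepZ uS mF) bigF.
Qed.

(** A product of two kernel values involves four sample points. It has expectation zero as soon as
    one of them differs from the other three and the kernel is centred in it; the other three may
    coincide. *)
Lemma int_independent_three i0 i1 i2 i3 (mu : probability E R)
    (F : E * (E * E) * E -> R) :
  i0 != i1 -> i0 != i2 -> i0 != i3 -> has_law (Z i0) mu -> bounded_measurable F ->
  (forall v, \int[mu]_u F (v, u) = 0) ->
  \int[Pr]_t F ((Z i1 t, (Z i2 t, Z i3 t)), Z i0 t) = 0.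
Proof.
move=> n1 n2 n3 law bF F0.
pose V := rv_pair (Z i1) (rv_pair (Z i2) (Z i3)).
transitivity (\int[distribution Pr V]_v \int[mu]_u F (v, u)); last first.
  by under eq_Rintegral do rewrite F0; rewrite Rint_cst.
apply: (@int_independent _ _ _ _ (Z i0) V mu F law _ bF) => A B mA mB.
have mZA := measurable_preimage (Z i0) mA.
have fin C : measurable C -> Pr C = (fine (Pr C))%:E.
  by move=> mC; rewrite fineK// fin_num_measure.
have c0 : 0 <= fine (Pr (Z i0 @^-1` A)) by rewrite fine_ge0.
rewrite -[in RHS](setIT (V @^-1` B)) (fin _ mZA).
apply: (rectangle_proportional (D := setT)) => // B1 B23 mB1 mB23.
rewrite setIT -setIA setIC -setIA [X in Pr (_ `&` X)]setIC.
rewrite [X in (_ * Pr X)%E]setIC.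
have mZB := measurable_preimage (Z i1) mB1.
apply: (rectangle_proportional (D := Z i1 @^-1` B1)) => //; first exact: measurableI.
move=> B2 B3 mB2 mB3; rewrite -(fin _ mZA).
rewrite [X in (_ * Pr X)%E]setIC -independent_of_three//.
by congr (Pr _); rewrite setIC -!setIA; congr (_ `&` _); rewrite setIC -setIA.
Qed.

End family.
End independence.

(** * Orthogonality and second moments *)

Section second_moments.
Context (R : realType) (dT : measure_display) (T : measurableType dT) (Pr : probability T R).

Lemma bmf_avg n (f : 'I_n -> T -> R) : (forall i, bounded_measurable (f i)) ->
  bounded_measurable (fun t => avg (fun i => f i t)).
Proof. by move=> bf; apply: bmfM; [exact: bmf_cst|exact: bmf_sum]. Qed.

Lemma bmf_sqr (f : T -> R) : bounded_measurable f ->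
  bounded_measurable (fun t => f t ^+ 2).
Proof. by move=> bf; under eq_fun do rewrite expr2; exact: bmfM. Qed.

(** Only the n diagonal terms of the n^2 products survive. *)
Lemma avg_orthogonal_moment n (f : 'I_n -> T -> R) (S : R) : (0 < n)%N ->
  (forall i, bounded_measurable (f i)) ->
  (forall i i', i != i' -> \int[Pr]_t (f i t * f i' t) = 0) ->
  (forall i, \int[Pr]_t (f i t ^+ 2) <= S) ->
  \int[Pr]_t (avg (fun i => f i t) ^+ 2) <= S / n%:R.
Proof.
move=> n0 bf ortho fS.
have bff i i' : bounded_measurable (fun t => f i t * f i' t) by exact: bmfM.
have -> : \int[Pr]_t (avg (fun i => f i t) ^+ 2) =
    n%:R^-1 * (n%:R^-1 * \sum_(i < n) \sum_(i' < n) \int[Pr]_t (f i t * f i' t)).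
  transitivity (\int[Pr]_t (n%:R^-1 * (n%:R^-1 * \sum_(i < n) \sum_(i' < n) (f i t * f i' t)))).
    apply: eq_Rintegral => t _; rewrite /avg expr2 mulrACA mulr_suml -mulrA.
    by congr (_ * (_ * _)); apply: eq_bigr => i _; rewrite mulr_sumr.
  have bs i : bounded_measurable (fun t => \sum_(i' < n) (f i t * f i' t)) by exact: bmf_sum.
  rewrite bmf_intZ; last by apply: bmfM; [exact: bmf_cst|exact: bmf_sum].
  rewrite bmf_intZ; last exact: bmf_sum.
  rewrite bmf_int_sum//; congr (_ * (_ * _)); apply: eq_bigr => i _.
  by rewrite bmf_int_sum.
rewrite [leRHS]mulrC ler_wpM2l ?invr_ge0 ?ler0n//.
rewrite mulrC ler_pdivrMr ?ltr0n// -[n in leRHS]card_ord mulr_natr -sumr_const.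
apply: ler_sum => i _; rewrite (bigD1 i)//= big1 ?addr0; last first.
  by move=> i' i'i; apply: ortho; rewrite eq_sym.
by under eq_Rintegral do rewrite -expr2; exact: fS.
Qed.

End second_moments.

Section two_samples.
Context (R : realType) (dT : measure_display) (T : measurableType dT) (Pr : probability T R).
Context d (E : measurableType d) (P Q : probability E R) (X Y : nat -> {RV Pr >-> E}).
Hypotheses (lawX : forall k, has_law (X k) P) (lawY : forall j, has_law (Y j) Q).
Let Z (i : nat + nat) := match i with inl k => X k | inr j => Y j end.
Hypothesis indep : mutually_independent Z.
Context (p : E * E -> R) (L : R).
Hypotheses (bp : bounded_measurable p) (pL : forall z, `|p z| <= L).

Let bpXY i j : bounded_measurable (fun t => p (X i t, Y j t)).
Proof.
by apply: (bmf_comp _ bp); apply/measurable_fun_pairP; split; exact: measurable_funP.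
Qed.

(** [Y j] is the fresh point; i = i' is allowed. *)
Lemma orthogonal_columns i i' j j' : (forall x, \int[Q]_y p (x, y) = 0) -> j != j' ->
  \int[Pr]_t (p (X i t, Y j t) * p (X i' t, Y j' t)) = 0.
Proof.
move=> p0 jj'.
pose F (z : E * (E * E) * E) := p (z.1.1, z.2) * p z.1.2.
have bF : bounded_measurable F.
  apply: bmfM.
    apply: (bmf_comp _ bp); apply/measurable_fun_pairP; split; last exact: measurable_snd.
    exact: measurableT_comp measurable_fst measurable_fst.
  by apply: (bmf_comp _ bp); exact: measurableT_comp measurable_snd measurable_fst.
apply: (@int_independent_three _ _ _ _ _ _ _ Z indep (inr j) (inl i) (inl i') (inr j') Q F) => //.
  exact: lawY.
move=> [x xy]; rewrite /F/= bmf_intZr ?p0 ?mul0r//; exact: bmf_pair1.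
Qed.

Lemma orthogonal_rows i i' j j' : (forall y, \int[P]_x p (x, y) = 0) -> i != i' ->
  \int[Pr]_t (p (X i t, Y j t) * p (X i' t, Y j' t)) = 0.
Proof.
move=> p0 ii'.
pose F (z : E * (E * E) * E) := p (z.2, z.1.1) * p z.1.2.
have bF : bounded_measurable F.
  apply: bmfM.
    apply: (bmf_comp _ bp); apply/measurable_fun_pairP; split; first exact: measurable_snd.
    exact: measurableT_comp measurable_fst measurable_fst.
  by apply: (bmf_comp _ bp); exact: measurableT_comp measurable_snd measurable_fst.
apply: (@int_independent_three _ _ _ _ _ _ _ Z indep (inl i) (inr j) (inl i') (inr j') P F) => //.
  exact: lawX.
move=> [y xy]; rewrite /F/= bmf_intZr ?p0 ?mul0r//; exact: bmf_pair2.
Qed.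

Let sqrL i j : \int[Pr]_t (p (X i t, Y j t) ^+ 2) <= L ^+ 2.
Proof.
rewrite -[leRHS](Rint_cst Pr); apply: bmf_le => [||t].
- exact: bmf_sqr.
- exact: bmf_cst.
- by rewrite -[leLHS]real_normK ?num_real// ler_sqr ?nnegrE// (le_trans _ (pL point)).
Qed.

Lemma row_moment i m : (0 < m)%N -> (forall x, \int[Q]_y p (x, y) = 0) ->
  \int[Pr]_t (avg (fun j : 'I_m => p (X i t, Y j t)) ^+ 2) <= L ^+ 2 / m%:R.
Proof.
move=> m0 p0; apply: (avg_orthogonal_moment (f := fun j t => p (X i t, Y j t))) => //.
by move=> j j' jj'; exact: orthogonal_columns.
Qed.

Lemma column_moment j n : (0 < n)%N -> (forall y, \int[P]_x p (x, y) = 0) ->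
  \int[Pr]_t (avg (fun i : 'I_n => p (X i t, Y j t)) ^+ 2) <= L ^+ 2 / n%:R.
Proof.
move=> n0 p0; apply: (avg_orthogonal_moment (f := fun i t => p (X i t, Y j t))) => //.
by move=> i i' ii'; exact: orthogonal_rows.
Qed.

(** Orthogonality is used twice: between rows, because p is centred in x, which gives 1/n, and
    within each row, because p is centred in y, which gives 1/m. *)
Lemma double_moment n m : (0 < n)%N -> (0 < m)%N ->
  (forall x, \int[Q]_y p (x, y) = 0) -> (forall y, \int[P]_x p (x, y) = 0) ->
  \int[Pr]_t (avg (fun i : 'I_n => avg (fun j : 'I_m => p (X i t, Y j t))) ^+ 2)
  <= L ^+ 2 / m%:R / n%:R.
Proof.
move=> n0 m0 pQ pP.
apply: (avg_orthogonal_moment (f := fun i t => avg (fun j : 'I_m => p (X i t, Y j t)))) => //.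
- by move=> i; apply: (bmf_avg (f := fun j t => p (X i t, Y j t))).
- move=> i i' ii'.
  transitivity (\int[Pr]_t avg (fun j : 'I_m => avg (fun j' : 'I_m =>
      p (X i t, Y j t) * p (X i' t, Y j' t)))).
    apply: eq_Rintegral => t _; rewrite mulrC -avgZ; apply: eq_avg => j.
    by rewrite mulrC -avgZ.
  have b2 (j j' : 'I_m) : bounded_measurable (fun t => p (X i t, Y j t) * p (X i' t, Y j' t)).
    exact: bmfM.
  rewrite bmf_intZ; last by apply: bmf_sum => j; exact: bmf_avg.
  rewrite bmf_int_sum; last by move=> j; exact: bmf_avg.
  rewrite big1 ?mulr0// => j _.
  rewrite bmf_intZ; last by exact: bmf_sum.
  rewrite bmf_int_sum// big1 ?mulr0// => j' _.
  exact: orthogonal_rows.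
- by move=> i; exact: row_moment.
Qed.

End two_samples.

(** * Plans between empirical measures *)

Section empirical_integral.
Context (R : realType) (d : measure_display) (T : measurableType d) (x : nat -> T).

Let nonneg_int n (f : T -> R) : measurable_fun setT f -> (forall z, 0 <= f z) ->
  \int[empirical x n]_z f z = avg (fun k : 'I_n.-1.+1 => f (x k)).
Proof.
move=> mf f0; have mF : measurable_fun setT (EFin \o f) by exact/measurable_EFinP.
rewrite /Rintegral /empirical ge0_integral_mscale//; last first.
  by move=> z _; rewrite lee_fin.
rewrite ge0_integral_measure_sum//; last by move=> z _; rewrite lee_fin.
under eq_bigr => k _ do rewrite integral_dirac// diracT mul1e.
by rewrite sumEFin -EFinM.
Qed.

(** Adding a bound M reduces to nonnegative functions, whose integral splits along the scaled sum of
    Dirac masses. *)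
Lemma int_empirical n (f : T -> R) : bounded_measurable f ->
  \int[empirical x n]_z f z = avg (fun k : 'I_n.-1.+1 => f (x k)).
Proof.
move=> bf; have [mf [M fM]] := bf.
have bfM : bounded_measurable (fun z => f z + M) by apply: bmfD => //; exact: bmf_cst.
have -> : \int[empirical x n]_z f z = \int[empirical x n]_z (f z + M) - M.
  by rewrite bmf_intD ?Rint_cst ?addrK//; exact: bmf_cst.
rewrite nonneg_int ?avgD ?avg_cst ?addrK//; first by case: bfM.
by move=> z; have := fM z; rewrite ler_norml -subr_ge0 opprK => /andP[].
Qed.

Lemma empirical_eq1 n (A : set T) : measurable A ->
  (forall k : 'I_n.-1.+1, A (x k)) -> @empirical R _ _ x n A = 1%E.
Proof.
move=> mA Ax.
rewrite [LHS]probability_Rint// int_empirical; last exact: bmf_indic.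
rewrite (@eq_avg _ _ _ (fun=> 1)) ?avg_cst// => k.
by rewrite indicE mem_set.
Qed.

End empirical_integral.

(** The last clause, convergence of the iteration from the constant 1, is kept because it later
    makes b depend measurably on the sample. *)
Lemma schrodinger_exists (R : realType) d1 (T1 : measurableType d1) d2 (T2 : measurableType d2)
    (mu : probability T1 R) (nu : probability T2 R) (k : T1 * T2 -> R) (dl : R) :
  0 < dl -> bounded_measurable k -> (forall z, dl <= k z) -> (forall z, k z <= 1) ->
  exists a b, [/\ positive_measurable a, positive_measurable b,
    forall x, a x * kernel_op nu k b x = 1,
    forall y, b y * kernel_op mu (swap_kernel k) a y = 1 &
    forall y, iter n (sinkhorn_step mu nu k) (fun _ => 1) y @[n --> \oo] --> b y].
Proof.
move=> dl0 bk dlk k1.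
have [b [pb fixb] cvgb] := sinkhorn_limit mu nu dl0 bk dlk k1.
have bk' : bounded_measurable (swap_kernel k) by exact: bmf_swap.
have pa := positive_scaling nu dl0 bk dlk pb.
have pka := positive_kernel_op mu dl0 bk' (fun z => dlk _) pa.
have pkb := positive_kernel_op nu dl0 bk dlk pb.
exists (scaling nu k b), b; split => // [x|y].
  by rewrite mulVf// gt_eqF//; exact: positive_gt0.
by rewrite -{1}fixb mulVf// gt_eqF//; exact: positive_gt0.
Qed.

(** The Sinkhorn step between empirical measures, read at the sample points. It involves only a
    finite matrix, and it will be used with the untruncated kernel, so that the truncation level may
    vary with the sample. *)
Definition discrete_step (R : realType) n m (k : 'I_n -> 'I_m -> R) (b : 'I_m -> R) j : R :=
  (avg (fun i => k i j * (avg (fun j' => k i j' * b j'))^-1))^-1.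

Section empirical_plan.
Context (R : realType) (d : nat) (eps M : R).
Local Notation E := (borelRd R d).
Hypotheses (eps0 : 0 < eps) (M0 : 0 <= M).
Context (n m : nat) (x y : nat -> E).
Hypothesis costM : forall (i : 'I_n.+1) (j : 'I_m.+1), 2^-1 * sqdist (x i) (y j) <= M.

Let Pn : probability E R := empirical x n.+1.
Let Qm : probability E R := empirical y m.+1.
Let k := @gibbs R d eps M.
Let kij (i : 'I_n.+1) (j : 'I_m.+1) := expR (- (2^-1 * sqdist (x i) (y j)) / eps).

Let kE (i : 'I_n.+1) (j : 'I_m.+1) : k (x i, y j) = kij i j.
Proof. by rewrite /k /gibbs/= min_l. Qed.

Let dl0 : 0 < expR (- M / eps). Proof. exact: expR_gt0. Qed.
Let bk : bounded_measurable k. Proof. exact: bmf_gibbs. Qed.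

Let kernel_opQ b (i : 'I_n.+1) : bounded_measurable b ->
  kernel_op Qm k b (x i) = avg (fun j : 'I_m.+1 => k (x i, y j) * b (y j)).
Proof. by move=> bb; rewrite /kernel_op int_empirical//; exact: bmf_kernel. Qed.

Let kernel_opP a (j : 'I_m.+1) : bounded_measurable a ->
  kernel_op Pn (swap_kernel k) a (y j) = avg (fun i : 'I_n.+1 => k (x i, y j) * a (x i)).
Proof.
by move=> ba; rewrite /kernel_op int_empirical//; apply: bmf_kernel => //; exact: bmf_swap.
Qed.

Let step_discrete N : positive_measurable (iter N (sinkhorn_step Pn Qm k) (fun _ => 1)) /\
  forall j : 'I_m.+1, iter N (sinkhorn_step Pn Qm k) (fun _ => 1) (y j) =
    iter N (discrete_step kij) (fun _ => 1) j.
Proof.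
have klo := @gibbs_ge R d eps M eps0; have khi := @gibbs_le1 R d eps M eps0 M0.
elim: N => [|N [pb IHN]].
  by split => //; split; [exact: bmf_cst|exists 1].
split; first exact: (positive_sinkhorn_step Pn Qm dl0 bk klo).
move=> j; rewrite !iterS {1}/sinkhorn_step /scaling kernel_opP; last first.
  by have [] := positive_scaling Qm dl0 bk klo pb.
rewrite /discrete_step; congr (_^-1); apply: eq_avg => i.
rewrite kE kernel_opQ; last by have [] := pb.
by congr (_ * _^-1); apply: eq_avg => j'; rewrite kE IHN.
Qed.

Lemma empirical_plan : exists (a : 'I_n.+1 -> R) (b : 'I_m.+1 -> R),
  let xih i j := a i * kij i j * b j in
  [/\ forall i, 0 < a i /\ forall j, 0 < b j,
    forall j, iter N (discrete_step kij) (fun _ => 1) j @[N --> \oo] --> b j,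
    forall i, a i * avg (fun j => kij i j * b j) = 1,
    forall j, b j * avg (fun i => kij i j * a i) = 1 &
    (forall i j, expR (- M / eps) ^+ 2 <= xih i j <= expR (- M / eps) ^- 2) /\
    forall eta : E * E -> R, measurable_fun setT eta ->
      \int[eot_plan eps Pn Qm]_z eta z = avg (fun i => avg (fun j => xih i j * eta (x i, y j)))].
Proof.
have klo := @gibbs_ge R d eps M eps0; have khi := @gibbs_le1 R d eps M eps0 M0.
have [a [b [pa pb ab1 ab2 cvgb]]] := schrodinger_exists Pn Qm dl0 bk klo khi.
have [ba _] := pa; have [bb _] := pb.
exists (fun i => a (x i)), (fun j => b (y j)) => xih.
have xihE i j : xih i j = scaled_kernel k a b (x i, y j).
  by rewrite /xih /scaled_kernel/= kE.
split.
- by move=> i; split=> [|j]; exact: positive_gt0.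
- move=> j; under eq_fun do rewrite -(step_discrete _).2; exact: cvgb.
- by move=> i; rewrite -[RHS](ab1 (x i)) kernel_opQ//; congr (_ * _); apply: eq_avg => j; rewrite kE.
- by move=> j; rewrite -[RHS](ab2 (y j)) kernel_opP//; congr (_ * _); apply: eq_avg => i; rewrite kE.
split.
  by move=> i j; rewrite xihE; exact: scaled_kernel_bounds ab1 ab2 _.
move=> eta meta.
(* A bound for |eta| at all pairs of sample points. As the plan charges only these pairs, clamping
   at N changes nothing, and [eta] may be any measurable function. *)
pose N := \sum_(i < n.+1) \sum_(j < m.+1) `|eta (x i, y j)|.
pose etaN z := clamp N (eta z).
have N0 : 0 <= N by apply: sumr_ge0 => i _; exact: sumr_ge0.
have etaN_eq (i : 'I_n.+1) (j : 'I_m.+1) : etaN (x i, y j) = eta (x i, y j).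
  apply: clamp_id; rewrite /N (bigD1 i)//= (bigD1 j)//= -addrA lerDl addr_ge0//.
    exact: sumr_ge0.
  by apply: sumr_ge0 => i' _; exact: sumr_ge0.
have betaN : bounded_measurable etaN by exact: bmf_clamp.
have [metaN _] := betaN.
have bxi : bounded_measurable (scaled_kernel k a b) by exact: bmf_scaled_kernel.
pose K1 : set E := \bigcup_(i in [set: 'I_n.+1]) [set x i].
pose K2 : set E := \bigcup_(j in [set: 'I_m.+1]) [set y j].
have mK1 : measurable K1.
  apply: fin_bigcup_measurable => [|i _]; first exact: finite_finset.
  by apply: measurable_compact; exact: compact_set1.
have mK2 : measurable K2.
  apply: fin_bigcup_measurable => [|i _]; first exact: finite_finset.
  by apply: measurable_compact; exact: compact_set1.
have PK1 : Pn K1 = 1%E by apply: empirical_eq1 => // i; exists i.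
have QK2 : Qm K2 = 1%E by apply: empirical_eq1 => // j; exists j.
have costK : forall u v, K1 u -> K2 v -> 2^-1 * sqdist u v <= M.
  by move=> u v [i _ ->] [j _ ->].
have piE := eot_plan_density eps0 M0 mK1 mK2 PK1 QK2 costK pa pb ab1 ab2.
have dom := density_dominates bxi piE.
have mK12 : measurable (K1 `*` K2) by exact: measurableX.
have plan1 : \forall z \ae eot_plan eps Pn Qm, etaN z = eta z.
  apply: (null_dominates_ae dom).
  pose rho : probability (E * E)%type R := (Pn \x Qm)%E.
  have K12 : rho (K1 `*` K2) = 1%E by rewrite [LHS]product_measure1E// [X in (X * _)%E]PK1 [X in (_ * X)%E]QK2 mule1.
  by apply: filterS (prob1_ae mK12 K12) => -[u v] [[i _ /= ->] [j _ /= ->]].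
have plan1' : etaN = eta %[ae eot_plan eps Pn Qm] by apply: filterS plan1 => z e _.
rewrite -(Rint_ae_eq metaN meta plan1') (density_int bxi piE betaN).
have bF : bounded_measurable (fun z => etaN z * scaled_kernel k a b z) by exact: bmfM.
rewrite (bmf_Fubini1 Pn Qm bF) int_empirical; last exact: (bmf_int2 Qm bF).
apply: eq_avg => i; rewrite int_empirical; last exact: (bmf_pair1 _ bF).
by apply: eq_avg => j; rewrite etaN_eq mulrC -xihE.
Qed.

End empirical_plan.

Lemma measurable_avg (R : realType) d (T : measurableType d) n (f : 'I_n -> T -> R) :
  (forall i, measurable_fun setT (f i)) -> measurable_fun setT (fun t => avg (fun i => f i t)).
Proof. by move=> mf; apply: measurable_funM => //; exact: measurable_sum. Qed.

Lemma avg_gt0 (R : realType) n (f : 'I_n.+1 -> R) : (forall i, 0 < f i) -> 0 < avg f.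
Proof.
move=> f0; rewrite /avg mulr_gt0 ?invr_gt0 ?ltr0n// big_ord_recl ltr_pwDl//.
by apply: sumr_ge0 => i _; exact: ltW.
Qed.

(** * Measurable dependence of the plan on the sample *)

Section random_plan.
Context (R : realType) (d : nat) (eps M : R).
Local Notation E := (borelRd R d).
Hypotheses (eps0 : 0 < eps) (M0 : 0 <= M).
Context (dT : measure_display) (T : measurableType dT) (X Y : nat -> T -> E).
Hypotheses (mX : forall i, measurable_fun setT (X i)).
Hypotheses (mY : forall i, measurable_fun setT (Y i)).
Context (n m : nat).

Let kij t (i : 'I_n.+1) (j : 'I_m.+1) := expR (- (2^-1 * sqdist (X i t) (Y j t)) / eps).
Let plan t := eot_plan eps (empirical (fun k => X k t) n.+1) (empirical (fun k => Y k t) m.+1).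

(** The representation of the plan holds for every t; only the uniform bounds on its density require
    the cost to stay below M at the sample points. *)
Lemma random_plan : exists (a : T -> 'I_n.+1 -> R) (b : T -> 'I_m.+1 -> R),
  let xih t i j := a t i * kij t i j * b t j in
  [/\ forall t, (forall i, 0 < a t i) /\ (forall j, 0 < b t j),
    forall t, (forall i, avg (fun j => xih t i j) = 1) /\ (forall j, avg (fun i => xih t i j) = 1),
    forall i j, measurable_fun setT (fun t => xih t i j),
    forall t, (forall (i : 'I_n.+1) (j : 'I_m.+1), 2^-1 * sqdist (X i t) (Y j t) <= M) ->
      forall i j, expR (- M / eps) ^+ 2 <= xih t i j <= expR (- M / eps) ^- 2 &
    forall eta : E * E -> R, measurable_fun setT eta -> forall t,
      \int[plan t]_z eta z = avg (fun i => avg (fun j => xih t i j * eta (X i t, Y j t)))].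
Proof.
have H t : exists ab : ('I_n.+1 -> R) * ('I_m.+1 -> R),
  let xih i j := ab.1 i * kij t i j * ab.2 j in
  [/\ forall i, 0 < ab.1 i /\ forall j, 0 < ab.2 j,
    forall j, iter N (discrete_step (kij t)) (fun _ => 1) j @[N --> \oo] --> ab.2 j,
    forall i, ab.1 i * avg (fun j => kij t i j * ab.2 j) = 1,
    forall j, ab.2 j * avg (fun i => kij t i j * ab.1 i) = 1 &
    ((forall (i : 'I_n.+1) (j : 'I_m.+1), 2^-1 * sqdist (X i t) (Y j t) <= M) ->
    (forall i j, expR (- M / eps) ^+ 2 <= xih i j <= expR (- M / eps) ^- 2)) /\
    forall eta : E * E -> R, measurable_fun setT eta ->
      \int[plan t]_z eta z = avg (fun i => avg (fun j => xih i j * eta (X i t, Y j t)))].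
  have [cM|ncM] := pselect (forall (i : 'I_n.+1) (j : 'I_m.+1), 2^-1 * sqdist (X i t) (Y j t) <= M).
    have [a [b [h1 h2 h3 h4 [h5 h6]]]] :=
      @empirical_plan _ _ _ _ eps0 M0 n m (fun k => X k t) (fun k => Y k t) cM.
    by exists (a, b); split.
  (* Where the cost exceeds M, the truncation level is the sum of all costs, which dominates each of
     them. *)
  pose M' := \sum_(i < n.+1) \sum_(j < m.+1) 2^-1 * sqdist (X i t) (Y j t).
  have c0 (i : 'I_n.+1) (j : 'I_m.+1) : 0 <= 2^-1 * sqdist (X i t) (Y j t).
    by rewrite mulr_ge0// sqdist_ge0.
  have M'0 : 0 <= M' by apply: sumr_ge0 => i _; exact: sumr_ge0.
  have cM' (i : 'I_n.+1) (j : 'I_m.+1) : 2^-1 * sqdist (X i t) (Y j t) <= M'.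
    rewrite /M' (bigD1 i)//= (bigD1 j)//= -addrA lerDl addr_ge0//.
      exact: sumr_ge0.
    by apply: sumr_ge0 => i' _; exact: sumr_ge0.
  have [a [b [h1 h2 h3 h4 [h5 h6]]]] :=
    @empirical_plan _ _ _ _ eps0 M'0 n m (fun k => X k t) (fun k => Y k t) cM'.
  by exists (a, b); split.
have [ab Hab] := choice H.
have mk i j : measurable_fun setT (fun t => kij t i j).
  apply: measurableT_comp => //; apply: measurable_funM => //.
  by apply: measurableT_comp => //; apply: measurable_funM => //; exact: measurable_sqdist.
have k0 t i j : 0 < kij t i j by exact: expR_gt0.
have miter N j : measurable_fun setT (fun t => iter N (discrete_step (kij t)) (fun _ => 1) j) /\
    forall t, 0 < iter N (discrete_step (kij t)) (fun _ => 1) j.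
  elim: N j => [|N IHN] j; first by split.
  have pos1 t (i : 'I_n.+1) : 0 < avg (fun j' => kij t i j' *
      iter N (discrete_step (kij t)) (fun=> 1) j').
    by apply: avg_gt0 => j'; rewrite mulr_gt0//; have [_] := IHN j'.
  have pos2 t : 0 < avg (fun i => kij t i j * (avg (fun j' => kij t i j' *
      iter N (discrete_step (kij t)) (fun=> 1) j'))^-1).
    by apply: avg_gt0 => i; rewrite mulr_gt0// invr_gt0.
  split=> [|t]; last by rewrite iterS /discrete_step invr_gt0.
  apply: measurable_inv_pos; last exact: pos2.
  apply: (measurable_avg (f := fun i t => kij t i j * _)) => i.
  apply: measurable_funM => //; apply: measurable_inv_pos; last by move=> t; exact: pos1.
  apply: (measurable_avg (f := fun j' t => kij t i j' * _)) => j'.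
  by apply: measurable_funM => //; have [] := IHN j'.
(* [choice] gives no measurability, but b is the pointwise limit of iterates that are measurable in
   t, and a is determined by b. *)
have mb j : measurable_fun setT (fun t => (ab t).2 j).
  apply: (@measurable_fun_cvg _ _ _ _ (fun N t => iter N (discrete_step (kij t)) (fun _ => 1) j)).
    by move=> N; have [] := miter N j.
  by move=> t _; have [_ + _ _ _] := Hab t; exact.
have kb0 t i : 0 < avg (fun j => kij t i j * (ab t).2 j).
  by apply: avg_gt0 => j; rewrite mulr_gt0//; have [+ _ _ _ _] := Hab t; case/(_ i).
have ma i : measurable_fun setT (fun t => (ab t).1 i).
  rewrite (_ : (fun t => _) = (fun t => (avg (fun j => kij t i j * (ab t).2 j))^-1)).
    apply: measurable_inv_pos => //.
    by apply: (measurable_avg (f := fun j t => kij t i j * (ab t).2 j)) => j; exact: measurable_funM.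
  apply/funext => t; have [_ _ /(_ i) h _ _] := Hab t.
  by rewrite -[RHS]mul1r -h mulfK// gt_eqF.
exists (fun t => (ab t).1), (fun t => (ab t).2) => xih; split.
- by move=> t; have [h _ _ _ _] := Hab t; split=> [i|j]; [have [] := h i|have [_] := h ord0].
- move=> t; have [_ _ h1 h2 _] := Hab t; split=> [i|j].
    by rewrite -[RHS](h1 i) -avgZ; apply: eq_avg => j; rewrite /xih mulrA.
  by rewrite -[RHS](h2 j) -avgZ; apply: eq_avg => i; rewrite /xih; ring.
- by move=> i j; apply: measurable_funM => //; exact: measurable_funM.
- by move=> t h; have [_ _ _ _ [h' _]] := Hab t; exact: h'.
- by move=> eta meta t; have [_ _ _ _ [_ h']] := Hab t; exact: h'.
Qed.

End random_plan.

(** * Influence functions *)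

Section ae_sections.
Context (R : realType) d1 (T1 : measurableType d1) d2 (T2 : measurableType d2).
Context (mu : probability T1 R) (nu : probability T2 R).

Lemma ae_section (B : set (T1 * T2)) : (\forall z \ae (mu \x nu)%E, B z) ->
  \forall x \ae mu, \forall y \ae nu, B (x, y).
Proof.
move=> [N [mN N0 BN]].
have mf : measurable_fun setT (fun x => nu (xsection N x)) by exact: measurable_fun_xsection.
have int0 : (\int[mu]_x `|nu (xsection N x)| = 0)%E.
  by rewrite -N0; apply: eq_integral => x _; rewrite gee0_abs.
move/(ae_eq_integral_abs mu measurableT mf) : int0.
apply: filterS => x /(_ Logic.I)/= Nx.
exists (xsection N x); split => //; first exact: measurable_xsection.
by move=> y /= nB; rewrite /xsection/= inE; apply: BN.
Qed.

Lemma ae_swap (B : set (T1 * T2)) : (\forall z \ae (mu \x nu)%E, B z) ->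
  \forall z \ae (nu \x mu)%E, B (z.2, z.1).
Proof.
move=> [N [mN N0 BN]].
have ms : measurable_fun setT (fun z : T2 * T1 => (z.2, z.1)) by exact: measurable_swap.
exists ((fun z : T2 * T1 => (z.2, z.1)) @^-1` N); split.
- by rewrite -[X in measurable X]setTI; exact: ms.
- rewrite -N0; apply/esym.
  pose m0 : {measure set _ -> \bar R} := pushforward (nu \x mu)%E (fun z : T2 * T1 => (z.2, z.1)).
  apply: (@product_measure_unique _ _ _ _ _ mu nu (m0 ms)) => // A1 A2 mA1 mA2.
  rewrite /m0/= /pushforward.
  rewrite (_ : _ @^-1` _ = A2 `*` A1); last by apply/seteqP; split => -[u v] /= [? ?].
  by rewrite product_measure1E// muleC.
- by move=> z /= nB; apply: BN.
Qed.

Lemma ae_snd (B : set T2) : (\forall y \ae nu, B y) -> \forall z \ae (mu \x nu)%E, B z.2.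
Proof.
move=> [N [mN N0 BN]]; exists (setT `*` N); split.
- exact: measurableX.
- by rewrite product_measure1E// [X in (_ * X)%E]N0 mule0.
- by move=> z /= nB; split => //; exact: BN.
Qed.

Lemma Rint_ae_section (F G : T1 * T2 -> R) :
  measurable_fun setT F -> measurable_fun setT G -> F = G %[ae (mu \x nu)%E] ->
  \forall x \ae mu, \int[nu]_y F (x, y) = \int[nu]_y G (x, y).
Proof.
move=> mF mG /ae_section; apply: filterS => x FG; apply: Rint_ae_eq.
- exact: measurableT_comp mF (measurable_pair1 x).
- exact: measurableT_comp mG (measurable_pair1 x).
- by apply: filterS FG => y /(_ Logic.I).
Qed.

(** Makes the operators of the statement independent, up to null sets, of the version of the density
    and of the representative of the function. *)
Lemma kernel_op_ae (xt xi : T1 * T2 -> R) (g g' : T2 -> R) :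
  measurable_fun setT xt -> measurable_fun setT xi -> xt = xi %[ae (mu \x nu)%E] ->
  measurable_fun setT g -> measurable_fun setT g' -> g = g' %[ae nu] ->
  kernel_op nu xt g = kernel_op nu xi g' %[ae mu].
Proof.
move=> mxt mxi xtxi mg mg' gg'.
have mF : measurable_fun setT (fun z : T1 * T2 => xt z * g z.2).
  by apply: measurable_funM => //; exact: measurableT_comp mg measurable_snd.
have mG : measurable_fun setT (fun z : T1 * T2 => xi z * g' z.2).
  by apply: measurable_funM => //; exact: measurableT_comp mg' measurable_snd.
have FG : (fun z : T1 * T2 => xt z * g z.2) = (fun z => xi z * g' z.2) %[ae (mu \x nu)%E].
  by apply: filterS2 xtxi (ae_snd gg') => z /(_ Logic.I) e /(_ Logic.I) e' _; rewrite e e'.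
by apply: filterS (Rint_ae_section mF mG FG) => x.
Qed.

Lemma measurable_kernel_op (xt : T1 * T2 -> R) (g : T2 -> R) :
  measurable_fun setT xt -> measurable_fun setT g ->
  measurable_fun setT (kernel_op nu xt g).
Proof.
move=> mxt mg; apply: (@measurable_Rint2 _ _ _ _ _ nu (fun z : T1 * T2 => xt z * g z.2)).
by apply: measurable_funM => //; exact: measurableT_comp mg measurable_snd.
Qed.

End ae_sections.

Section mean_zero_inverse.
Context (R : realType) d1 (T1 : measurableType d1) d2 (T2 : measurableType d2).
Context (mu : probability T1 R) (nu : probability T2 R) (xi xt : T1 * T2 -> R) (ka : R).
Hypotheses (bxi : bounded_measurable xi) (ka0 : 0 < ka) (kaxi : forall z, ka <= xi z).
Hypothesis (xi1 : forall x, \int[nu]_y xi (x, y) = 1).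
Hypothesis (xi2 : forall y, \int[mu]_x xi (x, y) = 1).
Hypotheses (mxt : measurable_fun setT xt) (xtxi : xt = xi %[ae (mu \x nu)%E]).
Context (phit phi0 phi : T1 -> R).
Hypotheses (phit0 : phit = phi0 %[ae mu]) (bphi0 : bounded_measurable phi0).
Hypotheses (bphi : bounded_measurable phi) (phi_mean : \int[mu]_x phi x = 0).

Let K k f := kernel_op nu k (kernel_op mu (swap_kernel k) f).
Hypothesis phiE : forall x, phi x = phi0 x + K xi phi x.

Let bxi' : bounded_measurable (swap_kernel xi). Proof. exact: bmf_swap. Qed.

Let mxt' : measurable_fun setT (swap_kernel xt).
Proof. by apply: (measurableT_comp mxt); exact: measurable_swap. Qed.

Let xtxi' : swap_kernel xt = swap_kernel xi %[ae (nu \x mu)%E].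
Proof.
have h : \forall z \ae (mu \x nu)%E, xt z = xi z by apply: filterS xtxi => z /(_ Logic.I).
by apply: filterS (ae_swap h) => -[u v].
Qed.

Let K_ae f : measurable_fun setT f -> K xt f = K xi f %[ae mu].
Proof.
move=> mf; have [mxi _] := bxi; have [mxi' _] := bxi'.
apply: kernel_op_ae => //; try exact: measurable_kernel_op.
by apply: kernel_op_ae => //; apply: aeW.
Qed.

Lemma bmf_Lfun2 (f : T1 -> R) : bounded_measurable f -> f \in Lfun mu 2%:E.
Proof.
move=> bf; have [mf [M fM]] := bf.
have : f \in Lfun mu +oo%E.
  rewrite inE; apply/andP; split; rewrite inE//=.
  rewrite /finite_norm unlock; case: ifP => _; last by rewrite ltry.
  apply: (@le_lt_trans _ _ M%:E); last by rewrite ltry.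
  by apply/ess_supP; apply: aeW => x /=; rewrite lee_fin.
by apply: (Lfun_subset (p := 2%:E) (q := +oo%E)); rewrite ?lee1n ?leey//; exact: fin_num_measure.
Qed.

(** A bounded kernel maps integrable functions to bounded ones. This brings solutions in L^2 within
    reach of the sup-norm uniqueness of [neumann_unique]. *)
Let bmf_kernel_op_integrable (f : T1 -> R) : mu.-integrable setT (EFin \o f) ->
  bounded_measurable (kernel_op mu (swap_kernel xi) f).
Proof.
move=> intf; have mf : measurable_fun setT f by apply/measurable_EFinP; exact: measurable_int intf.
have [mxi' [L xiL]] := bxi'.
split; first exact: measurable_kernel_op.
exists (L * \int[mu]_x `|f x|) => y.
have intn : mu.-integrable setT (EFin \o (fun x => `|f x|)) by exact: integrable_norm.
have L0 : 0 <= L by exact: le_trans (xiL point).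
have mprod : measurable_fun setT (fun x => swap_kernel xi (y, x) * f x).
  by apply: measurable_funM => //; exact: measurableT_comp mxi' (measurable_pair1 y).
have intLn : mu.-integrable setT (EFin \o (fun x => L * `|f x|)).
  by apply: (@eq_integrable _ _ _ _ _ measurableT _ _ _ (integrableZl measurableT L intn)) => x _.
have intp : mu.-integrable setT (EFin \o (fun x => swap_kernel xi (y, x) * f x)).
  apply: le_integrable intLn => //; first exact/measurable_EFinP.
  by move=> x _; rewrite /= lee_fin normrM [leRHS]ger0_norm ?mulr_ge0// ler_wpM2r.
apply: le_trans (le_normr_Rintegral _ _) _ => //.
rewrite -RintegralZl//; apply: le_Rintegral => //; first exact: integrable_norm.
by move=> x _; rewrite normrM ler_wpM2r.
Qed.

(** The right-hand side phi0 + K h is a bounded representative h' of h. Since K h = K h' at every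
    point, h' solves the equation everywhere, as phi does. *)
Let solution_unique h : L2_mean_zero mu h -> h \- K xt h = phit %[ae mu] -> h = phi %[ae mu].
Proof.
move=> [hL2 h0] hE.
have mh : measurable_fun setT h by have := sub_Lfun_mfun hL2; rewrite inE.
have inth : mu.-integrable setT (EFin \o h).
  by apply/Lfun1_integrable; apply: (Lfun_subset12 _ hL2); exact: fin_num_measure.
pose h' x := phi0 x + K xi h x.
have bAh := bmf_kernel_op_integrable inth.
have bh' : bounded_measurable h' by apply: bmfD => //; exact: bmf_kernel_op.
have hh' : h = h' %[ae mu].
  apply: filterS3 hE (K_ae mh) phit0 => x /(_ Logic.I) e1 /(_ Logic.I) e2 /(_ Logic.I) e3 _.
  by rewrite /h' -e2 -e3 -e1 /= subrK.
have [mh' _] := bh'.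
have Kh : kernel_op mu (swap_kernel xi) h = kernel_op mu (swap_kernel xi) h'.
  apply/funext => y; have [mxi' _] := bxi'; apply: Rint_ae_eq.
  - by apply: measurable_funM => //; exact: measurableT_comp mxi' (measurable_pair1 y).
  - by apply: measurable_funM => //; exact: measurableT_comp mxi' (measurable_pair1 y).
  - by apply: filterS hh' => x e /e ->.
have h'E x : h' x = phi0 x + K xi h' x by rewrite {1}/h' /K Kh.
have h'0 : \int[mu]_x h' x = 0 by rewrite -h0; apply/esym; exact: Rint_ae_eq.
apply: filterS hh' => x e /e ->; apply/eqP; rewrite -subr_eq0; apply/eqP.
apply: (neumann_unique bxi ka0 kaxi xi1 xi2 (f := fun x => h' x - phi x)).
- exact: bmfB.
- by rewrite bmf_intB// h'0 phi_mean subrr.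
move=> z; rewrite {1}h'E {1}phiE opprD addrACA subrr add0r /K -kernel_opB//; try exact: bmf_kernel_op.
by congr kernel_op; apply/funext => y; rewrite kernel_opB.
Qed.

(** phi belongs to the set of admissible solutions, so [xget] does not fall back on its default;
    uniqueness identifies the chosen element with phi. *)
Lemma inv_one_sub_spec :
  inv_one_sub mu (K xt) phit = phi %[ae mu] /\
  measurable_fun setT (inv_one_sub mu (K xt) phit).
Proof.
have [mphi _] := bphi.
have ex : exists h, [set h | L2_mean_zero mu h /\ h \- K xt h = phit %[ae mu]] h.
  exists phi; split; first by split => //; exact: bmf_Lfun2.
  apply: filterS2 (K_ae mphi) phit0 => x /(_ Logic.I) e1 /(_ Logic.I) e2 _.
  by rewrite /= e1 e2 {1}phiE addrK.
have [[hL2 h0] hE] := xgetPex (cst 0) ex.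
split; first exact: solution_unique.
by have := sub_Lfun_mfun hL2; rewrite inE.
Qed.

End mean_zero_inverse.

Lemma compact_sqdist_bounded (R : realType) (d : nat) (K : set 'rV[R]_d) : compact K ->
  exists2 M, 0 <= M & forall x y, K x -> K y -> 2^-1 * sqdist x y <= M.
Proof.
move=> cK.
have coord i : exists B, forall x : 'rV[R]_d, K x -> `|x ord0 i| <= B.
  have cf : {within K, continuous (fun x : 'rV[R]_d => x ord0 i)}.
    by apply: continuous_subspaceT => x; exact: coord_continuous.
  have /compact_bounded [B [_ hB]] := continuous_compact cf cK.
  exists (`|B| + 1) => x Kx; apply: hB; last by exists x.
  by rewrite (le_lt_trans (ler_norm _))// ltrDl.
have [B hB] := choice coord.
pose M := \sum_(i < d) (B i + B i) ^+ 2.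
have M0 : 0 <= M by apply: sumr_ge0 => i _; exact: sqr_ge0.
exists (2^-1 * M); first by rewrite mulr_ge0.
move=> x y Kx Ky; rewrite ler_pM2l ?invr_gt0//; apply: ler_sum => i _.
have h1 := hB i x Kx; have h2 := hB i y Ky.
have h : `|x ord0 i - y ord0 i| <= B i + B i.
  by apply: le_trans (ler_normB _ _) _; exact: lerD.
by rewrite -[leLHS]real_normK ?num_real// ler_sqr ?nnegrE// (le_trans _ h).
Qed.

Lemma Lfun_oo_bounded_version (R : realType) d (T : measurableType d) (mu : probability T R)
    (f : T -> R) : f \in Lfun mu +oo%E ->
  measurable_fun setT f /\ exists2 f', bounded_measurable f' & f = f' %[ae mu].
Proof.
move=> fL; have mf : measurable_fun setT f by have := sub_Lfun_mfun fL; rewrite inE.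
split => //; have := sub_Lfun_finLfun fL; rewrite inE /finite_norm unlock.
have mu1 : (0 < mu setT)%E by rewrite [X in (_ < X)%E](probability_setT mu).
rewrite mu1 => h.
have [B hB] := @ess_supr_bounded _ _ _ mu (fun x => `|f x|) h.
have B0 : 0 <= Num.max 0 B by rewrite le_max lexx.
exists (fun z => clamp (Num.max 0 B) (f z)); first exact: bmf_clamp.
by apply: filterS hB => z fz _; rewrite clamp_id// le_max fz orbT.
Qed.

Section population.
Context (R : realType) (d : nat) (eps : R) (Omega : set 'rV[R]_d).
Local Notation E := (borelRd R d).
Context (P Q : probability E R) (eta : E * E -> R).
Hypotheses (eps0 : 0 < eps) (cO : compact Omega) (PO : P Omega = 1%E) (QO : Q Omega = 1%E).
Hypothesis eta_oo : eta \in Lfun (P \x Q)%E +oo%E.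

Let AP := op_P eps P Q.
Let AQ := op_Q eps P Q.
Let etax := eta_x eps P Q eta.
Let etay := eta_y eps P Q eta.
Let hX := inv_one_sub P (fun f => AQ (AP f)) (etax \- AQ etay).
Let hY := inv_one_sub Q (fun g => AP (AQ g)) (etay \- AP etax).
Let theta := \int[eot_plan eps P Q]_z eta z.

(* phi and psi are bounded versions of hX and hY, solving
   phi + A_Q psi + theta = eta_x and psi + A_P phi + theta = eta_y everywhere;
   these two equations are the last two conclusions. *)
Lemma population_projection : exists M a b phi psi eta',
  let xi := scaled_kernel (@gibbs R d eps M) a b in
  let zeta z := eta' z - phi z.1 - psi z.2 - theta in
  [/\ [/\ 0 <= M, forall x y, Omega x -> Omega y -> 2^-1 * sqdist x y <= M,
        positive_measurable a & positive_measurable b],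
    (forall x, \int[Q]_y xi (x, y) = 1) /\ (forall y, \int[P]_x xi (x, y) = 1),
    (forall z, expR (- M / eps) ^+ 2 <= xi z <= expR (- M / eps) ^- 2) /\
      [/\ bounded_measurable phi, bounded_measurable psi & bounded_measurable eta'],
    [/\ measurable_fun setT eta, measurable_fun setT hX & measurable_fun setT hY] /\
      [/\ eta = eta' %[ae (P \x Q)%E], hX = phi %[ae P] & hY = psi %[ae Q]] &
    (forall x, \int[Q]_y (xi (x, y) * zeta (x, y)) = 0) /\
    (forall y, \int[P]_x (xi (x, y) * zeta (x, y)) = 0)].
Proof.
have [M M0 costM] := compact_sqdist_bounded cO.
have bk := @bmf_gibbs R d eps M eps0 M0.
have klo := @gibbs_ge R d eps M eps0; have khi := @gibbs_le1 R d eps M eps0 M0.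
have dl0 : 0 < expR (- M / eps) by exact: expR_gt0.
have [a [b [pa pb ab1 ab2 _]]] := schrodinger_exists P Q dl0 bk klo khi.
pose xi := scaled_kernel (@gibbs R d eps M) a b.
have bxi : bounded_measurable xi by exact: bmf_scaled_kernel.
have [mxi _] := bxi.
have xi1 : forall x, \int[Q]_y xi (x, y) = 1 by move=> x; exact: scaled_kernel_int1.
have xi2 : forall y, \int[P]_x xi (x, y) = 1 by move=> y; exact: scaled_kernel_int2.
have xib : forall z, expR (- M / eps) ^+ 2 <= xi z <= expR (- M / eps) ^- 2.
  by move=> z; apply: (scaled_kernel_bounds dl0 bk klo khi pa pb ab1 ab2).
pose ka := expR (- M / eps) ^+ 2.
have ka0 : 0 < ka by rewrite exprn_gt0.
have kaxi z : ka <= xi z by have /andP[] := xib z.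
have mO : measurable (Omega : set E) by exact: measurable_compact.
have piE := eot_plan_density eps0 M0 mO mO PO QO costM pa pb ab1 ab2.
have dom := density_dominates bxi piE.
have RN := ae_eq_density bxi piE.
(* [xt] is the version used by the operators of the statement; [xi] is the version whose bounds and
   marginals hold at every point. *)
pose xt := eot_density eps P Q.
have mxt : measurable_fun setT xt.
  pose rho : probability (E * E)%type R := (P \x Q)%E.
  have iRN : rho.-integrable setT
      ('d (charge_of_finite_measure (eot_plan eps P Q)) '/d rho).
    by apply: Radon_Nikodym_integrable => /=; exact: dom.
  have mRN := measurable_int _ iRN.
  rewrite (_ : xt = fine \o ('d (charge_of_finite_measure (eot_plan eps P Q)) '/d rho))//.
  exact: measurableT_comp.
have xtxi : xt = xi %[ae (P \x Q)%E].
  by apply: filterS RN => z /(_ Logic.I) e _; rewrite /xt /eot_density /density e.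
have [meta [eta' beta' etaeta']] := Lfun_oo_bounded_version eta_oo.
have [meta' _] := beta'.
have bex : bounded_measurable (fun z => eta' z * xi z) by exact: bmfM.
have thetaE : theta = \int[(P \x Q)%E]_z (eta' z * xi z).
  rewrite -(density_int bxi piE beta'); apply: Rint_ae_eq => //.
  have h : \forall z \ae (P \x Q)%E, eta z = eta' z.
    by apply: filterS etaeta' => z /(_ Logic.I).
  by apply: filterS (null_dominates_ae dom h) => z e _.
pose ex x := \int[Q]_y (eta' (x, y) * xi (x, y)).
pose ey y := \int[P]_x (eta' (x, y) * xi (x, y)).
have bx : bounded_measurable ex by exact: (bmf_int2 Q bex).
have by' : bounded_measurable ey by exact: (bmf_int2 P (bmf_swap bex)).
have [mex _] := bx; have [mey _] := by'.
have ex_mean : \int[P]_x ex x = theta by rewrite thetaE (bmf_Fubini1 P Q bex).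
have ey_mean : \int[Q]_y ey y = theta by rewrite thetaE (bmf_Fubini2 P Q bex).
pose xi' := swap_kernel xi.
have bxi' : bounded_measurable xi' by exact: bmf_swap.
have [mxi' _] := bxi'.
have kaxi' z : ka <= xi' z by exact: kaxi.
have mxt' : measurable_fun setT (swap_kernel xt).
  by apply: (measurableT_comp mxt); exact: measurable_swap.
have xtxi' : swap_kernel xt = xi' %[ae (Q \x P)%E].
  have h : \forall z \ae (P \x Q)%E, xt z = xi z by apply: filterS xtxi => z /(_ Logic.I).
  by apply: filterS (ae_swap h) => -[u v].
have etax_ae : etax = ex %[ae P].
  have FG : (fun z => eta z * xt z) = (fun z => eta' z * xi z) %[ae (P \x Q)%E].
    by apply: filterS2 etaeta' xtxi => z /(_ Logic.I) e1 /(_ Logic.I) e2 _; rewrite e1 e2.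
  have mF : measurable_fun setT (fun z => eta z * xt z) by exact: measurable_funM.
  by apply: filterS (Rint_ae_section mF (proj1 bex) FG) => x e _.
have etay_ae : etay = ey %[ae Q].
  have h : \forall z \ae (P \x Q)%E, eta z * xt z = eta' z * xi z.
    by apply: filterS2 etaeta' xtxi => z /(_ Logic.I) e1 /(_ Logic.I) e2; rewrite e1 e2.
  have FG : swap_kernel (fun z => eta z * xt z) = swap_kernel (fun z => eta' z * xi z)
      %[ae (Q \x P)%E].
    by apply: filterS (ae_swap h) => -[u v].
  have mF : measurable_fun setT (swap_kernel (fun z => eta z * xt z)).
    by apply: (@measurableT_comp _ _ _ _ _ _ (fun z => eta z * xt z));
      [exact: measurable_funM|exact: measurable_swap].
  by apply: filterS (Rint_ae_section mF (proj1 (bmf_swap bex)) FG) => x e _.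
have metax : measurable_fun setT etax.
  by apply: (@measurable_Rint2 _ _ _ _ _ Q (fun z => eta z * xt z)); exact: measurable_funM.
have metay : measurable_fun setT etay.
  apply: (@measurable_Rint2 _ _ _ _ _ P (swap_kernel (fun z => eta z * xt z))).
  by apply: (@measurableT_comp _ _ _ _ _ _ (fun z => eta z * xt z));
      [exact: measurable_funM|exact: measurable_swap].
pose KQ g := kernel_op Q xi g; pose KP f := kernel_op P xi' f.
have bKQ g : bounded_measurable g -> bounded_measurable (KQ g) by exact: bmf_kernel_op.
have bKP g : bounded_measurable g -> bounded_measurable (KP g) by exact: bmf_kernel_op.
have KQ_mean g : bounded_measurable g -> \int[P]_x KQ g x = \int[Q]_y g y.
  by move=> bg; exact: (@int_kernel_op _ _ _ _ _ P Q xi bxi xi2 g bg).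
have KP_mean g : bounded_measurable g -> \int[Q]_x KP g x = \int[P]_y g y.
  by move=> bg; exact: (@int_kernel_op _ _ _ _ _ Q P xi' bxi' xi1 g bg).
pose phi0 x := ex x - KQ ey x; pose psi0 y := ey y - KP ex y.
have bphi0 : bounded_measurable phi0 by apply: bmfB => //; exact: bKQ.
have bpsi0 : bounded_measurable psi0 by apply: bmfB => //; exact: bKP.
have phi0_mean : \int[P]_x phi0 x = 0.
  by rewrite bmf_intB ?KQ_mean ?ex_mean ?ey_mean ?subrr//; exact: bKQ.
have psi0_mean : \int[Q]_y psi0 y = 0.
  by rewrite bmf_intB ?KP_mean ?ex_mean ?ey_mean ?subrr//; exact: bKP.
have [phi [bphi phi_mean phiE]] := neumann_solution bxi ka0 kaxi xi1 xi2 bphi0 phi0_mean.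
have [psi [bpsi psi_mean psiE]] := neumann_solution bxi' ka0 kaxi' xi2 xi1 bpsi0 psi0_mean.
have phit0 : (etax \- AQ etay) = phi0 %[ae P].
  have h := kernel_op_ae mxt mxi xtxi metay mey etay_ae.
  by apply: filterS2 etax_ae h => x /(_ Logic.I) e1 /(_ Logic.I) e2 _; rewrite /= e1 /phi0 /KQ -e2.
have psit0 : (etay \- AP etax) = psi0 %[ae Q].
  have h := kernel_op_ae mxt' mxi' xtxi' metax mex etax_ae.
  by apply: filterS2 etay_ae h => x /(_ Logic.I) e1 /(_ Logic.I) e2 _; rewrite /= e1 /psi0 /KP -e2.
have [hX_ae mhX] := inv_one_sub_spec bxi ka0 kaxi xi1 xi2 mxt xtxi phit0 bphi0 bphi phi_mean phiE.
have [hY_ae mhY] := inv_one_sub_spec bxi' ka0 kaxi' xi2 xi1 mxt' xtxi' psit0 bpsi0 bpsi psi_mean psiE.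
have psi_eq y : psi y = ey y - KP phi y - theta.
  (* The Neumann series define phi and psi separately. Here [psi1], built from phi, has mean zero
     and solves the same equation as psi, so uniqueness couples the two. *)
  pose psi1 y := ey y - KP phi y - theta.
  have bpsi1 : bounded_measurable psi1.
    by apply: bmfB; [apply: bmfB => //; exact: bKP|exact: bmf_cst].
  have KQpsi1 x : KQ psi1 x = ex x - phi x - theta.
    rewrite /KQ /psi1 kernel_opB//; [|by apply: bmfB => //; exact: bKP|exact: bmf_cst].
    rewrite kernel_opB//; last exact: bKP.
    rewrite kernel_op_cst// phiE /phi0 /KQ /KP; ring.
  have psi1E y' : psi1 y' = psi0 y' + KP (KQ psi1) y'.
    have -> : KQ psi1 = (fun x => ex x - phi x - theta) by apply/funext.
    rewrite /KP kernel_opB//; [|exact: bmfB|exact: bmf_cst].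
    rewrite kernel_opB// kernel_op_cst// /psi0 /psi1 /KP; ring.
  apply/eqP; rewrite -subr_eq0; apply/eqP.
  apply: (neumann_unique bxi' ka0 kaxi' xi2 xi1 (f := fun y => psi y - psi1 y)).
  - exact: bmfB.
  - rewrite bmf_intB// psi_mean sub0r /psi1 bmf_intB; [|by apply: bmfB => //; exact: bKP|exact: bmf_cst].
    rewrite bmf_intB//; last exact: bKP.
    by rewrite ey_mean KP_mean// phi_mean Rint_cst subr0 subrr oppr0.
  move=> y'; rewrite {1}psiE {1}psi1E opprD addrACA subrr add0r.
  rewrite -kernel_opB//; try exact: bmf_kernel_op.
  by congr kernel_op; apply/funext => x; rewrite kernel_opB.
have KQpsi x : KQ psi x = ex x - phi x - theta.
  have -> : psi = (fun y => ey y - KP phi y - theta) by apply/funext.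
  rewrite /KQ kernel_opB//; [|by apply: bmfB => //; exact: bKP|exact: bmf_cst].
  rewrite kernel_opB//; last exact: bKP.
  rewrite kernel_op_cst// phiE /phi0 /KQ /KP; ring.
exists M, a, b, phi, psi, eta'.
split => //; split=> [x|y].
- have b1 : bounded_measurable (fun y => eta' (x, y) * xi (x, y)) by exact: (bmf_pair1 x bex).
  have b2 : bounded_measurable (fun y => xi (x, y)) by exact: (bmf_pair1 x bxi).
  have b3 : bounded_measurable (fun y => xi (x, y) * psi y) by exact: bmfM.
  have b4 : bounded_measurable (fun y => (phi x + theta) * xi (x, y)).
    by apply: bmfM => //; exact: bmf_cst.
  transitivity (\int[Q]_y (eta' (x, y) * xi (x, y) - xi (x, y) * psi y - (phi x + theta) * xi (x, y))).
    by apply: eq_Rintegral => y _ /=; rewrite -/xi; ring.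
  rewrite bmf_intB//; last exact: bmfB.
  rewrite bmf_intB// bmf_intZ// xi1 mulr1.
  have := KQpsi x; rewrite /KQ /kernel_op => ->; rewrite /ex; ring.
- have b1 : bounded_measurable (fun x => eta' (x, y) * xi (x, y)) by exact: (bmf_pair2 y bex).
  have b2 : bounded_measurable (fun x => xi (x, y)) by exact: (bmf_pair2 y bxi).
  have b3 : bounded_measurable (fun x => xi (x, y) * phi x) by exact: bmfM.
  have b4 : bounded_measurable (fun x => (psi y + theta) * xi (x, y)).
    by apply: bmfM => //; exact: bmf_cst.
  transitivity (\int[P]_x (eta' (x, y) * xi (x, y) - xi (x, y) * phi x - (psi y + theta) * xi (x, y))).
    by apply: eq_Rintegral => x _ /=; rewrite -/xi; ring.
  rewrite bmf_intB//; last exact: bmfB.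
  rewrite bmf_intB// bmf_intZ// xi2 mulr1 psi_eq /KP /kernel_op /xi' /swap_kernel/= /ey; ring.
Qed.

End population.

(** * Size of the remainder *)

Section almost_sure.
Context (R : realType) (dT : measure_display) (T : measurableType dT) (Pr : probability T R).

Lemma ae_law d (E : measurableType d) (U : {RV Pr >-> E}) (mu : probability E R) (B : set E) :
  has_law U mu -> (\forall x \ae mu, B x) -> \forall t \ae Pr, B (U t).
Proof.
move=> law [N [mN N0 BN]]; exists (U @^-1` N); split.
- exact: measurable_preimage.
- by rewrite -N0 -law.
- by move=> t /= nB; apply: BN.
Qed.

Lemma ae_law_eq d (E : measurableType d) (U : {RV Pr >-> E}) (mu : probability E R)
    (A : set E) (f g : E -> R) : has_law U mu -> measurable A -> mu A = 1%E ->
  f = g %[ae mu] -> \forall t \ae Pr, A (U t) /\ f (U t) = g (U t).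
Proof.
move=> law mA A1 fg; apply: (@ae_law _ _ U mu [set x | A x /\ f x = g x]) => //.
by apply: filterS2 (prob1_ae mA A1) fg => x Ax /(_ Logic.I).
Qed.

Lemma ae_law_pair d (E : measurableType d) (P Q : probability E R) (X Y : nat -> {RV Pr >-> E})
    (B : set (E * E)) :
  (forall k, has_law (X k) P) -> (forall j, has_law (Y j) Q) ->
  mutually_independent (fun i : nat + nat => match i with inl k => X k | inr j => Y j end) ->
  (\forall z \ae (P \x Q)%E, B z) -> forall i j, \forall t \ae Pr, B (X i t, Y j t).
Proof.
move=> lawX lawY indep hB i j.
apply: (@ae_law _ _ (rv_pair (X i) (Y j)) (P \x Q)%E) => // C mC; apply/esym.
pose m' : {measure set _ -> \bar R} := distribution Pr (rv_pair (X i) (Y j)).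
apply: (@product_measure_unique _ _ _ _ _ _ _ m') => // A1 A2 mA1 mA2.
rewrite -[X in (X * _)%E](lawX i A1 mA1) -[X in (_ * X)%E](lawY j A2 mA2).
have := @indep [:: inl i; inr j] (fun s => match s with inl _ => A1 | inr _ => A2 end) isT.
rewrite !big_cons !big_nil setIT mule1; apply.
by case.
Qed.

(** The event A depends on the error itself, which S dominates only almost surely; A is therefore
    intersected with the event that S reaches the threshold before integrating. *)
Lemma ae_markov (A : set T) (S : T -> R) (s : R) : 0 < s -> measurable A ->
  bounded_measurable S -> (forall t, 0 <= S t) -> (\forall t \ae Pr, A t -> s <= S t) ->
  (Pr A <= (\int[Pr]_t S t / s)%:E)%E.
Proof.
move=> s0 mA bS S0 AS; have [mS _] := bS.
pose B := A `&` [set t | s <= S t].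
have mB : measurable B by apply: measurableI => //; exact: measurable_set_le.
rewrite [leLHS]probability_Rint// lee_fin ler_pdivlMr// -bmf_intZr; last exact: bmf_indic.
have -> : \int[Pr]_t (\1_A t * s) = \int[Pr]_t (\1_B t * s).
  apply: Rint_ae_eq.
  - by apply: measurable_funM => //; exact: measurable_indic.
  - by apply: measurable_funM => //; exact: measurable_indic.
  - apply: filterS AS => t h _; congr (_ * _); rewrite !indicE; congr (_%:R); congr nat_of_bool.
    apply/idP/idP => /set_mem h'; apply/mem_set; last by case: h'.
    by split => //; exact: h.
apply: bmf_le => [|//|t].
  by apply: bmfM; [exact: bmf_indic|exact: bmf_cst].
rewrite indicE; case: (boolP (t \in B)) => [/set_mem[_ h]|_]; first by rewrite mul1r.
by rewrite mul0r.
Qed.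

End almost_sure.

Section sample_expansion.
Context (R : realType) (eps M Z theta : R) (n m : nat).
Hypothesis eps0 : 0 < eps.
Context (k xi et : 'I_n.+1 -> 'I_m.+1 -> R) (al phi a : 'I_n.+1 -> R) (be psi b : 'I_m.+1 -> R).
Let dl := expR (- M / eps).
Hypotheses (al0 : forall i, 0 < al i) (be0 : forall j, 0 < be j).
Hypotheses (a0 : forall i, 0 < a i) (b0 : forall j, 0 < b j).
Hypothesis xiE : forall i j, xi i j = al i * k i j * be j.
Let xih i j := a i * k i j * b j.
Hypotheses (xi_bounds : forall i j, dl ^+ 2 <= xi i j <= dl ^- 2).
Hypotheses (xih_bounds : forall i j, dl ^+ 2 <= xih i j <= dl ^- 2).
Hypothesis xih1 : forall i, avg (fun j => xih i j) = 1.
Hypothesis xih2 : forall j, avg (fun i => xih i j) = 1.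
Let zeta i j := et i j - phi i - psi j - theta.
Hypothesis xizetaZ : forall i j, `|xi i j * zeta i j| <= Z.

(** Both densities lie between dl^2 and dl^-2, so each logarithm is at most 2M/eps in absolute
    value, and w is their difference. *)
Let W := 4 * (M / eps).

Definition expansion_constant :=
  (2^-1 + Z * expR W) * (dl ^+ 2 * expR (- W)) ^- 2 + 2^-1.

(** A deterministic inequality for one sample. The kernel k cancels in xih / xi, so that w splits as
    u(x) + v(y); the marginals of xih integrate phi, psi and theta exactly. *)
Lemma sample_expansion :
  `|avg (fun i => avg (fun j => xih i j * et i j)) - theta - (avg phi + avg psi)| <=
  `|avg (fun i => avg (fun j => xi i j * zeta i j))| + expansion_constant *
    (avg (fun i => avg (fun j => xi i j - 1) ^+ 2) + avg (fun j => avg (fun i => xi i j - 1) ^+ 2) +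
     avg (fun i => avg (fun j => xi i j * zeta i j) ^+ 2) +
     avg (fun j => avg (fun i => xi i j * zeta i j) ^+ 2)).
Proof.
have dl0 : 0 < dl by exact: expR_gt0.
have d2 : 0 < dl ^+ 2 by rewrite exprn_gt0.
have xi0 i j : 0 < xi i j by have /andP[h _] := xi_bounds i j; exact: lt_le_trans h.
have xih0 i j : 0 < xih i j by have /andP[h _] := xih_bounds i j; exact: lt_le_trans h.
pose u i := ln (a i) - ln (al i); pose v j := ln (b j) - ln (be j).
have uvE i j : xi i j * expR (u i + v j) = xih i j.
  rewrite expRD !expRB !lnK ?posrE// xiE /xih.
  by field; rewrite !gt_eqF.
have lnb r : dl ^+ 2 <= r <= dl ^- 2 -> `|ln r| <= 2 * (M / eps).
  move=> /andP[h1 h2]; have r0 : 0 < r by exact: lt_le_trans h1.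
  have : ln (dl ^+ 2) <= ln r by rewrite ler_ln ?posrE.
  have : ln r <= ln (dl ^- 2) by rewrite ler_ln ?posrE// invr_gt0.
  rewrite lnV ?posrE// lnXn// expRK mulr2n => h3 h4.
  by rewrite ler_norml; apply/andP; split; lra.
have uvW i j : `|u i + v j| <= W.
  have -> : u i + v j = ln (xih i j) - ln (xi i j).
    have e : xi i j * expR (u i + v j) = xih i j by exact: uvE.
    by rewrite -e lnM ?posrE ?expR_gt0// expRK; ring.
  apply: le_trans (ler_normB _ _) _.
  apply: le_trans (lerD (lnb _ (xih_bounds i j)) (lnb _ (xi_bounds i j))) _.
  by rewrite /W; lra.
have kaxi i j : dl ^+ 2 <= xi i j by have /andP[] := xi_bounds i j.
have m1 i : avg (fun j => xi i j * expR (u i + v j)) = 1.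
  by rewrite -(xih1 i); apply: eq_avg => j; exact: uvE.
have m2 j : avg (fun i => xi i j * expR (u i + v j)) = 1.
  by rewrite -(xih2 j); apply: eq_avg => i; exact: uvE.
have := @plan_expansion R n.+1 m.+1 isT isT xi zeta u v (dl ^+ 2) W Z d2 kaxi uvW xizetaZ m1 m2.
have -> : avg (fun i => avg (fun j => xi i j * expR (u i + v j) * zeta i j)) =
    avg (fun i => avg (fun j => xih i j * et i j)) - theta - (avg phi + avg psi).
  transitivity (avg (fun i => avg (fun j => xih i j * et i j)) -
     avg (fun i => avg (fun j => xih i j * (phi i + (psi j + theta))))).
    by rewrite -avgB; apply: eq_avg => i; rewrite -avgB; apply: eq_avg => j; rewrite uvE /zeta; ring.
  rewrite -addrA -opprD; congr (_ - _).
  transitivity (avg (fun i => avg (fun j => phi i * xih i j)) + (avg (fun i => avg (fun j => xih i j * psi j)) + avg (fun i => avg (fun j => theta * xih i j)))).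
    by rewrite -!avgD; apply: eq_avg => i; rewrite -!avgD; apply: eq_avg => j; ring.
  have -> : avg (fun i => avg (fun j => phi i * xih i j)) = avg phi.
    by apply: eq_avg => i; rewrite avgZ xih1 mulr1.
  have -> : avg (fun i => avg (fun j => theta * xih i j)) = theta.
    by rewrite (@eq_avg _ _ _ (fun=> theta)) ?avg_cst// => i; rewrite avgZ xih1 mulr1.
  have -> : avg (fun i => avg (fun j => xih i j * psi j)) = avg psi.
    rewrite exchange_avg; apply: eq_avg => j.
    by under eq_avg do rewrite mulrC; rewrite avgZ xih2 mulr1.
  by ring.
by [].
Qed.

End sample_expansion.

(** * Tail bound for the remainder *)

Section plug_in_error.
Context (R : realType) (d : nat) (eps : R) (Omega : set 'rV[R]_d).
Local Notation E := (borelRd R d).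
Context (P Q : probability E R).
Context (dT : measure_display) (T : measurableType dT) (Pr : probability T R).
Context (X Y : nat -> {RV Pr >-> E}) (eta : E * E -> R).
Hypotheses (eps0 : 0 < eps) (cO : compact Omega) (PO : P Omega = 1%E) (QO : Q Omega = 1%E).
Hypotheses (lawX : forall k, has_law (X k) P) (lawY : forall j, has_law (Y j) Q).
Hypothesis indep :
  mutually_independent (fun i : nat + nat => match i with inl k => X k | inr j => Y j end).
Hypothesis eta_oo : eta \in Lfun (P \x Q)%E +oo%E.

Let hX := inv_one_sub P (fun f => op_Q eps P Q (op_P eps P Q f))
  (eta_x eps P Q eta \- op_Q eps P Q (eta_y eps P Q eta)).
Let hY := inv_one_sub Q (fun g => op_P eps P Q (op_Q eps P Q g))
  (eta_y eps P Q eta \- op_P eps P Q (eta_x eps P Q eta)).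

Definition plug_in_error n m t : R :=
  \int[eot_plan eps (empirical (fun k => X k t) n) (empirical (fun j => Y j t) m)]_z eta z
  - \int[eot_plan eps P Q]_z eta z
  - (n%:R^-1 * \sum_(k < n) hX (X k t) + m%:R^-1 * \sum_(j < m) hY (Y j t)).

Lemma measurable_plug_in_error n m : measurable_fun setT (plug_in_error n.+1 m.+1).
Proof.
have [M [_ [_ [_ [_ [_ [[M0 _ _ _] _ _ [[meta mhX mhY] _] _]]]]]]] :=
  population_projection eps0 cO PO QO eta_oo.
have mX i : measurable_fun setT (X i) by exact: measurable_funP.
have mY i : measurable_fun setT (Y i) by exact: measurable_funP.
have [a [b [_ _ mxih _ intE]]] := random_plan eps0 M0 mX mY n m.
rewrite (_ : plug_in_error _ _ = (fun t =>
  avg (fun i => avg (fun j => a t i * expR (- (2^-1 * sqdist (X i t) (Y j t)) / eps) * b t j *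
    eta (X i t, Y j t)))
  - \int[eot_plan eps P Q]_z eta z
  - (avg (fun i : 'I_n.+1 => hX (X i t)) + avg (fun j : 'I_m.+1 => hY (Y j t))))); last first.
  by apply/funext => t; rewrite /plug_in_error intE.
apply: measurable_funB; first apply: measurable_funB => //.
  apply: (measurable_avg (f := fun i t => avg _)) => i.
  apply: (measurable_avg (f := fun j t => _ * eta _)) => j.
  apply: measurable_funM; first exact: mxih.
  by apply: (measurableT_comp meta); apply/measurable_fun_pairP; split; [exact: mX|exact: mY].
apply: measurable_funD.
  by apply: (measurable_avg (f := fun i t => hX (X i t))) => i; exact: measurableT_comp.
by apply: (measurable_avg (f := fun i t => hY (Y i t))) => i; exact: measurableT_comp.
Qed.

(** Markov's inequality for a variable of expectation at most C r against the threshold delta sqrt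
    r. The constant C is independent of n, m and delta. *)
Lemma plug_in_error_tail : exists2 C, 0 <= C & forall n m r delta, 0 < delta ->
  r = n.+1%:R^-1 + m.+1%:R^-1 ->
  (Pr [set t | (delta <= `|plug_in_error n.+1 m.+1 t / Num.sqrt r|)%R]
   <= (C / delta * Num.sqrt r)%:E)%E.
Proof.
have [M [al [be [phi [psi [eta' [[M0 costM pal pbe] [xi1 xi2] [xib [bphi bpsi beta']]
  [[meta mhX mhY] [etaE hXE hYE]] [zeta1 zeta2]]]]]]]] :=
  population_projection eps0 cO PO QO eta_oo.
set theta := \int[eot_plan eps P Q]_z eta z in zeta1 zeta2.
set xi := scaled_kernel _ al be in xi1 xi2 xib zeta1 zeta2.
pose zeta z := eta' z - phi z.1 - psi z.2 - theta.
have bxi : bounded_measurable xi by apply: bmf_scaled_kernel => //; exact: bmf_gibbs.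
have bzeta : bounded_measurable zeta.
  have b1 : bounded_measurable (fun z : E * E => phi z.1) by exact: bmf_fst.
  have b2 : bounded_measurable (fun z : E * E => psi z.2) by exact: bmf_snd.
  by apply: bmfB; [apply: bmfB => //; exact: bmfB|exact: bmf_cst].
pose p1 z := xi z - 1; pose p2 z := xi z * zeta z.
have bp1 : bounded_measurable p1 by apply: bmfB => //; exact: bmf_cst.
have bp2 : bounded_measurable p2 by exact: bmfM.
have [_ [L p1L]] := bp1; have [_ [Z p2Z]] := bp2.
have p1Q x : \int[Q]_y p1 (x, y) = 0.
  by rewrite bmf_intB ?xi1 ?Rint_cst ?subrr//; [exact: (bmf_pair1 x bxi)|exact: bmf_cst].
have p1P y : \int[P]_x p1 (x, y) = 0.
  by rewrite bmf_intB ?xi2 ?Rint_cst ?subrr//; [exact: (bmf_pair2 y bxi)|exact: bmf_cst].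
have p2Q x : \int[Q]_y p2 (x, y) = 0 by exact: zeta1.
have p2P y : \int[P]_x p2 (x, y) = 0 by exact: zeta2.
pose C := expansion_constant eps M Z.
have Z0 : 0 <= Z by exact: le_trans (p2Z point).
have C0 : 0 <= C.
  rewrite /C /expansion_constant.
  set K1 := expR (4 * _); set K2 := (_ * _) ^- 2.
  have K10 : 0 <= K1 by exact: expR_ge0.
  have K20 : 0 <= K2 by rewrite invr_ge0 exprn_even_ge0.
  by rewrite addr_ge0 ?invr_ge0// mulr_ge0// addr_ge0 ?invr_ge0// mulr_ge0.
(* The first summand bounds the degenerate average, the second the four mean squares: L bounds xi -
   1 and Z bounds xi zeta. *)
pose C' := (Z ^+ 2 + 1) + C * (L ^+ 2 + Z ^+ 2).
have C'0 : 0 <= C' by rewrite addr_ge0 ?addr_ge0 ?sqr_ge0// mulr_ge0// addr_ge0 ?sqr_ge0.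
exists C' => // n m r delta delta0 rE.
have r0 : 0 < r by rewrite rE addr_gt0// invr_gt0 ltr0n.
pose D t := avg (fun i : 'I_n.+1 => avg (fun j : 'I_m.+1 => p2 (X i t, Y j t))).
pose row (p : E * E -> R) t : R := avg (fun i : 'I_n.+1 => avg (fun j : 'I_m.+1 => p (X i t, Y j t)) ^+ 2).
pose col (p : E * E -> R) t : R := avg (fun j : 'I_m.+1 => avg (fun i : 'I_n.+1 => p (X i t, Y j t)) ^+ 2).
pose S t := `|D t| + C * (row p1 t + col p1 t + row p2 t + col p2 t).
have bpXY (p : E * E -> R) i j : bounded_measurable p -> bounded_measurable (fun t => p (X i t, Y j t)).
  by move=> bp; apply: (bmf_comp _ bp); apply/measurable_fun_pairP; split; exact: measurable_funP.
have browi (p : E * E -> R) (i : 'I_n.+1) : bounded_measurable p ->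
    bounded_measurable (fun t => avg (fun j : 'I_m.+1 => p (X i t, Y j t))).
  by move=> bp; apply: (bmf_avg (f := fun j t => p (X i t, Y j t))) => j; exact: bpXY.
have bcolj (p : E * E -> R) (j : 'I_m.+1) : bounded_measurable p ->
    bounded_measurable (fun t => avg (fun i : 'I_n.+1 => p (X i t, Y j t))).
  by move=> bp; apply: (bmf_avg (f := fun i t => p (X i t, Y j t))) => i; exact: bpXY.
have bD : bounded_measurable D.
  by apply: (bmf_avg (f := fun i t => avg (fun j : 'I_m.+1 => p2 (X i t, Y j t)))) => i; exact: browi.
have brow p : bounded_measurable p -> bounded_measurable (row p).
  move=> bp; apply: (bmf_avg (f := fun i t => avg (fun j : 'I_m.+1 => p (X i t, Y j t)) ^+ 2)) => i.
  by apply: bmf_sqr; exact: browi.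
have bcol p : bounded_measurable p -> bounded_measurable (col p).
  move=> bp; apply: (bmf_avg (f := fun j t => avg (fun i : 'I_n.+1 => p (X i t, Y j t)) ^+ 2)) => i.
  by apply: bmf_sqr; exact: bcolj.
have int_avg k (f : 'I_k.+1 -> T -> R) B : (forall i, bounded_measurable (f i)) ->
    (forall i, \int[Pr]_t f i t <= B) -> \int[Pr]_t avg (fun i => f i t) <= B.
  move=> bf fB; rewrite bmf_intZ; last exact: bmf_sum.
  rewrite bmf_int_sum// -[leRHS](@avg_cst R k.+1)//.
  exact: (avg_le (f := fun i => \int[Pr]_t f i t)).
have int_row p B : bounded_measurable p -> (forall z, `|p z| <= B) ->
    (forall x, \int[Q]_y p (x, y) = 0) -> \int[Pr]_t row p t <= B ^+ 2 / m.+1%:R.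
  move=> bp pB pQ; apply: int_avg => i; first by apply: bmf_sqr; exact: browi.
  exact: (row_moment lawY indep bp pB i _ pQ).
have int_col p B : bounded_measurable p -> (forall z, `|p z| <= B) ->
    (forall y, \int[P]_x p (x, y) = 0) -> \int[Pr]_t col p t <= B ^+ 2 / n.+1%:R.
  move=> bp pB pP; apply: int_avg => j; first by apply: bmf_sqr; exact: bcolj.
  exact: (column_moment lawX indep bp pB j _ pP).
have int_D : \int[Pr]_t `|D t| <= (Z ^+ 2 + 1) * r.
  have bD2 : bounded_measurable (fun t => D t ^+ 2) by exact: bmf_sqr.
  have D2 : \int[Pr]_t (D t ^+ 2) <= Z ^+ 2 / m.+1%:R / n.+1%:R.
    exact: (double_moment lawX lawY indep bp2 p2Z (n := n.+1) (m := m.+1) isT isT p2Q p2P).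
  have b1 : bounded_measurable (fun t => r^-1 * D t ^+ 2 + r).
    by apply: bmfD; [apply: bmfM => //; exact: bmf_cst|exact: bmf_cst].
  (* The inequality |D| <= D^2 / r + r replaces Cauchy-Schwarz. The second moment of D is at most
     Z^2 / (n m), hence at most Z^2 r^2, with n and m the sample sizes. *)
  apply: (@le_trans _ _ (\int[Pr]_t (r^-1 * D t ^+ 2 + r))).
    apply: bmf_le => //; first exact: bmf_norm.
    move=> t; have : 0 <= r^-1 * (`|D t| - r) ^+ 2 by rewrite mulr_ge0 ?sqr_ge0// invr_ge0 ltW.
    have -> : r^-1 * (`|D t| - r) ^+ 2 = r^-1 * `|D t| ^+ 2 - 2 * `|D t| + r.
      by field; rewrite gt_eqF.
    rewrite real_normK ?num_real//; have := normr_ge0 (D t); lra.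
  rewrite bmf_intD; [|by apply: bmfM => //; exact: bmf_cst|exact: bmf_cst].
  rewrite bmf_intZ// Rint_cst mulrDl mul1r lerD2r mulrC ler_pdivrMr//.
  apply: le_trans D2 _; rewrite -[leLHS]mulrA -[leRHS]mulrA ler_wpM2l ?sqr_ge0//.
  have x0 : 0 < n.+1%:R^-1 :> R by rewrite invr_gt0 ltr0n.
  have y0 : 0 < m.+1%:R^-1 :> R by rewrite invr_gt0 ltr0n.
  by rewrite rE; apply: ler_pM; [exact: ltW|exact: ltW|rewrite lerDr ltW|rewrite lerDl ltW].
have bsum : bounded_measurable (fun t => row p1 t + col p1 t + row p2 t + col p2 t).
  by do !apply: bmfD; [exact: brow|exact: bcol|exact: brow|exact: bcol].
have bCsum : bounded_measurable (fun t => C * (row p1 t + col p1 t + row p2 t + col p2 t)).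
  by apply: bmfM => //; exact: bmf_cst.
have bS : bounded_measurable S by apply: bmfD => //; exact: bmf_norm.
have int_S : \int[Pr]_t S t <= C' * r.
  rewrite bmf_intD//; last exact: bmf_norm.
  rewrite /C' mulrDl; apply: lerD => //; rewrite bmf_intZ// -mulrA ler_wpM2l//.
  have br1 := brow _ bp1; have bc1 := bcol _ bp1.
  have br2 := brow _ bp2; have bc2 := bcol _ bp2.
  rewrite bmf_intD//; last by apply: bmfD => //; exact: bmfD.
  rewrite bmf_intD//; last exact: bmfD.
  rewrite bmf_intD//.
  have := int_row _ _ bp1 p1L p1Q; have := int_col _ _ bp1 p1L p1P.
  have := int_row _ _ bp2 p2Z p2Q; have := int_col _ _ bp2 p2Z p2P.
  rewrite rE mulrDl !mulrDr => h1 h2 h3 h4.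
  apply: le_trans (lerD (lerD (lerD h4 h3) h2) h1) _.
  by rewrite le_eqVlt; apply/orP; left; apply/eqP; ring.
have row0 p t : 0 <= row p t.
  by rewrite mulr_ge0 ?invr_ge0 ?ler0n// sumr_ge0// => i _; exact: sqr_ge0.
have col0 p t : 0 <= col p t.
  by rewrite mulr_ge0 ?invr_ge0 ?ler0n// sumr_ge0// => i _; exact: sqr_ge0.
have S0 t : 0 <= S t by rewrite addr_ge0 ?normr_ge0// mulr_ge0// !addr_ge0.
have mX i : measurable_fun setT (X i) by exact: measurable_funP.
have mY i : measurable_fun setT (Y i) by exact: measurable_funP.
have [a [b [ab0 marg _ xihb intE]]] := random_plan eps0 M0 mX mY n m.
have mO : measurable (Omega : set E) by exact: measurable_compact.
have goodX : \forall t \ae Pr, forall i, Omega (X i t) /\ hX (X i t) = phi (X i t).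
  by apply: ae_foralln => i; exact: (ae_law_eq (lawX i) mO PO hXE).
have goodY : \forall t \ae Pr, forall j, Omega (Y j t) /\ hY (Y j t) = psi (Y j t).
  by apply: ae_foralln => j; exact: (ae_law_eq (lawY j) mO QO hYE).
have goodXY : \forall t \ae Pr, forall i j, eta (X i t, Y j t) = eta' (X i t, Y j t).
  apply: ae_foralln => i; apply: ae_foralln => j.
  apply: (@ae_law_pair _ _ _ _ _ _ P Q X Y (fun z => eta z = eta' z)) => //.
  by apply: filterS etaE => z /(_ Logic.I).
have bound : \forall t \ae Pr, `|plug_in_error n.+1 m.+1 t| <= S t.
  apply: filterS3 goodX goodY goodXY => t gX gY gXY.
  have costXY (i : 'I_n.+1) (j : 'I_m.+1) : 2^-1 * sqdist (X i t) (Y j t) <= M.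
    by apply: costM; [case: (gX i)|case: (gY j)].
  have [a0 b0] := ab0 t; have [m1 m2] := marg t.
  have := @sample_expansion R eps M Z theta n m
    (fun i j => expR (- (2^-1 * sqdist (X i t) (Y j t)) / eps))
    (fun i j => xi (X i t, Y j t)) (fun i j => eta' (X i t, Y j t))
    (fun i => al (X i t)) (fun i => phi (X i t)) (a t)
    (fun j => be (Y j t)) (fun j => psi (Y j t)) (b t).
  move=> /(_ (fun i => positive_gt0 _ pal) (fun j => positive_gt0 _ pbe) a0 b0).
  have xiE (i : 'I_n.+1) (j : 'I_m.+1) : xi (X i t, Y j t) =
      al (X i t) * expR (- (2^-1 * sqdist (X i t) (Y j t)) / eps) * be (Y j t).
    by rewrite /xi /scaled_kernel /gibbs/= min_l.
  move=> /(_ xiE (fun i j => xib _) (xihb t costXY) m1 m2 (fun i j => p2Z _)).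
  congr (_ <= _); congr (`| _ |); rewrite /plug_in_error intE//; congr (_ - _ - (_ + _)).
  - by apply: eq_avg => i; apply: eq_avg => j; rewrite gXY.
  - by apply: eq_avg => i; have [_ ->] := gX i.
  - by apply: eq_avg => j; have [_ ->] := gY j.
have mW := measurable_plug_in_error n m.
have s0 : 0 < Num.sqrt r by rewrite sqrtr_gt0.
have mW' : measurable_fun setT (fun t => `|plug_in_error n.+1 m.+1 t / Num.sqrt r|).
  by apply: measurableT_comp => //; exact: measurable_funM.
apply: le_trans (ae_markov (mulr_gt0 delta0 s0) _ bS S0 _) _.
- exact: measurable_set_le.
- apply: filterS bound => t h /=.
  rewrite normrM [`|_^-1|]gtr0_norm ?invr_gt0// ler_pdivlMr// => h'.
  exact: le_trans h' h.
rewrite lee_fin ler_pdivrMr ?mulr_gt0//.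
apply: le_trans int_S _.
rewrite -[X in _ * X <= _](sqr_sqrtr (ltW r0)).
have -> : C' / delta * Num.sqrt r * (delta * Num.sqrt r) = C' * Num.sqrt r ^+ 2.
  by field; rewrite gt_eqF.
by [].
Qed.

End plug_in_error.

(** * Passage to the limit *)

Lemma cvg_inv_natr (R : realType) : (k%:R^-1 : R) @[k --> \oo] --> (0 : R).
Proof. by rewrite -(cvg_shiftS (fun k => k%:R^-1 : R)); exact: cvg_harmonic. Qed.

Theorem theorem3p1 (R : realType) (d : nat) (eps : R)
  (Omega : set 'rV[R]_d) (P Q : probability (borelRd R d) R)
  (dT : measure_display) (T : measurableType dT) (Pr : probability T R)
  (X Y : nat -> {RV Pr >-> borelRd R d})
  (m : nat -> nat) (lambda : R)
  (eta : borelRd R d * borelRd R d -> R) :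
  0 < eps ->
  compact Omega -> P Omega = 1%E -> Q Omega = 1%E ->
  (forall k, has_law (X k) P) -> (forall j, has_law (Y j) Q) ->
  mutually_independent
    (fun i : nat + nat => match i with inl k => X k | inr j => Y j end) ->
  m n @[n --> \oo] --> \oo ->
  (m n)%:R / (n + m n)%:R @[n --> \oo] --> lambda ->
  0 < lambda -> lambda < 1 ->
  eta \in Lfun (P \x Q)%E +oo%E ->
  let AP := op_P eps P Q in
  let AQ := op_Q eps P Q in
  let etax := eta_x eps P Q eta in
  let etay := eta_y eps P Q eta in
  let hX := inv_one_sub P (fun f => AQ (AP f)) (etax \- AQ etay) in
  let hY := inv_one_sub Q (fun g => AP (AQ g)) (etay \- AP etax) in
  little_o_prob Pr
    (fun n t =>
       let Pn := empirical (fun k => X k t) n in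
       let Qm := empirical (fun j => Y j t) (m n) in
       \int[eot_plan eps Pn Qm]_z eta z - \int[eot_plan eps P Q]_z eta z
       - (n%:R^-1 * \sum_(k < n) hX (X k t)
          + (m n)%:R^-1 * \sum_(j < m n) hY (Y j t)))
    (fun n => Num.sqrt ((n + m n)%:R / (n * m n)%:R)).
Proof.
move=> eps0 cO PO QO lawX lawY indep m_oo _ _ _ eta_oo AP AQ etax etay hX hY.
pose err := plug_in_error eps P Q X Y eta.
pose r n : R := n%:R^-1 + (m n)%:R^-1.
have scaleE n : (0 < n)%N -> (0 < m n)%N -> (n + m n)%:R / (n * m n)%:R = r n.
  move=> n0 m0; rewrite /r natrD natrM.
  by field; rewrite !pnatr_eq0 -!lt0n n0 m0.
have [C C0 tail] := plug_in_error_tail eps0 cO PO QO lawX lawY indep eta_oo.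
split.
  (* If [n] or [m n] is 0, the inverse of 0 is 0, so the normalisation is 0 and the quotient is the
     zero function. Otherwise the sizes are successors, as in [measurable_plug_in_error]. *)
  move=> n; have [n0|n0] := posnP n.
    rewrite (_ : (fun t => _) = (fun=> 0)); first exact: measurable_cst.
    by apply/funext => t; rewrite [in X in _ / X]n0 mul0n invr0 mulr0 sqrtr0 invr0 mulr0.
  have [m0|m0] := posnP (m n).
    rewrite (_ : (fun t => _) = (fun=> 0)); first exact: measurable_cst.
    by apply/funext => t; rewrite [in X in _ / X]m0 muln0 invr0 mulr0 sqrtr0 invr0 mulr0.
  apply: measurable_funM => //.
  have := measurable_plug_in_error X Y eps0 cO PO QO eta_oo n.-1 (m n).-1.
  by rewrite !prednK.
move=> delta delta0.
have r_cvg : r n @[n --> \oo] --> (0 : R).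
  rewrite -[X in _ --> X]addr0; apply: cvgD; first exact: cvg_inv_natr.
  exact: (@cvg_comp _ _ _ m (fun k => k%:R^-1 : R) _ _ _ m_oo (@cvg_inv_natr R)).
have bound_cvg : (C / delta * Num.sqrt (r n))%:E @[n --> \oo] --> 0%E.
  apply: cvg_EFin; first by apply: nearW.
  rewrite -[X in _ --> X](mulr0 (C / delta)) -sqrtr0.
  apply: cvgM; first exact: cvg_cst.
  by apply: continuous_cvg => //; exact: sqrt_continuous.
apply: squeeze_cvge (@cvg_cst _ _ _ _ _) bound_cvg.
have n_pos : \forall n \near \oo, (0 < n)%N by exact: nbhs_infty_gt.
have m_pos : \forall n \near \oo, (0 < m n)%N.
  by move/cvgnyPgt : m_oo; apply.
apply: filterS2 n_pos m_pos => n n0 m0.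
rewrite measure_ge0/=.
have := tail n.-1 (m n).-1 (r n) delta delta0; rewrite !prednK// => /(_ erefl).
apply: le_trans.
under eq_set do rewrite subr0 scaleE//.
by [].
Qed.
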